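(* Let $F\in\overline{\mathcal{F}}_{d,q}(\beta_{\min},\sigma_{\max}^2,M)$ with DAG $G=G(F)$ and modified variance gap $\overline\Delta$, let $\delta\in(0,1)$, and let $\tau$ be a given valid topological sort of $G$. Let $\widehat G(\tau)$ be the DAG returned by the parent-learning step (with ordering $\tau$) run on the sample covariance matrix of $n$ i.i.d. samples from $F$ with threshold $\gamma=\overline\Delta/2$. If $$n\gtrsim\frac{M^5}{\overline\Delta}\Big(q\log\frac dq+\log\frac1\delta\Big),$$ then $P(\widehat G(\tau)=G(F)\mid\tau)\gtrsim1-\delta$.
   Context: Model. $X=(X_1,\dots,X_d)$ satisfies $X=B^\top X+\epsilon$, where $B=(\beta_{jk})\in\mathbb{R}^{d\times d}$ and $\epsilon=(\epsilon_1,\dots,\epsilon_d)$ has independent components $\epsilon_k\sim N(0,\sigma_k^2)$, the variances being allowed to depend on $k$. The directed graph $G(B)$ on $V=[d]$ has an edge $j\to k$ iff $\beta_{jk}\neq0$, and is assumed acyclic; $\mathrm{pa}(k)$ is the set of parents of $k$, $\mathrm{de}(k)$ the set of nodes reachable from $k$ by a directed path, and $\mathrm{nd}(k)=V\setminus\mathrm{de}(k)$ the nondescendants (a node $k$ is not regarded as one of its own nondescendants). A topological sort $\tau$ of $G$ is an ordering of $V$ such that $j\to k$ implies $j$ precedes $k$. Class. For $\beta_{\min}>0$, $\sigma_{\max}^2>0$, $M>1$, $1\le q\le d$, $\overline{\mathcal{F}}_{d,q}(\beta_{\min},\sigma_{\max}^2,M)$ is the class of such Gaussian models $F$ (with $G(F)=G(B)$)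 for which $|\mathrm{pa}(k)|\le q$ for all $k$, $|\beta_{jk}|\ge\beta_{\min}$ whenever $\beta_{jk}\ne0$, $\Sigma=\mathbb{E}[XX^\top]$ satisfies $M^{-1}\le\lambda_{\min}(\Sigma)\le\lambda_{\max}(\Sigma)\le M$, and $\sup_k\sigma_k^2\le\sigma_{\max}^2$. Modified variance gap. $$\overline\Delta=\min_k\ \min_{\substack{A\subseteq\mathrm{nd}(k)\\ \mathrm{pa}(k)\setminus A\ne\emptyset}}\ \mathbb{E}_A\,\mathrm{var}(X_k\mid X_A)-\sigma_k^2 .$$ Parent-learning step (inputs: $\widehat\Sigma=\frac1n\sum_{i=1}^nX_iX_i^\top$ where here $X_1,\dots,X_n\in\mathbb{R}^d$ are the samples; threshold $\gamma$; in-degree bound $q$; ordering $\tau$). Put $v_{kC}=\widehat\Sigma_{kk}-\widehat\Sigma_{kC}\widehat\Sigma_{CC}^{-1}\widehat\Sigma_{Ck}$. For $j=1,\dots,d$ let $C_j=\arg\min_{C\subseteq\{\tau_1,\dots,\tau_{j-1}\},|C|\le q}v_{\tau_jC}$ and set $\mathrm{pa}_{\widehat G}(\tau_j)=C_j\setminus\{i\in C_j:|v_{\tau_jC_j}-v_{\tau_j,C_j\setminus\{i\}}|\le\gamma\}$. The output is the resulting DAG $\widehat G(\tau)$. Conventions. $P(\cdot\mid\tau)$ only emphasizes that the estimator has access to the true ordering $\tau$. The hypothesis $n\gtrsim E$ means $n\ge C\,E$ for a sufficiently large universal constant $C$; the conclusion $p\gtrsim1-\delta$ means $p\ge c(1-\delta)$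 for a universal constant $c>0$.
   Formalization: The factor log(d/q) in the sample-size condition is replaced by max(1, log(d/q)); with log(d/q) itself the claim fails as q approaches d (q = d: disjoint pairs of nodes, each with or without an edge of weight 1, fixed n and growing d). *)

(* Defs.v *)
From HB Require Import structures.
From mathcomp Require Import all_boot all_order all_fingroup all_algebra.
From mathcomp Require Import all_classical all_reals all_analysis.

Set Implicit Arguments.
Unset Strict Implicit.
Unset Printing Implicit Defensive.

Import Order.TTheory GRing.Theory Num.Theory.
Import numFieldNormedType.Exports.

Local Open Scope classical_set_scope.
Local Open Scope ring_scope.

(** * Probability: independence and conditioning on a sub-sigma-algebra *)

Section Probability.
Context {disp : measure_display} {T : measurableType disp} {R : realType}.
Variable P : probability T R.

Definition mutually_independent {disp' : measure_display}
    {S : measurableType disp'} {I : finType} (Z : I -> T -> S) : Prop :=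
  forall (J : {set I}) (E : I -> set S), (forall i, measurable (E i)) ->
    P (\bigcap_(i in [set` J]) (Z i @^-1` E i)) =
    (\prod_(i in J) P (Z i @^-1` E i))%E.

Definition is_cond_exp (G : set (set T)) (Z Y : T -> R) : Prop :=
  [/\ P.-integrable setT (EFin \o Y),
      forall E : set R, measurable E -> G (Y @^-1` E)
    & forall A, G A ->
        (\int[P]_(w in A) (Y w)%:E = \int[P]_(w in A) (Z w)%:E)%E].

(* An arbitrary version, unique up to a P-null set; it exists whenever [Z] is
   integrable and [G] is a sub-sigma-algebra of [measurable]. *)
Definition cond_exp (G : set (set T)) (Z : T -> R) : T -> R :=
  xget (cst 0) [set Y | is_cond_exp G Z Y].

Definition cond_var (G : set (set T)) (Z : T -> R) : T -> R :=
  cond_exp G (fun w => (Z w - cond_exp G Z w) ^+ 2).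

Definition sigma_gen {I : finType} (Z : I -> T -> R) (A : {set I}) :
    set (set T) :=
  <<s \bigcup_(i in [set` A]) preimage_set_system setT (Z i) measurable >>.

End Probability.

(** * Graphs *)

Section Graph.
Context {R : realType} {d : nat}.
Variable B : 'M[R]_d.

Definition edge : rel 'I_d := fun j k => B j k != 0.

Definition dag : {set 'I_d * 'I_d} := [set e | edge e.1 e.2].

Definition acyclic : Prop := forall j k, edge j k -> ~~ connect edge k j.

Definition pa (k : 'I_d) : {set 'I_d} := [set j | edge j k].

(* [connect] is reflexive, so [k] is not a nondescendant of itself. *)
Definition nd (k : 'I_d) : {set 'I_d} := [set j | ~~ connect edge k j].

(* [tau i] is the node in position [i] of the ordering. *)
Definition topological_sort (tau : {perm 'I_d}) : Prop :=
  forall i j : 'I_d, edge (tau i) (tau j) -> (i < j)%N.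

End Graph.

(** * The Gaussian model *)

Definition col_of_tuple {R : realType} {d : nat} (x : d.-tuple R) : 'cV[R]_d :=
  \col_k tnth x k.

Definition lambda_min {R : realType} {d : nat} (A : 'M[R]_d) : R :=
  inf [set a | eigenvalue A a].

Definition lambda_max {R : realType} {d : nat} (A : 'M[R]_d) : R :=
  sup [set a | eigenvalue A a].

Section Model.
Context {disp : measure_display} {T : measurableType disp} {R : realType}.
Context {P : probability T R} {d : nat}.
Variable X : {RV P >-> d.-tuple R}.

Definition coord (k : 'I_d) : T -> R := fun w => tnth (X w) k.

Definition covariance_matrix : 'M[R]_d :=
  \matrix_(i, j) fine 'E_P[fun w => coord i w * coord j w].

Variables (B : 'M[R]_d) (sigma : 'I_d -> R).

(* [sigma k] is the standard deviation, which is also the second parameter of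
   [normal_prob].  Requiring it to be positive loses nothing below, since a
   vanishing noise variance makes the covariance matrix singular. *)
Definition gaussian_sem : Prop :=
  [/\ acyclic B,
      forall k, 0 < sigma k
    & exists eps : {RV P >-> d.-tuple R},
        [/\ mutually_independent P (fun k w => tnth (eps w) k),
            forall k (E : set R), measurable E ->
              P ((fun w => tnth (eps w) k) @^-1` E) =
              normal_prob 0 (sigma k) E
          & forall w, col_of_tuple (X w) =
              B^T *m col_of_tuple (X w) + col_of_tuple (eps w)]].

(* The class \overline{F}_{d,q}(beta_min, sigma_max^2, M). *)
Definition model_class (q : nat) (beta_min sigma2_max M : R) : Prop :=
  gaussian_sem /\
  [/\ forall k, (#|pa B k| <= q)%N,
      forall j k, B j k != 0 -> beta_min <= `|B j k|,
      [/\ M^-1 <= lambda_min covariance_matrix,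
          lambda_min covariance_matrix <= lambda_max covariance_matrix
        & lambda_max covariance_matrix <= M]
    & forall k, sigma k ^+ 2 <= sigma2_max].

(* The minimum over an empty index set is +oo: this happens exactly when the
   graph has no edge. *)
Definition variance_gap : \bar R :=
  (\big[mine/+oo]_(k < d)
     \big[mine/+oo]_(A : {set 'I_d} |
         (A \subset nd B k) && (pa B k :\: A != finset.set0))
       ('E_P[cond_var P (sigma_gen coord A) (coord k)] - (sigma k ^+ 2)%:E))%E.

End Model.

(** * Samples and the parent-learning step *)

Definition iid_samples {disp0 disp : measure_display}
    {T0 : measurableType disp0} {T : measurableType disp} {R : realType}
    {P0 : probability T0 R} {P : probability T R} {d n : nat}
    (X : {RV P0 >-> d.-tuple R}) (Xs : 'I_n -> {RV P >-> d.-tuple R}) : Prop :=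
  mutually_independent P Xs /\
  forall i (E : set (d.-tuple R)), measurable E ->
    distribution P (Xs i) E = distribution P0 X E.

Definition sample_covariance {R : realType} {d n : nat}
    (x : 'I_n -> d.-tuple R) : 'M[R]_d :=
  n%:R^-1 *: \sum_(i < n) (col_of_tuple (x i) *m (col_of_tuple (x i))^T).

Section ParentLearning.
Context {R : realType} {d : nat}.
Variables (S : 'M[R]_d) (gamma : \bar R) (q : nat) (tau : {perm 'I_d}).

Definition block (A C : {set 'I_d}) : 'M[R]_(#|A|, #|C|) :=
  \matrix_(i, j) S (enum_val i) (enum_val j).

Definition block_row (k : 'I_d) (C : {set 'I_d}) : 'rV[R]_#|C| :=
  \row_j S k (enum_val j).

Definition block_col (C : {set 'I_d}) (k : 'I_d) : 'cV[R]_#|C| :=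
  \col_i S (enum_val i) k.

(* [invmx] is the identity on singular matrices, so this is the intended
   quantity when the block indexed by [C] is invertible. *)
Definition resid_var (k : 'I_d) (C : {set 'I_d}) : R :=
  S k k - (block_row k C *m invmx (block C C) *m block_col C k) 0 0.

Definition predecessors (j : 'I_d) : {set 'I_d} :=
  [set tau i | i : 'I_d & (i < j)%N].

(* Ties are broken by the choice operator behind [arg min]. *)
Definition best_subset (j : 'I_d) : {set 'I_d} :=
  [arg min_(C < finset.set0 | (C \subset predecessors j) && (#|C| <= q)%N)
     resid_var (tau j) C]%O.

Definition learned_parents (j : 'I_d) : {set 'I_d} :=
  let C := best_subset j in
  C :\: [set i in C |
    (`|resid_var (tau j) C - resid_var (tau j) (C :\ i)|%:E <= gamma)%E].

Definition learned_dag : {set 'I_d * 'I_d} :=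
  [set e | e.1 \in learned_parents ((tau^-1)%g e.2)].

End ParentLearning.

(** * The sample-size rate *)

(* The factor log(d/q) of the rate q log(d/q), with the usual convention that
   such a logarithm is at least 1: it equals ln (d/q) when q <= d/e, and
   q * log_ratio d q is, up to constants, the log-number of subsets of size at
   most q.  The bare ln (d/q) tends to 0 as q approaches d; at q = d the sample
   size would then not grow with d, and exact recovery would be impossible for
   every estimator (take d/2 disjoint pairs of nodes, each with or without an
   edge of weight 1, and unit noise variances). *)
Definition log_ratio {R : realType} (d q : nat) : R :=
  Num.max 1 (ln (d%:R / q%:R)).

(* Main.v *)
From HB Require Import structures.
Require Import Defs.
From mathcomp Require Import all_boot all_order all_fingroup all_algebra.
From mathcomp Require Import all_classical all_reals all_analysis.
From mathcomp Require Import measurable_realfun.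
From mathcomp Require Import ring lra zify.

Set Implicit Arguments.
Unset Strict Implicit.
Unset Printing Implicit Defensive.

Import Order.TTheory GRing.Theory Num.Theory.
Import numFieldNormedType.Exports.

Local Open Scope classical_set_scope.
Local Open Scope ring_scope.

Import HBNNSimple.

(** Write r_k = e_k - b_k, where b_k is the k-th column of B, so that r_k . X is
   the noise of k, and let S and Sg be the sample and the population covariance,
   read as quadratic forms.  Completing the square, the residual variance v_kC is
   the minimum over the w supported on C of S(e_k - w), and e_k - w = r_k + z
   with z = b_k - w.

   In the population, r_k is Sg-orthogonal to every combination of nondescendants,
   so Sg(r_k + z) = sigma_k^2 + Sg(z).  When C contains all parents, z = 0 is
   available; when a parent is missing, Sg(z) is at least the variance gap,
   because conditional expectation, the best predictor in mean square, can only do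
   better than the linear predictor w ([variance_gap_le]).  The learned graph is
   therefore correct as soon as
     S(z) + 2 S(r_k, z) >= 0.6 Sg(z) - Delta / 20
   for all k and all z with at most 2q nonzero entries, located at predecessors of
   k ([learned_dag_correct]).

   For this, S(z) >= 0.8 Sg(z) is a bound of fixed relative precision.  The cross
   term vanishes in the population, since r_k . X is independent of z . X; by the
   arithmetic-geometric inequality it is enough that
   S(r_k, z)^2 <= Delta Sg(z) / 100, a precision of order sqrt Delta on a quantity
   that fluctuates like 1 / sqrt n.  This is what makes n of order 1 / Delta
   sufficient, instead of 1 / Delta^2.  Both bounds concern quadratic forms in z
   (the second one is of rank one), and a form that is small on the sparse lattice
   points of a ball is small on all sparse vectors ([sparse_net_bound],
   [sparse_excess]).

   For one vector u, S(u) is an average of independent copies of (u . X)^2, the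
   square of a Gaussian variable, and a Chernoff bound gives the deviations
   ([qform_concentration]).  There are at most exp(54 q log (d / q)) lattice points
   ([card_net_le]), so a union bound leaves a failure probability of at most one
   half ([recovery_probability]); since the claim is up to a universal factor,
   this settles every delta in (0, 1).

   Two boundary cases remain.  Without edges the gap and the threshold are
   infinite and the empty graph is returned; a gap equal to zero makes the
   required sample size infinite.  That the gap is nonnegative is again a
   projection argument: the noise of k has conditional mean zero given all the
   other noise variables ([expectation_cond_var_ge]). *)

(** * Integrals of nonnegative functions of random variables *)

Lemma nnsfun_approx_cvg {disp : measure_display} {S : measurableType disp}
    {R : realType} (g : S -> R)
    (mg : measurable_fun [set: S] (EFin \o g)) (s : S) :
  (forall s, 0 <= g s) ->
  nnsfun_approx measurableT mg n s @[n --> \oo] --> g s.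
Proof.
move=> g0; pose g_ := nnsfun_approx measurableT mg.
have /fine_cvgP[_ /=] : EFin \o g_^~ s @ \oo --> (EFin \o g) s.
  by apply: cvg_nnsfun_approx => // x _; rewrite /= lee_fin.
exact.
Qed.

Section Density.
Context {disp disp' : measure_display} {T : measurableType disp}.
Context {S : measurableType disp'} {R : realType}.
Variables (P : {measure set T -> \bar R}) (Z : T -> S) (W : T -> R).
Hypotheses (mZ : measurable_fun setT Z) (mW : measurable_fun setT W).
Hypothesis W0 : forall w, 0 <= W w.

Lemma integral_nnsfun_density (f : {nnsfun S >-> R}) :
  (\int[P]_w (f (Z w) * W w)%:E =
   \sum_(r \in range f)
     (if (0 <= r)%R then r%:E * \int[P]_w (\1_(f @^-1` [set r]) (Z w) * W w)%:E
      else 0))%E.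
Proof.
have mI r : measurable_fun setT (fun w => \1_(f @^-1` [set r]) (Z w) : R).
  by apply: measurableT_comp => //; exact: measurable_indic.
rewrite (eq_integral (fun w => \sum_(r \in range f)
    (r%:E * (\1_(f @^-1` [set r]) (Z w) * W w)%:E))%E); last first.
  move=> w _; rewrite [X in (X * _)%:E]fimfunE.
  rewrite fsbig_finite//= mulr_suml -sumEFin [in RHS]fsbig_finite//=.
  by apply: eq_bigr => r _; rewrite -mulrA EFinM.
rewrite ge0_integral_fsum//; last 2 first.
- move=> r; apply: measurable_funeM; apply/measurable_EFinP.
  exact: measurable_funM.
- move=> r w _; rewrite -EFinM mulrA lee_fin mulr_ge0//.
  exact: nnfun_muleindic_ge0.
rewrite fsbig_finite//= [in RHS]fsbig_finite//=; apply: eq_bigr => r _.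
have [r0|r0] := leP 0 r.
  rewrite ge0_integralZl//.
  - by apply/measurable_EFinP; exact: measurable_funM.
  - by move=> w _; rewrite lee_fin mulr_ge0.
rewrite (preimage_nnfun0 f r0) integral0_eq// => w _.
by rewrite indic0 mul0r mule0.
Qed.

Lemma integral_density_lim (g : S -> R)
    (mg : measurable_fun [set: S] (EFin \o g)) : (forall s, 0 <= g s) ->
  (\int[P]_w (g (Z w) * W w)%:E =
   limn (fun n => \int[P]_w (nnsfun_approx measurableT mg n (Z w) * W w)%:E))%E.
Proof.
move=> g0; rewrite -monotone_convergence//.
- apply: eq_integral => w _; apply/esym/cvg_lim => //.
  by apply: cvg_EFin; [exact: nearW|apply: cvgMr_tmp; exact: nnsfun_approx_cvg].
- move=> n; apply/measurable_EFinP; apply: measurable_funM => //.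
  exact: measurableT_comp.
- by move=> n w _; rewrite lee_fin mulr_ge0.
- move=> w _ m n mn; rewrite lee_fin ler_wpM2r//.
  exact/lefP/nd_nnsfun_approx.
Qed.

End Density.

(** The weights are what makes this usable for induction on the factors of a
   product and for densities: the product of the other factors, or the density,
   serves as the weight. *)
Lemma ge0_eq_integral_density {disp1 disp2 disp' : measure_display}
    {T1 : measurableType disp1} {T2 : measurableType disp2}
    {S : measurableType disp'} {R : realType}
    (P1 : {measure set T1 -> \bar R}) (P2 : {measure set T2 -> \bar R})
    (Z1 : T1 -> S) (Z2 : T2 -> S) (W1 : T1 -> R) (W2 : T2 -> R) (g : S -> R) :
  measurable_fun setT Z1 -> measurable_fun setT Z2 ->
  measurable_fun setT W1 -> measurable_fun setT W2 ->
  (forall w, 0 <= W1 w) -> (forall w, 0 <= W2 w) ->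
  (forall E, measurable E -> (\int[P1]_w (\1_E (Z1 w) * W1 w)%:E =
                              \int[P2]_w (\1_E (Z2 w) * W2 w)%:E)%E) ->
  measurable_fun setT g -> (forall s, 0 <= g s) ->
  (\int[P1]_w (g (Z1 w) * W1 w)%:E = \int[P2]_w (g (Z2 w) * W2 w)%:E)%E.
Proof.
move=> mZ1 mZ2 mW1 mW2 W10 W20 hE mg g0.
have /measurable_EFinP mgE := mg.
rewrite (integral_density_lim P1 mZ1 mW1 W10 mgE)//.
rewrite (integral_density_lim P2 mZ2 mW2 W20 mgE)//.
congr (limn _); apply/funext => n.
rewrite !integral_nnsfun_density//; apply: eq_fsbigr => r _.
by case: ifP => // r0; rewrite hE.
Qed.

Lemma ge0_integral_density {disp disp' : measure_display}
    {T : measurableType disp} {S : measurableType disp'} {R : realType}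
    (P : {measure set T -> \bar R}) (Q : {measure set S -> \bar R})
    (Z : T -> S) (W : T -> R) (g : S -> R) :
  measurable_fun setT Z -> measurable_fun setT W -> (forall w, 0 <= W w) ->
  (forall E, measurable E -> (\int[P]_w (\1_E (Z w) * W w)%:E = Q E)%E) ->
  measurable_fun setT g -> (forall s, 0 <= g s) ->
  (\int[P]_w (g (Z w) * W w)%:E = \int[Q]_s (g s)%:E)%E.
Proof.
move=> mZ mW W0 hE mg g0.
rewrite (@ge0_eq_integral_density _ _ _ _ _ _ _ P Q Z id W (cst 1))//.
  by apply: eq_integral => s _; rewrite /= mulr1.
move=> E mE; rewrite hE// -[X in Q X]setIT -(integral_indic Q measurableT mE).
by apply: eq_integral => s _; rewrite /= mulr1.
Qed.

Lemma ge0_integral_indep_ext {disp disp' : measure_display}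
    {T : measurableType disp} {S : measurableType disp'} {R : realType}
    (P : probability T R) (Z : {mfun T >-> S}) (W : T -> R) (c : R)
    (g : S -> R) :
  measurable_fun setT W -> (forall w, 0 <= W w) -> 0 <= c ->
  (forall E, measurable E ->
    (\int[P]_w (\1_E (Z w) * W w)%:E = c%:E * P (Z @^-1` E))%E) ->
  measurable_fun setT g -> (forall s, 0 <= g s) ->
  (\int[P]_w (g (Z w) * W w)%:E = c%:E * \int[P]_w (g (Z w))%:E)%E.
Proof.
move=> mW W0 c0 hE mg g0.
have mgE : measurable_fun setT (fun s => (g s)%:E) by exact/measurable_EFinP.
rewrite (@ge0_integral_density _ _ _ _ _ P
  (mscale (NngNum c0) (distribution P Z)))//.
rewrite ge0_integral_mscale//=; last by move=> s _; rewrite lee_fin.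
by rewrite ge0_integral_distribution// => s; rewrite lee_fin.
Qed.

Lemma prod_fin_num {R : realType} {I : finType} (A : pred I)
    (a : I -> \bar R) :
  (forall i, a i \is a fin_num) -> (\prod_(i | A i) a i)%E \is a fin_num.
Proof. by move=> ha; elim/big_ind: _ => // x y; exact: fin_numM. Qed.

(** Starting from indicators, where this is the definition of independence, the
   functions are replaced one at a time: with all other factors as a weight, both
   sides are measures in the set that defines the current indicator. *)
Theorem indep_integral_prod {disp disp' : measure_display}
    {T : measurableType disp} {S : measurableType disp'} {R : realType}
    (P : probability T R) {I : finType} (Z : I -> T -> S) (f : I -> S -> R) :
  (forall i, measurable_fun setT (Z i)) -> mutually_independent P Z ->
  (forall i, measurable_fun setT (f i)) -> (forall i s, 0 <= f i s) ->
  (forall i, (\int[P]_w (f i (Z i w))%:E < +oo)%E) ->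
  (\int[P]_w (\prod_i f i (Z i w))%:E = \prod_i \int[P]_w (f i (Z i w))%:E)%E.
Proof.
move=> mZ iZ.
suff H (s : seq I) : forall f : I -> S -> R,
    (forall i, i \notin s -> exists2 E, measurable E & f i = \1_E) ->
    (forall i, measurable_fun setT (f i)) -> (forall i s, 0 <= f i s) ->
    (forall i, (\int[P]_w (f i (Z i w))%:E < +oo)%E) ->
    (\int[P]_w (\prod_i f i (Z i w))%:E =
     \prod_i \int[P]_w (f i (Z i w))%:E)%E.
  by apply: (H (enum I)) => i; rewrite mem_enum inE.
have mZE i E : measurable E -> measurable (Z i @^-1` E).
  by move=> mE; rewrite -[X in measurable X]setTI; exact: mZ.
have intZE i E : measurable E -> (\int[P]_w (\1_E (Z i w))%:E = P (Z i @^-1` E))%E.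
  by move=> mE; have := integral_indic P measurableT (mZE i E mE); rewrite setIT.
elim: s => [|i0 s IH] {}f hf mf f0 ff.
  have /choice[E hE] : forall i, exists E, measurable E /\ f i = \1_E.
    by move=> i; have [E] := hf i isT; exists E.
  have mE i : measurable (E i) by have [] := hE i.
  have fE i : f i = \1_(E i) by have [] := hE i.
  under [in RHS]eq_bigr do rewrite fE intZE//.
  have := iZ finset.setT E mE.
  under [X in _ = X -> _]eq_bigl do rewrite finset.in_setT.
  move=> <-.
  have mB : measurable (\bigcap_(i in [set` [set: I]%SET]) (Z i @^-1` E i)).
    by apply: fin_bigcap_measurable => // i _; exact: mZE.
  rewrite -[X in P X]setIT -(integral_indic P measurableT mB).
  apply: eq_integral => w _; congr (_%:E); rewrite indicE.
  under eq_bigr do rewrite fE.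
  have [wB|wB] := boolP (w \in _).
    rewrite big1// => i _; rewrite indicE mem_set//.
    by move/set_mem: wB; apply => //=; rewrite finset.in_setT.
  have [i wEi] : exists i, ~ E i (Z i w).
    apply/existsNP => h; move/negP: wB; apply; apply/mem_set => i _; exact: h.
  by rewrite (bigD1 i)//= indicE memNset// mul0r.
have fin_f i : (\int[P]_w (f i (Z i w))%:E)%E \is a fin_num.
  by rewrite ge0_fin_numE// integral_ge0// => w _; rewrite lee_fin.
pose c := fine (\prod_(i | i != i0) \int[P]_w (f i (Z i w))%:E)%E.
have cE : c%:E = (\prod_(i | i != i0) \int[P]_w (f i (Z i w))%:E)%E.
  by rewrite fineK// prod_fin_num.
rewrite [RHS](bigD1 i0)//= -cE.
under eq_integral do rewrite (bigD1 i0)//=.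
pose Z0 : {mfun T >-> S} := HB.pack (Z i0) (isMeasurableFun.Build _ _ _ _ _ (mZ i0)).
rewrite muleC; apply: (@ge0_integral_indep_ext _ _ _ _ _ _ Z0
  (fun w => \prod_(i | i != i0) f i (Z i w))) => //.
- under eq_fun do rewrite -big_filter.
  by apply: measurable_prod => i _; exact: measurableT_comp.
- by move=> w; apply: prodr_ge0.
- by rewrite /c fine_ge0// prode_ge0// => i _; apply: integral_ge0 => w _; rewrite lee_fin.
move=> E mE; rewrite muleC.
pose f' i := if i == i0 then \1_E else f i.
have f'N i : i != i0 -> f' i = f i by rewrite /f' => /negPf ->.
have f'0 : f' i0 = \1_E by rewrite /f' eqxx.
have := IH f'; rewrite [X in _ -> _ -> _ -> _ -> _ = X](bigD1 i0)//= f'0 intZE//.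
rewrite cE => IH'.
under [in RHS]eq_bigr => i ii0 do rewrite -(f'N i ii0).
rewrite -IH'.
- apply: eq_integral => w _; congr (_%:E); rewrite [RHS](bigD1 i0)//= f'0.
  by congr (_ * _); apply: eq_bigr => i ii0; rewrite f'N.
- move=> i si; have [->|ii0] := eqVneq i i0; first by exists E.
  by rewrite f'N//; apply: hf; rewrite inE negb_or ii0.
- by move=> i; rewrite /f'; case: ifP => // _; exact: measurable_indic.
- by move=> i t; rewrite /f'; case: ifP => // _.
- move=> i; have [->|ii0] := eqVneq i i0; last by rewrite f'N.
  by rewrite f'0 intZE// (le_lt_trans (probability_le1 _ (mZE _ _ _))) ?ltry.
Qed.

(** * Exponential moments of the normal law *)

Lemma integral_normal_probE {R : realType} (m s : R) (g : R -> R) :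
  measurable_fun setT g -> (forall x, 0 <= g x) ->
  (\int[normal_prob m s]_x (g x)%:E =
   \int[lebesgue_measure]_x (g x * normal_pdf m s x)%:E)%E.
Proof.
move=> mg g0; apply/esym; apply: (@ge0_integral_density _ _ _ _ R
   lebesgue_measure (normal_prob m s) id (normal_pdf m s) g) => //.
- exact: measurable_normal_pdf.
- by move=> x; exact: normal_pdf_ge0.
move=> E mE; rewrite /normal_prob [RHS]integral_mkcond.
apply: eq_integral => x _; rewrite /= patchE indicE.
by case: ifP => _; rewrite ?mul1r ?mul0r.
Qed.

Lemma normal_mgf {R : realType} (s t : R) : s != 0 ->
  (\int[normal_prob 0 s]_x (expR (t * x))%:E
   = (expR (t ^+ 2 * s ^+ 2 / 2))%:E)%E.
Proof.
move=> s0; rewrite integral_normal_probE//; last first.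
  by apply: measurableT_comp => //; exact: measurable_funM.
have E x : expR (t * x) * normal_pdf 0 s x =
    expR (t ^+ 2 * s ^+ 2 / 2) * normal_pdf (t * s ^+ 2) s x.
  rewrite /normal_pdf (negPf s0) /normal_fun mulrCA [RHS]mulrCA -!expRD.
  congr (_ * expR _); field.
  by rewrite s0.
under eq_integral do rewrite E EFinM.
rewrite ge0_integralZl ?integral_normal_pdf ?mule1//; last 2 first.
- by apply/measurable_EFinP; exact: measurable_normal_pdf.
- by move=> x _; rewrite lee_fin normal_pdf_ge0.
Qed.

(** The factor turns the density of N(0, s^2) into a multiple of that of
   N(0, (r s)^2): every exponential moment of the square is read off from the
   normalisation of the Gaussian density. *)
Lemma normal_expR_sqr {R : realType} (s r : R) : 0 < s -> 0 < r ->
  (\int[normal_prob 0 s]_x (expR ((1 - r ^- 2) / (2 * s ^+ 2) * x ^+ 2))%:E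
   = r%:E)%E.
Proof.
move=> s0 r0; rewrite integral_normal_probE//; last first.
  by apply: measurableT_comp => //; exact: measurable_funM.
have s0' := lt0r_neq0 s0; have r0' := lt0r_neq0 r0.
have rs0 : r * s != 0 by rewrite mulf_neq0.
have E x : expR ((1 - r ^- 2) / (2 * s ^+ 2) * x ^+ 2) * normal_pdf 0 s x =
    r * normal_pdf 0 (r * s) x.
  rewrite /normal_pdf (negPf s0') (negPf rs0) /normal_fun /normal_peak mulrCA.
  rewrite -expRD [RHS]mulrA; congr (_ * expR _); last first.
    by field; rewrite s0' r0'.
  have -> : Num.sqrt ((r * s) ^+ 2 * pi *+ 2) = r * Num.sqrt (s ^+ 2 * pi *+ 2).
    by rewrite exprMn -mulrA -mulrnAr sqrtrM ?sqr_ge0// sqrtr_sqr gtr0_norm.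
  by rewrite invfM mulrA divff// mul1r.
under eq_integral do rewrite E EFinM.
rewrite ge0_integralZl ?integral_normal_pdf ?mule1//; last 3 first.
- by apply/measurable_EFinP; exact: measurable_normal_pdf.
- by move=> x _; rewrite lee_fin normal_pdf_ge0.
- exact: ltW.
Qed.

(** * Integrability and finite sums *)

Section RealIntegrals.
Context {disp : measure_display} {T : measurableType disp} {R : realType}.
Variable P : {measure set T -> \bar R}.
Implicit Types f g : T -> R.

Lemma integrableR_le f g : measurable_fun setT f ->
  (forall w, `|f w| <= g w) -> P.-integrable setT (EFin \o g) ->
  P.-integrable setT (EFin \o f).
Proof.
move=> mf fg; apply: le_integrable => //; first exact/measurable_EFinP.
by move=> w _; rewrite /= lee_fin (le_trans (fg w)) ?ler_norm.
Qed.

Lemma integrableR_lty f : measurable_fun setT f -> (forall w, 0 <= f w) ->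
  (\int[P]_w (f w)%:E < +oo)%E -> P.-integrable setT (EFin \o f).
Proof.
move=> mf f0 ff; apply/integrableP; split; first exact/measurable_EFinP.
by under eq_integral do rewrite /= ger0_norm//.
Qed.

Lemma integrableR_sum {I : Type} (s : seq I) (f : I -> T -> R) :
  (forall i, P.-integrable setT (EFin \o f i)) ->
  P.-integrable setT (fun w => (\sum_(i <- s) f i w)%:E).
Proof.
move=> hf; have := integrable_sum measurableT s (P := predT) (fun i _ => hf i).
by apply: eq_integrable => // w _; rewrite -sumEFin.
Qed.

Lemma integrableR_Zl f r : P.-integrable setT (EFin \o f) ->
  P.-integrable setT (fun w => (r * f w)%:E).
Proof. exact: integrableZl. Qed.

Lemma integrableR_D f g : P.-integrable setT (EFin \o f) ->
  P.-integrable setT (EFin \o g) -> P.-integrable setT (fun w => (f w + g w)%:E).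
Proof. by move=> hf hg; exact: (integrableD measurableT hf hg). Qed.

Lemma Rintegral_sum {I : Type} (s : seq I) (f : I -> T -> R) :
  (forall i, P.-integrable setT (EFin \o f i)) ->
  \int[P]_w (\sum_(i <- s) f i w) = \sum_(i <- s) \int[P]_w f i w.
Proof.
move=> hf; elim: s => [|i s IH].
  rewrite big_nil; under eq_Rintegral do rewrite big_nil.
  by rewrite /Rintegral integral0.
rewrite big_cons -IH -RintegralD//; last exact: integrableR_sum.
by apply: eq_Rintegral => w _; rewrite big_cons.
Qed.

Lemma EFin_Rintegral f : P.-integrable setT (EFin \o f) ->
  (\int[P]_w f w)%:E = (\int[P]_w (f w)%:E)%E.
Proof. by move=> hf; rewrite fineK//; exact: integrable_fin_num. Qed.

End RealIntegrals.

Lemma Rintegral_prob_cst {disp : measure_display} {T : measurableType disp}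
  {R : realType} (P : probability T R) (r : R) : \int[P]_w r = r.
Proof.
by rewrite Rintegral_cst// [X in fine X](@probability_setT _ _ _ P) mulr1.
Qed.

(** * Linear combinations of independent centred Gaussian variables *)

Definition gaussian_noise {disp : measure_display} {T : measurableType disp}
    {R : realType} {I : finType} (P : probability T R) (E : I -> T -> R)
    (s : I -> R) : Prop :=
  [/\ forall i, 0 < s i, forall i, measurable_fun setT (E i),
      mutually_independent P E
    & forall i (A : set R), measurable A ->
        P (E i @^-1` A) = normal_prob 0 (s i) A].

Section GaussianNoise.
Context {disp : measure_display} {T : measurableType disp} {R : realType}.
Context {I : finType}.
Variables (P : probability T R) (E : I -> T -> R) (s : I -> R).
Hypothesis noiseE : gaussian_noise P E s.

Definition noise_comb (c : I -> R) (w : T) : R := \sum_i c i * E i w.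

Definition comb_var (c : I -> R) : R := \sum_i c i ^+ 2 * s i ^+ 2.

Lemma noise_gt0 i : 0 < s i. Proof. by case: noiseE. Qed.

Lemma measurable_noise i : measurable_fun setT (E i).
Proof. by case: noiseE. Qed.

Lemma measurable_noise_comb c : measurable_fun setT (noise_comb c).
Proof.
by apply: measurable_sum => i; apply: measurable_funM => //; exact: measurable_noise.
Qed.

Lemma comb_var_ge0 c : 0 <= comb_var c.
Proof. by apply: sumr_ge0 => i _; rewrite mulr_ge0 ?sqr_ge0. Qed.

Lemma integral_noise i (g : R -> R) :
  measurable_fun setT g -> (forall x, 0 <= g x) ->
  (\int[P]_w (g (E i w))%:E = \int[normal_prob 0 (s i)]_x (g x)%:E)%E.
Proof.
move=> mg g0; have [_ mE _ lawE] := noiseE.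
transitivity (\int[P]_w (g (E i w) * cst 1 w)%:E)%E.
  by apply: eq_integral => w _; rewrite mulr1.
apply: (ge0_integral_density (Q := normal_prob 0 (s i))) => //.
  exact: mE.
move=> A mA; transitivity (P (E i @^-1` A)); last exact: lawE.
have mEA : measurable (E i @^-1` A).
  by rewrite -[X in measurable X]setTI; exact: mE.
have := integral_indic P measurableT mEA; rewrite setIT => <-.
by apply: eq_integral => w _; rewrite /= mulr1.
Qed.

Lemma noise_comb_mgf c t :
  (\int[P]_w (expR (t * noise_comb c w))%:E
   = (expR (t ^+ 2 * comb_var c / 2))%:E)%E.
Proof.
have [s0 mE iE _] := noiseE.
have mexp a : measurable_fun setT (fun x : R => expR (a * x)).
  by apply: measurableT_comp => //; exact: measurable_funM.
have mgfE i : (\int[P]_w (expR (t * c i * E i w))%:E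
    = (expR ((t * c i) ^+ 2 * s i ^+ 2 / 2))%:E)%E.
  rewrite (@integral_noise i (fun x => expR (t * c i * x)))// ?normal_mgf//.
  by rewrite lt0r_neq0.
have h : (\int[P]_w (\prod_i expR (t * c i * E i w))%:E =
    \prod_i (expR ((t * c i) ^+ 2 * s i ^+ 2 / 2))%:E)%E.
  rewrite (@indep_integral_prod _ _ _ _ _ P I E
    (fun i x => expR (t * c i * x)))//; first exact: eq_bigr.
  by move=> i; rewrite mgfE ltry.
rewrite [in RHS](_ : t ^+ 2 * _ / 2 =
   \sum_i (t * c i) ^+ 2 * s i ^+ 2 / 2); last first.
  rewrite /comb_var mulr_sumr mulr_suml; apply: eq_bigr => i _.
  by rewrite exprMn !mulrA.
rewrite expR_sum -prodEFin -h.
apply: eq_integral => w _; rewrite -expR_sum; congr (expR _)%:E.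
by rewrite mulr_sumr; apply: eq_bigr => i _; rewrite mulrA.
Qed.

(** Writing exp(a y^2) itself as a Gaussian mixture of exponentials exp(b y)
   linearises the square, so the moment generating function suffices. *)
Lemma noise_comb_expR_sqr c r : 0 < comb_var c -> 1 < r ->
  (\int[P]_w (expR ((1 - r ^- 2) / (2 * comb_var c) * noise_comb c w ^+ 2))%:E
   = r%:E)%E.
Proof.
move=> v0 r1; have r0 : 0 < r by apply: lt_trans r1.
have r2 : 0 <= 1 - r ^- 2.
  by rewrite subr_ge0 invf_le1 ?exprn_gt0// exprn_ege1// ltW.
pose b := Num.sqrt ((1 - r ^- 2) / comb_var c).
have b2 : b ^+ 2 = (1 - r ^- 2) / comb_var c by rewrite sqr_sqrtr// divr_ge0// ltW.
have mixE y : (expR ((1 - r ^- 2) / (2 * comb_var c) * y ^+ 2))%:E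
    = (\int[normal_prob 0 1]_g (expR (b * y * g))%:E)%E.
  rewrite normal_mgf//; congr (expR _)%:E.
  by rewrite exprMn b2; field; rewrite !lt0r_neq0.
under eq_integral do rewrite mixE.
have mC := measurable_noise_comb c.
rewrite (@fubini_tonelli _ _ _ _ _ P (normal_prob 0 1)
  (fun z => (expR (b * noise_comb c z.1 * z.2))%:E)); last 2 first.
- apply/measurable_EFinP; apply: measurableT_comp => //.
  apply: measurable_funM => //; apply: measurable_funM => //.
  exact: measurableT_comp.
- by move=> z; rewrite lee_fin expR_ge0.
transitivity (\int[normal_prob 0 1]_g
    (expR ((1 - r ^- 2) / (2 * 1 ^+ 2) * g ^+ 2))%:E)%E; last first.
  by rewrite normal_expR_sqr.
apply: eq_integral => g _.
transitivity (\int[P]_w (expR (b * g * noise_comb c w))%:E)%E.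
  by apply: eq_integral => w _; rewrite /= mulrAC.
rewrite noise_comb_mgf; congr (expR _)%:E.
by rewrite exprMn b2; field; rewrite !lt0r_neq0.
Qed.

(** Since a y^2 <= exp(a y^2) - 1, an exponential moment with r > 1 bounds the
   second moment from above; the bound is sharp as r tends to 1. *)
Lemma noise_comb_sqr_le c :
  (\int[P]_w (noise_comb c w ^+ 2)%:E <= (comb_var c)%:E)%E.
Proof.
have mC := measurable_noise_comb c.
have [v0|] := ltP 0 (comb_var c); last first.
  move=> v0; have {}v0 : comb_var c = 0.
    by apply/eqP; rewrite eq_le v0 comb_var_ge0.
  rewrite v0 integral0_eq// => w _; congr (_%:E).
  rewrite /noise_comb big1 ?expr0n// => i _.
  have /eqP : c i ^+ 2 * s i ^+ 2 = 0.
    move/eqP: v0; rewrite psumr_eq0; last by move=> j _; rewrite mulr_ge0 ?sqr_ge0.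
    by move/allP => /(_ i); rewrite mem_index_enum => /(_ isT) /eqP.
  rewrite mulf_eq0 !sqrf_eq0 (gt_eqF (noise_gt0 i)) orbF => /eqP ->.
  by rewrite mul0r.
set x := (\int[P]_w _)%E.
have x0 : (0 <= x)%E by apply: integral_ge0 => w _; rewrite lee_fin sqr_ge0.
have H r : 1 < r -> (x <= (2 * comb_var c * r ^+ 2 / (r + 1))%:E)%E.
  move=> r1; have r0 : 0 < r by apply: lt_trans r1.
  set a := (1 - r ^- 2) / (2 * comb_var c).
  have a0 : 0 < a.
    rewrite divr_gt0 ?mulr_gt0// subr_gt0 invf_lt1 ?exprn_gt0//.
    by rewrite exprn_egt1// ltW.
  have : (1 + a%:E * x <= r%:E)%E.
    rewrite -(noise_comb_expR_sqr v0 r1) -/a.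
    rewrite -(@ge0_integralZl_EFin _ _ _ P _ measurableT); last 3 first.
    - by move=> w _; rewrite lee_fin sqr_ge0.
    - exact/measurable_EFinP/measurable_funX.
    - exact: ltW.
    rewrite -(@probability_setT _ _ _ P) -[X in (X + _)%E]mul1e.
    rewrite -(integral_cst P measurableT) -ge0_integralD//; last 2 first.
    - by move=> w _; rewrite mule_ge0 ?lee_fin ?sqr_ge0// ltW.
    - apply: measurable_funeM; exact/measurable_EFinP/measurable_funX.
    apply: ge0_le_integral => //.
    - by move=> w _; rewrite adde_ge0// mule_ge0 ?lee_fin ?sqr_ge0// ltW.
    - apply: emeasurable_funD => //.
      by apply: measurable_funeM; exact/measurable_EFinP/measurable_funX.
    - apply/measurable_EFinP; apply: measurableT_comp => //.
      by apply: measurable_funM => //; exact: measurable_funX.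
    - by move=> w _; rewrite -EFinM -EFinD lee_fin expR_ge1Dx.
  rewrite -leeBrDl// -EFinB -lee_pdivlMl// => /le_trans; apply.
  rewrite -EFinM lee_fin le_eqVlt; apply/orP; left; apply/eqP; rewrite /a; field.
  by rewrite !lt0r_neq0//; [rewrite subr_gt0 exprn_egt1|exact: addr_gt0].
have xfin : x \is a fin_num.
  by rewrite ge0_fin_numE// (le_lt_trans (H 2 _)) ?ltry// ltr1n.
rewrite -(fineK xfin) lee_fin; apply/ler_addgt0Pr => e e0.
have [r [r1 ->]] : exists r, 1 < r /\ e = (r - 1) * (2 * comb_var c).
  exists (1 + e / (2 * comb_var c)); rewrite ltrDl divr_gt0 ?mulr_gt0//.
  by rewrite addrAC subrr add0r divfK// lt0r_neq0// mulr_gt0.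
rewrite -lee_fin fineK// (le_trans (H _ r1))// lee_fin.
have r0 : 0 < r + 1 by rewrite addr_gt0// (lt_trans _ r1).
have vr : 0 < comb_var c * (r - 1) by rewrite mulr_gt0// subr_gt0.
rewrite ler_pdivrMr//; nra.
Qed.

(** The lower half of the variance of a coordinate: the exponential moments
   with r < 1 bound the second moment from below. *)
Lemma noise_sqr_ge i : ((s i ^+ 2)%:E <= \int[P]_w (E i w ^+ 2)%:E)%E.
Proof.
have mE := measurable_noise i; have s0 := noise_gt0 i.
have s2 : 0 < s i ^+ 2 by rewrite exprn_gt0.
set x := (\int[P]_w _)%E.
have x0 : (0 <= x)%E by apply: integral_ge0 => w _; rewrite lee_fin sqr_ge0.
have H r : 0 < r < 1 -> ((2 * s i ^+ 2 * r ^+ 2 / (r + 1))%:E <= x)%E.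
  move=> /andP[r0 r1].
  set a := (1 - r ^- 2) / (2 * s i ^+ 2).
  have a0 : 0 < - a.
    by rewrite -mulNr divr_gt0 ?mulr_gt0// opprB subr_gt0 invf_gt1 ?exprn_gt0//
      exprn_ilt1// ltW.
  have : (1 <= r%:E + (- a)%:E * x)%E.
    have mexp : measurable_fun setT (fun y : R => expR (a * y ^+ 2)).
      by apply: measurableT_comp => //; apply: measurable_funM.
    rewrite -(normal_expR_sqr s0 r0) -/a.
    rewrite -(@integral_noise i (fun y => expR (a * y ^+ 2)))//.
    have mexpE : measurable_fun setT (fun w => (expR (a * E i w ^+ 2))%:E).
      by apply/measurable_EFinP; apply: (measurableT_comp mexp).
    rewrite -(@ge0_integralZl_EFin _ _ _ P _ measurableT); last 3 first.
    - by move=> w _; rewrite lee_fin sqr_ge0.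
    - exact/measurable_EFinP/measurable_funX.
    - exact: ltW.
    rewrite -(@probability_setT _ _ _ P) -[X in (X <= _)%E]mul1e.
    rewrite -(integral_cst P measurableT) -ge0_integralD//; last 2 first.
    - by move=> w _; rewrite mule_ge0 ?lee_fin ?sqr_ge0// ltW.
    - apply: measurable_funeM; exact/measurable_EFinP/measurable_funX.
    apply: ge0_le_integral => //.
    - apply: emeasurable_funD => //.
      by apply: measurable_funeM; exact/measurable_EFinP/measurable_funX.
    - move=> w _; rewrite -EFinM -EFinD lee_fin -lerBlDr mulNr opprK.
      exact: expR_ge1Dx.
  rewrite -leeBlDl// -EFinB -lee_pdivrMl//; apply: le_trans.
  rewrite -EFinM lee_fin le_eqVlt; apply/orP; left; apply/eqP; rewrite /a; field.
  rewrite (lt0r_neq0 s0) (lt0r_neq0 r0) (lt0r_neq0 (addr_gt0 r0 _))// andbT.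
  by rewrite subr_eq0 lt_eqF// exprn_ilt1// ltW.
have [xfin|] := boolP (x \is a fin_num); last first.
  by rewrite ge0_fin_numE// -leNgt leye_eq => /eqP ->; rewrite leey.
rewrite -(fineK xfin) lee_fin; apply/ler_addgt0Pr => e e0.
have [r [/andP[r0 r1] er]] : exists r, 0 < r < 1 /\ (1 - r) * (2 * s i ^+ 2) <= e.
  exists (1 - Num.min (2^-1) (e / (2 * s i ^+ 2))); split.
    rewrite gtrBl lt_min invr_gt0// divr_gt0 ?mulr_gt0//= subr_gt0.
    by rewrite ltr0n gt_min invf_lt1 ?ltr1n ?ltr0n.
  rewrite opprB addrC subrK -ler_pdivlMr ?mulr_gt0//.
  by rewrite ge_min lexx orbT.
have := H r; rewrite r0 r1 => /(_ isT); rewrite -(fineK xfin) lee_fin => {}H.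
rewrite (le_trans _ (lerD H er))//.
have r10 : 0 < r + 1 by rewrite addr_gt0.
rewrite -lerBlDr ler_pdivlMr//.
have : 0 < s i ^+ 2 * (1 - r) by rewrite mulr_gt0// subr_gt0.
nra.
Qed.

Lemma comb_var_pair i j a b : i != j ->
  let c := fun k => a * (k == i)%:R + b * (k == j)%:R in
  comb_var c = a ^+ 2 * s i ^+ 2 + b ^+ 2 * s j ^+ 2.
Proof.
move=> ij c; rewrite /comb_var (bigD1 i)//= (bigD1 j) ?(eq_sym j)//=.
rewrite /c /= !eqxx ?(eq_sym j i) !(negPf ij) !mulr1 !mulr0 addr0 add0r.
rewrite big1 ?addr0// => k /andP[ki kj].
by rewrite (negPf ki) (negPf kj) !mulr0 addr0 expr0n mul0r.
Qed.

Lemma noise_comb_pair i j a b w : i != j ->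
  noise_comb (fun k => a * (k == i)%:R + b * (k == j)%:R) w
  = a * E i w + b * E j w.
Proof.
move=> ij; rewrite /noise_comb (bigD1 i)//= (bigD1 j) ?(eq_sym j)//=.
rewrite !eqxx ?(eq_sym j i) !(negPf ij) !mulr1 !mulr0 addr0 add0r.
rewrite big1 ?addr0// => k /andP[ki kj].
by rewrite (negPf ki) (negPf kj) !mulr0 addr0 mul0r.
Qed.

Lemma integrable_noise_comb_sqr c :
  P.-integrable setT (fun w => (noise_comb c w ^+ 2)%:E).
Proof.
apply: (@integrableR_lty _ _ _ P (fun w => noise_comb c w ^+ 2)).
- exact/measurable_funX/measurable_noise_comb.
- by move=> w; exact: sqr_ge0.
- by rewrite (le_lt_trans (noise_comb_sqr_le c)) ?ltry.
Qed.

Lemma noise_comb1 i w : noise_comb (fun k => (k == i)%:R) w = E i w.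
Proof.
rewrite /noise_comb (bigD1 i)//= eqxx mul1r big1 ?addr0// => k /negPf ->.
by rewrite mul0r.
Qed.

Lemma comb_var1 i : comb_var (fun k => (k == i)%:R) = s i ^+ 2.
Proof.
rewrite /comb_var (bigD1 i)//= eqxx expr1n mul1r big1 ?addr0// => k /negPf ->.
by rewrite expr0n mul0r.
Qed.

Lemma integrable_noise_sqr i : P.-integrable setT (fun w => (E i w ^+ 2)%:E).
Proof.
have := integrable_noise_comb_sqr (fun k => (k == i)%:R).
by apply: eq_integrable => // w _; rewrite noise_comb1.
Qed.

Lemma integrable_noiseM i j : P.-integrable setT (fun w => (E i w * E j w)%:E).
Proof.
apply: (@integrableR_le _ _ _ P _ (fun w => E i w ^+ 2 + E j w ^+ 2)).
- by apply: measurable_funM; exact: measurable_noise.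
- move=> w; rewrite normrM -(real_normK (num_real (E i w))).
  rewrite -(real_normK (num_real (E j w))).
  have := sqr_ge0 (`|E i w| - `|E j w|).
  have := normr_ge0 (E i w); have := normr_ge0 (E j w); nra.
- by apply: integrableR_D; exact: integrable_noise_sqr.
Qed.

Lemma noise_sqr i : \int[P]_w (E i w ^+ 2) = s i ^+ 2.
Proof.
apply/eqP; rewrite eq_le -!lee_fin EFin_Rintegral ?noise_sqr_ge ?andbT//; last first.
  exact: integrable_noise_sqr.
rewrite -comb_var1 (le_trans _ (noise_comb_sqr_le _))// le_eqVlt; apply/orP; left.
by apply/eqP/eq_integral => w _; rewrite noise_comb1.
Qed.

(** The bound on the variance of a combination, applied to the sum and to the
   difference of two coordinates, leaves no room for a correlation. *)
Lemma noise_cross i j : i != j -> \int[P]_w (E i w * E j w) = 0.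
Proof.
move=> ij.
have key b : b ^+ 2 = 1 -> b * \int[P]_w (E i w * E j w) <= 0.
  move=> b2; have := noise_comb_sqr_le (fun k => 1 * (k == i)%:R + b * (k == j)%:R).
  rewrite comb_var_pair// -EFin_Rintegral; last exact: integrable_noise_comb_sqr.
  rewrite lee_fin expr1n b2 !mul1r.
  rewrite (eq_Rintegral P (g := fun w => (E i w ^+ 2 + E j w ^+ 2)
      + 2 * b * (E i w * E j w))); last first.
    move=> w _; rewrite noise_comb_pair// mul1r sqrrD exprMn b2 mul1r.
    by rewrite addrAC; congr (_ + _); ring.
  rewrite RintegralD//; last 2 first.
  - by apply: integrableR_D; exact: integrable_noise_sqr.
  - by apply: integrableR_Zl; exact: integrable_noiseM.
  rewrite RintegralD//; try exact: integrable_noise_sqr.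
  rewrite RintegralZl//; last exact: integrable_noiseM.
  by rewrite !noise_sqr -lerBrDl subrr -mulrA (pmulr_rle0 _ (ltr0n _ 2)).
have := key 1 (expr1n _ _); have := key (-1) (sqrr_sign _ 1).
rewrite mulN1r mul1r; lra.
Qed.

Lemma noise_comb_cov c c' :
  \int[P]_w (noise_comb c w * noise_comb c' w)
  = \sum_i c i * c' i * s i ^+ 2.
Proof.
rewrite (eq_Rintegral P (g := fun w => \sum_i \sum_j
    (c i * c' j) * (E i w * E j w))); last first.
  move=> w _; rewrite /noise_comb mulr_suml; apply: eq_bigr => i _.
  by rewrite mulr_sumr; apply: eq_bigr => j _; rewrite mulrACA.
have h i j : P.-integrable setT
    (EFin \o (fun w => (c i * c' j) * (E i w * E j w))).
  by apply: integrableR_Zl; exact: integrable_noiseM.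
rewrite Rintegral_sum; last by move=> i; exact: integrableR_sum.
apply: eq_bigr => i _; rewrite Rintegral_sum//.
rewrite (bigD1 i)//= RintegralZl//; last exact: integrable_noiseM.
rewrite big1 => [|j ji].
  by under eq_Rintegral do rewrite -expr2; rewrite noise_sqr addr0.
by rewrite RintegralZl ?noise_cross ?mulr0// 1?eq_sym//; exact: integrable_noiseM.
Qed.

Lemma noise_comb_sqr c : \int[P]_w (noise_comb c w ^+ 2) = comb_var c.
Proof.
by under eq_Rintegral do rewrite expr2; rewrite noise_comb_cov.
Qed.

End GaussianNoise.

(** * Concentration of empirical second moments *)

Lemma expR_le_quadratic {R : realType} (x : R) :
  expR x <= 1 + x + x ^+ 2 * expR `|x|.
Proof.
have h y : expR y * (1 - y) <= 1 :> R.
  by rewrite mulrC -ler_pdivlMr ?expR_gt0// div1r -expRN expR_ge1Dx.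
have hx := h x; have e1 := expR_ge1Dx x.
have [x0|x0] := leP 0 x.
  have hm : x * (expR x * (1 - x)) <= x * 1 by rewrite ler_wpM2l.
  rewrite ger0_norm//; nra.
have ee : 1 <= expR `|x| by rewrite -expR0 ler_expR.
have : x ^+ 2 * 1 <= x ^+ 2 * expR `|x| by rewrite ler_wpM2l ?sqr_ge0.
have : x * expR x <= x * (1 + x) by rewrite ler_wnM2l// ltW.
nra.
Qed.

Section ChiSquare.
Context {disp : measure_display} {T : measurableType disp} {R : realType}.
Context {I : finType}.
Variables (P : probability T R) (E : I -> T -> R) (s : I -> R).
Hypothesis noiseE : gaussian_noise P E s.

(** The linear term of [expR_le_quadratic] integrates to zero, and the quadratic
   one is dominated by the exponential moment at r = 2, whose value is explicit. *)
Lemma noise_comb_chi_mgf (c : I -> R) (a : R) :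
  let v := comb_var s c in 0 < v -> `|a| <= 8^-1 ->
  (\int[P]_w (expR (a * (noise_comb E c w ^+ 2 / v - 1)))%:E
   <= (expR (128 * a ^+ 2))%:E)%E.
Proof.
move=> v v0 a8; pose Y := noise_comb E c; pose W w := Y w ^+ 2 / v - 1.
have mY : measurable_fun setT Y by exact: (measurable_noise_comb noiseE).
have mY2 : measurable_fun setT (fun w => Y w ^+ 2) by exact: measurable_funX.
have mW : measurable_fun setT W.
  by apply: measurable_funB => //; apply: measurable_funM.
pose b := (1 - 2 ^- 2) / (2 * v).
pose U w := expR (b * Y w ^+ 2).
have mU : measurable_fun setT U.
  by apply: measurableT_comp => //; apply: measurable_funM.
have IU : (\int[P]_w (U w)%:E = 2%:E)%E.
  exact: (@noise_comb_expR_sqr _ _ _ _ P E s noiseE c 2 v0 (ltr1n R 2)).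
have iU : P.-integrable setT (EFin \o U).
  by apply: integrableR_lty => // [w|]; rewrite ?expR_ge0// IU ltry.
have iY2 : P.-integrable setT (EFin \o (fun w => Y w ^+ 2)).
  exact: (integrable_noise_comb_sqr noiseE).
have iW : P.-integrable setT (EFin \o W).
  have -> : W = (fun w => v^-1 * Y w ^+ 2 + (-1)).
    by apply/funext => w; rewrite /W mulrC.
  apply: integrableR_D; first exact: integrableR_Zl.
  exact: finite_measure_integrable_cst.
(* W^2 <= 32 exp(|W|/4), |a W| <= |W|/8, exp(3|W|/8) <= 8/5 U; 52 > 32 * 8/5. *)
have pw w : expR (a * W w) <= 1 + a * W w + 52 * a ^+ 2 * U w.
  apply: (le_trans (expR_le_quadratic _)); rewrite lerD2l exprMn.
  have aW : `|a * W w| <= `|W w| / 8 by rewrite normrM mulrC ler_wpM2l.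
  have W2 : W w ^+ 2 <= 32 * expR (`|W w| / 4).
    have := @expR_ge1Dxn _ (`|W w| / 4) 1 (divr_ge0 (normr_ge0 _) (ler0n _ _)).
    rewrite expr_div_n real_normK ?num_real//.
    rewrite (_ : 2`!%:R = 2 :> R)//; lra.
  have WU : expR (`|W w| / 4) * expR (`|W w| / 8) <= 8 / 5 * U w.
    rewrite -expRD (_ : _ + _ = 3 / 8 * `|W w|); last by field.
    apply: (@le_trans _ _ (expR (3 / 8 + b * Y w ^+ 2))).
      rewrite ler_expR (_ : b * Y w ^+ 2 = 3 / 8 * (Y w ^+ 2 / v)); last first.
        by rewrite /b; field; rewrite lt0r_neq0.
      have y0 : 0 <= Y w ^+ 2 / v by rewrite divr_ge0 ?sqr_ge0// ltW.
      have : `|W w| <= Y w ^+ 2 / v + 1.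
        by rewrite /W ler_norml; apply/andP; split; lra.
      lra.
    rewrite expRD ler_wpM2r ?expR_ge0//.
    have h : 5 / 8 <= (expR (3 / 8))^-1 :> R.
      by rewrite -expRN; have := expR_ge1Dx (- (3 / 8) : R); lra.
    have := ler_wpM2r (expR_ge0 (3 / 8)) h.
    by rewrite mulVf ?gt_eqF ?expR_gt0//; lra.
  have h1 : W w ^+ 2 * expR `|a * W w| <= 52 * U w.
    apply: (@le_trans _ _ (32 * expR (`|W w| / 4) * expR (`|W w| / 8))).
      by apply: ler_pM; rewrite ?sqr_ge0 ?expR_ge0// ler_expR.
    have := expR_ge0 (b * Y w ^+ 2); rewrite -/(U w); lra.
  by have := ler_wpM2l (sqr_ge0 a) h1; lra.
have IW : \int[P]_w W w = 0.
  have -> : W = (fun w => v^-1 * Y w ^+ 2 + (-1)).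
    by apply/funext => w; rewrite /W mulrC.
  rewrite RintegralD//; last 2 first.
  - exact: integrableR_Zl.
  - exact: finite_measure_integrable_cst.
  rewrite RintegralZl// (noise_comb_sqr noiseE) mulVf ?lt0r_neq0//.
  by rewrite Rintegral_prob_cst subrr.
have iaW : P.-integrable setT (EFin \o (fun w => a * W w)) by exact: integrableR_Zl.
have i1 : P.-integrable setT (EFin \o (fun=> 1 : R)).
  exact: finite_measure_integrable_cst.
have i1W : P.-integrable setT (EFin \o (fun w => 1 + a * W w)).
  exact: integrableR_D.
have iUU : P.-integrable setT (EFin \o (fun w => 52 * a ^+ 2 * U w)).
  exact: integrableR_Zl.
have ibd : P.-integrable setT (EFin \o (fun w => 1 + a * W w + 52 * a ^+ 2 * U w)).
  exact: integrableR_D.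
apply: (@le_trans _ _ (\int[P]_w (1 + a * W w + 52 * a ^+ 2 * U w)%:E)%E).
  apply: ge0_le_integral => //.
  - by apply/measurable_EFinP/measurableT_comp => //; exact: measurable_funM.
  - exact: measurable_int ibd.
  - by move=> w _; exact: pw.
rewrite -(EFin_Rintegral ibd) lee_fin !RintegralD// !RintegralZl// IW.
have -> : \int[P]_w U w = 2 by rewrite /Rintegral IU.
rewrite Rintegral_prob_cst mulr0 addr0.
apply: (le_trans _ (expR_ge1Dx _)); rewrite lerD2l.
have := sqr_ge0 a; lra.
Qed.

End ChiSquare.

(** The exponential Markov inequality for the sum and for its opposite; the slope
   a = t / 256 minimises the exponent 128 a^2 - a t. *)
Lemma iid_sum_concentration {disp0 disp disp' : measure_display}
    {T0 : measurableType disp0} {T : measurableType disp}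
    {S : measurableType disp'} {R : realType} (P0 : probability T0 R)
    (P : probability T R) {n : nat} (X : {mfun T0 >-> S})
    (Z : 'I_n -> {mfun T >-> S}) (g : S -> R) (t : R) :
  mutually_independent P (fun i => Z i : T -> S) ->
  (forall i E, measurable E -> distribution P (Z i) E = distribution P0 X E) ->
  measurable_fun setT g ->
  (forall a, `|a| <= 8^-1 ->
    (\int[P0]_w (expR (a * g (X w)))%:E <= (expR (128 * a ^+ 2))%:E)%E) ->
  0 <= t <= 1 ->
  (P [set w | n%:R * t <= `|\sum_i g (Z i w)|]%R
    <= (2 * expR (- (n%:R * t ^+ 2 / 512)))%:E)%E.
Proof.
move=> iZ lZ mg hg /andP[t0 t1].
have mgZ i : measurable_fun setT (fun w => g (Z i w)) by exact: measurableT_comp.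
have mS : measurable_fun setT (fun w => \sum_i g (Z i w)) by exact: measurable_sum.
have side (b : R) : `|b| = 1 ->
    measurable [set w | n%:R * t <= b * \sum_i g (Z i w)] /\
    (P [set w | n%:R * t <= b * \sum_i g (Z i w)]%R
      <= (expR (- (n%:R * t ^+ 2 / 512)))%:E)%E.
  move=> b1; set A := [set w | _].
  have mA : measurable A.
    rewrite -[X in measurable X]setTI; apply: measurable_fun_le => //.
    exact: measurable_funM.
  split => //.
  pose a := b * (t / 256).
  have a8 : `|a| <= 8^-1.
    by rewrite normrM b1 mul1r ger0_norm; lra.
  have a2 : a ^+ 2 = (t / 256) ^+ 2.
    by rewrite exprMn -(real_normK (num_real b)) b1 expr1n mul1r.
  have law i : (\int[P]_w (expR (a * g (Z i w)))%:E <= (expR (128 * a ^+ 2))%:E)%E.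
    have mexp : measurable_fun setT (fun s => (expR (a * g s))%:E).
      by apply/measurable_EFinP/measurableT_comp => //; exact: measurable_funM.
    rewrite -(@ge0_integral_distribution _ _ _ _ _ P (Z i)
      (fun s => (expR (a * g s))%:E))//.
    rewrite (eq_measure_integral (distribution P0 X)); last first.
      by move=> E mE _; exact: lZ.
    rewrite ge0_integral_distribution//.
    exact: hg.
  have prodE : (\int[P]_w (\prod_i expR (a * g (Z i w)))%:E
      <= (expR (128 * a ^+ 2 * n%:R))%:E)%E.
    rewrite (@indep_integral_prod _ _ _ _ _ P _ (fun i => Z i : T -> S)
       (fun i s => expR (a * g s)))//.
    - rewrite expRM_natr -[in leRHS](card_ord n) -prodr_const -prodEFin.
      suff /andP[] : (0 <= \prod_i \int[P]_w (expR (a * g (Z i w)))%:E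
         <= \prod_(i in 'I_n) (expR (128 * a ^+ 2))%:E)%E by [].
      apply: (big_ind2 (fun x y : \bar R => 0 <= x <= y)%E).
      - by rewrite lexx lee01.
      - move=> x1 x2 y1 y2 /andP[x0 x12] /andP[y0 y12].
        by rewrite mule_ge0//= lee_pmul.
      - move=> i _; rewrite law andbT.
        by apply: integral_ge0 => w _; rewrite lee_fin expR_ge0.
    - by move=> i; apply/measurableT_comp => //; exact: measurable_funM.
    - by move=> i; rewrite (le_lt_trans (law i)) ?ltry.
  have : ((expR (t / 256 * (n%:R * t)))%:E * P A
      <= (expR (128 * a ^+ 2 * n%:R))%:E)%E.
    apply: le_trans prodE.
    have := integral_indic P measurableT mA; rewrite setIT => <-.
    rewrite -ge0_integralZl//; last first.
      by apply/measurable_EFinP; exact: measurable_indic.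
    apply: ge0_le_integral => //.
    - by apply: measurable_funeM; apply/measurable_EFinP; exact: measurable_indic.
    - apply/measurable_EFinP; apply: measurable_prod => i _.
      by apply/measurableT_comp => //; exact: measurable_funM.
    move=> w _; rewrite -EFinM lee_fin indicE -expR_sum -mulr_sumr.
    have [/set_mem wA|_] := boolP (w \in A); last by rewrite mulr0 expR_ge0.
    rewrite mulr1 ler_expR /a [b * _]mulrC -[leRHS]mulrA.
    by rewrite ler_wpM2l ?divr_ge0.
  rewrite -lee_pdivlMl ?expR_gt0// => /le_trans; apply.
  rewrite -expRN -EFinM -expRD lee_fin ler_expR a2.
  lra.
have [mA PA] := side 1 (normr1 _); have [mB PB] := side (-1) (normrN1 _).
have -> : [set w | n%:R * t <= `|\sum_i g (Z i w)|] =
    [set w | n%:R * t <= 1 * \sum_i g (Z i w)] `|`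
    [set w | n%:R * t <= -1 * \sum_i g (Z i w)].
  apply/seteqP; split => w /=; rewrite mul1r mulN1r.
    by case: (ler0P (\sum_i _)) => _ ?; [right|left].
  by case=> /le_trans; apply; rewrite ?ler_norm// -normrN ler_norm.
rewrite (le_trans (measureU2 _ mA mB))// mulrDl mul1r EFinD.
exact: leeD.
Qed.

(** * Conditional expectation *)

Section CondExp.
Context {disp : measure_display} {T : measurableType disp} {R : realType}.
Variables (P : probability T R) (C : set (set T)).
Hypothesis C_measurable : C `<=` measurable.

Let S := g_sigma_algebraType C.

Lemma g_sigma_measurable (A : set T) : <<s C >> A -> measurable A.
Proof.
apply: smallest_sub => //; split; first exact: measurable0.
- by move=> B mB; rewrite setTD; exact: measurableC.
- by move=> F mF; exact: bigcupT_measurable.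
Qed.

Lemma g_sigma_measurable_id : measurable_fun setT (id : T -> S).
Proof. by move=> _ A mA; rewrite setTI; exact: g_sigma_measurable. Qed.

Lemma g_sigma_measurable_fun {disp' : measure_display}
    {U : measurableType disp'} (h : T -> U) :
  measurable_fun setT (h : S -> U) -> measurable_fun setT h.
Proof. by move=> mh; apply: (measurableT_comp mh g_sigma_measurable_id). Qed.

Lemma is_cond_exp_measurable (Z Y : T -> R) :
  is_cond_exp P <<s C >> Z Y -> measurable_fun setT (Y : S -> R).
Proof. by move=> [_ mY _] _ E mE; rewrite setTI; exact: mY. Qed.

(** On the sub-sigma-algebra, the charge with density [Z] is dominated by the
   restriction of [P]; the derivative is a conditional expectation. *)
Lemma cond_exp_exists (Z : T -> R) : P.-integrable setT (EFin \o Z) ->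
  is_cond_exp P <<s C >> Z (cond_exp P <<s C >> Z).
Proof.
move=> iZ; rewrite /cond_exp; case: xgetP => [Y _ //|/(_ _) none].
exfalso; pose idS : {mfun T >-> S} :=
  HB.pack (id : T -> S) (isMeasurableFun.Build _ _ _ _ _ g_sigma_measurable_id).
pose mu : probability S R := distribution P idS.
pose nu0 : {charge set T -> \bar R} := induced_charge iZ.
pose nu_of : {charge set S -> \bar R} := pushforward nu0 idS.
pose nu : {charge set S -> \bar R} := nu_of g_sigma_measurable_id.
have nu_mu : nu `<< mu.
  apply/null_content_dominatesP => A mA muA.
  have mA' := g_sigma_measurable mA.
  apply: (@null_set_integral _ _ _ P) => //.
  by apply: measurable_funTS; exact: measurable_int iZ.
have [f fE] : exists f : S -> R, [/\ mu.-integrable setT (EFin \o f)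
    & forall A, measurable A -> nu A = (\int[mu]_(x in A) (f x)%:E)%E].
  exists (fine \o Radon_Nikodym nu mu).
  have finRN x := Radon_Nikodym_fin_num x nu_mu.
  have E : EFin \o (fine \o Radon_Nikodym nu mu) = Radon_Nikodym nu mu.
    by apply/funext => x; rewrite /= fineK.
  split; first by rewrite E; exact: Radon_Nikodym_integrable.
  by move=> A mA; rewrite [LHS](Radon_Nikodym_integral nu_mu mA) -E.
case: fE => intf fE.
have mf : measurable_fun setT f by apply/measurable_EFinP; exact: measurable_int intf.
have intfT : P.-integrable setT (EFin \o f).
  apply/integrableP; split.
    by apply/measurable_EFinP; exact: g_sigma_measurable_fun.
  case/integrableP: intf => _; apply: le_lt_trans.
  rewrite (@ge0_integral_distribution _ _ _ _ _ P idS (fun x => `|(f x)%:E|%E))//.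
  by apply: measurableT_comp => //; exact/measurable_EFinP.
apply: (none f); split => //.
- by move=> E mE; rewrite -[X in <<s C >> X]setTI; exact: mf.
- move=> A GA; rewrite -[RHS]/(nu A) fE//.
  rewrite (@integral_pushforward _ _ _ _ _ idS g_sigma_measurable_id P A
    (EFin \o f))//.
  + exact/measurable_EFinP.
  + by apply: integrableS intfT => //; exact: g_sigma_measurable.
Qed.

(** Splitting Z - Y into its positive and negative parts, and shifting h to make
   it nonnegative, reduces this to [ge0_eq_integral_density]. *)
Lemma cond_exp_bounded (Z Y h : T -> R) (M : R) :
  P.-integrable setT (EFin \o Z) -> is_cond_exp P <<s C >> Z Y ->
  measurable_fun setT (h : S -> R) -> (forall w, `|h w| <= M) ->
  P.-integrable setT (EFin \o (fun w => (Z w - Y w) * h w)) /\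
  \int[P]_w ((Z w - Y w) * h w) = 0.
Proof.
move=> iZ [iY mY eY] mh hM.
pose D w := Z w - Y w.
have iD : P.-integrable setT (EFin \o D) by exact: (integrableB measurableT iZ iY).
have mD : measurable_fun setT D by apply/measurable_EFinP; exact: measurable_int iD.
have mhT : measurable_fun setT h by exact: g_sigma_measurable_fun.
pose Dp w := Num.max (D w) 0; pose Dn w := Num.max (- D w) 0.
have mDp : measurable_fun setT Dp by apply: measurable_maxr.
have mDn : measurable_fun setT Dn.
  by apply: measurable_maxr => //; exact: measurable_funN.
have Dp0 w : 0 <= Dp w by rewrite le_max lexx orbT.
have Dn0 w : 0 <= Dn w by rewrite le_max lexx orbT.
have DE w : D w = Dp w - Dn w.
  rewrite /Dp /Dn; case: (ltrP (D w) 0) => d0.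
    by rewrite (max_l (_ : 0 <= - D w)) ?oppr_ge0 ?ltW// sub0r opprK.
  by rewrite max_r ?oppr_le0// subr0.
have DpD w : `|Dp w| <= `|D w|.
  rewrite ger0_norm// ge_max normr_ge0 andbT; exact: ler_norm.
have DnD w : `|Dn w| <= `|D w|.
  by rewrite ger0_norm// ge_max normr_ge0 andbT -normrN; exact: ler_norm.
have iaD : P.-integrable setT (EFin \o (fun w => `|D w|)) by exact: integrable_norm.
have iDp : P.-integrable setT (EFin \o Dp) by exact: integrableR_le iaD.
have iDn : P.-integrable setT (EFin \o Dn) by exact: integrableR_le iaD.
have ibd (g F : T -> R) (K : R) : measurable_fun setT g ->
    (forall w, `|g w| <= K) -> P.-integrable setT (EFin \o F) ->
    P.-integrable setT (EFin \o (fun w => g w * F w)).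
  move=> mg gK iF.
  have mF : measurable_fun setT F by apply/measurable_EFinP; exact: measurable_int iF.
  apply: (@integrableR_le _ _ _ _ _ (fun w => K * `|F w|)).
  - exact: measurable_funM.
  - by move=> w; rewrite normrM ler_wpM2r.
  - by apply: integrableR_Zl; exact: integrable_norm.
have key (g : T -> R) (K : R) : measurable_fun setT (g : S -> R) ->
    (forall w, 0 <= g w) -> (forall w, `|g w| <= K) ->
    \int[P]_w (g w * D w) = 0.
  move=> mg g0 gK.
  have mgT : measurable_fun setT g by exact: g_sigma_measurable_fun.
  have E : (\int[P]_w (g w * Dp w)%:E = \int[P]_w (g w * Dn w)%:E)%E.
    apply: (@ge0_eq_integral_density _ _ _ _ _ _ _ P P (id : T -> S) (id : T -> S)
      Dp Dn g) => //; try exact: g_sigma_measurable_id.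
    move=> A mA.
    have mA' : measurable (A : set T) by exact: g_sigma_measurable.
    have ind (F : T -> R) : (\int[P]_w (\1_(A : set S) (id w : S) * F w)%:E
        = \int[P]_(w in A) (F w)%:E)%E.
      rewrite [RHS]integral_mkcond; apply: eq_integral => w _.
      by rewrite patchE indicE; case: ifP => _; rewrite ?mul1r ?mul0r.
    rewrite !ind.
    have iS (F : T -> R) : P.-integrable setT (EFin \o F) ->
      P.-integrable A (EFin \o F).
      by apply: (integrableS measurableT mA'); exact: subsetT.
    have : (\int[P]_(w in A) (D w)%:E = 0)%E.
      rewrite (eq_integral (fun w => (Z w)%:E - (Y w)%:E)%E)//.
      rewrite (integralB mA' (iS _ iZ) (iS _ iY)) eY// subee//.
      exact: (integrable_fin_num mA' (iS _ iZ)).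
    rewrite (eq_integral (fun w => (Dp w)%:E - (Dn w)%:E)%E); last first.
      by move=> w _; rewrite DE EFinB.
    rewrite (integralB mA' (iS _ iDp) (iS _ iDn)) => /eqP.
    by rewrite sube_eq ?add0e ?(integrable_fin_num mA' (iS _ iDp))//
      ?fin_num_adde_defr ?(integrable_fin_num mA' (iS _ iDp))// => /eqP.
  rewrite (eq_Rintegral P (g := fun w => g w * Dp w - g w * Dn w)); last first.
    by move=> w _; rewrite DE mulrBr.
  rewrite RintegralB//; [|exact: ibd gK iDp|exact: ibd gK iDn].
  by rewrite /Rintegral E subrr.
split.
  have := ibd h D M mhT hM iD; apply: eq_integrable => // w _.
  by rewrite /= mulrC.
have M0 : 0 <= M by apply: le_trans (hM point).
rewrite (eq_Rintegral P (g := fun w => (h w + M) * D w - M * D w)); last first.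
  by move=> w _; rewrite -mulrBl addrK mulrC.
have hM2 w : `|h w + M| <= M + M.
  by rewrite (le_trans (ler_normD _ _))// lerD// ger0_norm.
have mhM : measurable_fun setT (fun w => h w + M : R).
  exact: measurable_funD.
rewrite RintegralB//; [|exact: ibd hM2 iD|exact: integrableR_Zl].
rewrite (key _ (M + M))//; last 2 first.
- by apply: measurable_funD.
- by move=> w; have := hM w; rewrite ler_norml => /andP[]; lra.
have := key (cst M) M; rewrite /= => ->//; first by rewrite subrr.
by move=> w; rewrite ger0_norm.
Qed.

(** The difference Y - h would be orthogonal to Z - Y if the product were known to
   be integrable; cutting both competitors off at level [N] makes it so. *)
Lemma cond_exp_projection (Z Y h : T -> R) :
  P.-integrable setT (EFin \o Z) -> is_cond_exp P <<s C >> Z Y ->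
  measurable_fun setT (h : S -> R) ->
  (\int[P]_w ((Z w - Y w) ^+ 2)%:E <= \int[P]_w ((Z w - h w) ^+ 2)%:E)%E.
Proof.
move=> iZ ceY mh.
have mY := is_cond_exp_measurable ceY.
have mYT : measurable_fun setT Y by exact: g_sigma_measurable_fun.
have mhT : measurable_fun setT h by exact: g_sigma_measurable_fun.
have mZ : measurable_fun setT Z by apply/measurable_EFinP; exact: measurable_int iZ.
have [fin|] := ltP (\int[P]_w ((Z w - h w) ^+ 2)%:E)%E +oo%E; last first.
  by rewrite leye_eq => /eqP ->; rewrite leey.
have iZh : P.-integrable setT (EFin \o (fun w => (Z w - h w) ^+ 2)).
  apply: integrableR_lty => //; last by move=> w; exact: sqr_ge0.
  by apply: measurable_funX; exact: measurable_funB.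
pose b N w := (`|Y w| <= N%:R) && (`|h w| <= N%:R).
have mb N : measurable_fun setT (b N : S -> bool).
  by apply: measurable_and; apply: measurable_fun_ler => //; exact: measurableT_comp.
pose c N w : R := (b N w)%:R.
have mc N : measurable_fun setT (c N : S -> R).
  apply: (measurableT_comp (f := fun x : bool => x%:R : R)) => //.
have c01 N w : 0 <= c N w <= 1 by rewrite /c; case: (b N w); rewrite ?lexx ?ler01.
pose g N w := c N w * (Y w - h w).
have mg N : measurable_fun setT (g N : S -> R).
  by apply: measurable_funM => //; exact: measurable_funB.
have gN N w : `|g N w| <= (N + N)%:R.
  rewrite /g /c; case: (boolP (b N w)) => [/andP[Yw hw]|_].
    by rewrite mul1r (le_trans (ler_normB _ _))// natrD lerD.
  by rewrite mul0r normr0.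
pose q N w := c N w * (Z w - Y w) ^+ 2.
have mq N : measurable_fun setT (q N).
  apply: measurable_funM; first exact: g_sigma_measurable_fun.
  by apply: measurable_funX; exact: measurable_funB.
have q0 N w : 0 <= q N w by rewrite mulr_ge0 ?sqr_ge0//; case/andP: (c01 N w).
have bound N : (\int[P]_w (q N w)%:E <= \int[P]_w ((Z w - h w) ^+ 2)%:E)%E.
  have [iDg eDg] := cond_exp_bounded iZ ceY (mg N) (gN N).
  have ir : P.-integrable setT
      (EFin \o (fun w => (Z w - h w) ^+ 2 - 2 * ((Z w - Y w) * g N w))).
    exact: (integrableB measurableT iZh (integrableR_Zl 2 iDg)).
  have -> : (\int[P]_w ((Z w - h w) ^+ 2)%:E
      = \int[P]_w ((Z w - h w) ^+ 2 - 2 * ((Z w - Y w) * g N w))%:E)%E.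
    rewrite -(EFin_Rintegral iZh) -(EFin_Rintegral ir) RintegralB//; last first.
      exact: integrableR_Zl.
    by rewrite RintegralZl// eDg mulr0 subr0.
  apply: ge0_le_integral => //.
  - by move=> w _; rewrite lee_fin.
  - exact/measurable_EFinP.
  - exact: measurable_int ir.
  - move=> w _; rewrite lee_fin /q /g /c; case: (b N w); last first.
      by rewrite !mul0r mulr0 mulr0 subr0 sqr_ge0.
    have := sqr_ge0 (Y w - h w); rewrite !mul1r; nra.
have lim w : q N w @[N --> \oo] --> (Z w - Y w) ^+ 2.
  apply: cvg_near_cst.
  exists (Num.truncn (Num.max `|Y w| `|h w|)).+1 => // N /= hN.
  have : Num.max `|Y w| `|h w| <= N%:R.
    by rewrite (le_trans (ltW (truncnS_gt _)))// ler_nat.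
  by rewrite ge_max /q /c /b => ->; rewrite mul1r.
have -> : (\int[P]_w ((Z w - Y w) ^+ 2)%:E
    = limn (fun N => \int[P]_w (q N w)%:E))%E.
  rewrite -monotone_convergence//.
  - apply: eq_integral => w _; apply/esym/cvg_lim => //.
    by apply: cvg_EFin; [exact: nearW|exact: lim].
  - by move=> N; exact/measurable_EFinP.
  - by move=> N w _; rewrite lee_fin.
  - move=> w _ m n mn; rewrite lee_fin ler_wpM2r ?sqr_ge0//.
    rewrite /c /b; case: (boolP (_ && _)) => [/andP[Yw hw]|_ //].
    by rewrite (le_trans Yw) ?ler_nat// (le_trans hw) ?ler_nat.
apply: lime_le; last by near=> N; exact: bound.
apply: ereal_nondecreasing_is_cvgn => m n mn; apply: ge0_le_integral => //.
- by move=> w _; rewrite lee_fin.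
- exact/measurable_EFinP.
- exact/measurable_EFinP.
- move=> w _; rewrite lee_fin ler_wpM2r ?sqr_ge0//.
  rewrite /c /b; case: (boolP (_ && _)) => [/andP[Yw hw]|_ //].
  by rewrite (le_trans Yw) ?ler_nat// (le_trans hw) ?ler_nat.
Unshelve. all: by end_near. Qed.

Lemma expectation_cond_var (Z : T -> R) : P.-integrable setT (EFin \o Z) ->
  P.-integrable setT (EFin \o (fun w => Z w ^+ 2)) ->
  exists2 Y, is_cond_exp P <<s C >> Z Y &
    ('E_P[cond_var P <<s C >> Z] = \int[P]_w ((Z w - Y w) ^+ 2)%:E)%E.
Proof.
move=> iZ iZ2; exists (cond_exp P <<s C >> Z); first exact: cond_exp_exists.
set Y := cond_exp P _ Z; have ceY : is_cond_exp P <<s C >> Z Y by exact: cond_exp_exists.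
have mYT : measurable_fun setT Y.
  by apply: g_sigma_measurable_fun => //; exact: is_cond_exp_measurable ceY.
have mZ : measurable_fun setT Z by apply/measurable_EFinP; exact: measurable_int iZ.
have iW : P.-integrable setT (EFin \o (fun w => (Z w - Y w) ^+ 2)).
  apply: integrableR_lty; last 2 first.
  - by move=> w; exact: sqr_ge0.
  - have := cond_exp_projection iZ ceY (h := cst 0) => h0.
    apply: (le_lt_trans (h0 _)); first exact: measurable_cst.
    under eq_integral do rewrite subr0.
    by rewrite -(EFin_Rintegral iZ2) ltry.
  - by apply: measurable_funX; exact: measurable_funB.
rewrite /cond_var unlock -/Y; have [_ _ E] := cond_exp_exists iW.
by rewrite -E//; exact: (@measurableT _ S).
Qed.

End CondExp.

(** * Conditioning a Gaussian noise variable on the other ones *)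

Section NoiseCondExp.
Context {disp : measure_display} {T : measurableType disp} {R : realType}.
Context {I : finType}.
Variables (P : probability T R) (E : I -> T -> R) (s : I -> R).
Hypothesis noiseE : gaussian_noise P E s.

Let measurable_preim i (A : set R) : measurable A -> measurable (E i @^-1` A).
Proof.
move=> mA; rewrite -[X in measurable X]setTI.
exact: (measurable_noise noiseE).
Qed.

Lemma normal_prob_sym (r : R) (g : R -> R) : r != 0 ->
  measurable_fun setT g -> (forall x, 0 <= g x) ->
  (\int[normal_prob 0 r]_x (g (- x))%:E = \int[normal_prob 0 r]_x (g x)%:E)%E.
Proof.
move=> r0 mg g0.
have mgN : measurable_fun setT (fun x : R => g (- x)) by exact: measurableT_comp.
rewrite !integral_normal_probE//.
have mf : measurable_fun setT (fun x : R => (g x * normal_pdf 0 r x)%:E).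
  apply/measurable_EFinP; apply: measurable_funM => //.
  exact: measurable_normal_pdf.
transitivity (\int[lebesgue_measure]_x
    (g (- (x : R)) * normal_pdf 0 r (- (x : R)))%:E)%E.
  apply: eq_integral => x _; congr ((_ * _)%:E).
  by rewrite !normal_pdfE// normal_fun_center /normal_fun /= !subr0 sqrrN.
have mN : measurable_fun setT (-%R : R -> R) by exact: oppr_measurable.
transitivity (\int[pushforward lebesgue_measure (-%R : R -> measurableTypeR R)]_x
   (g x * normal_pdf 0 r x)%:E)%E.
  rewrite ge0_integral_pushforward//.
  by move=> x _; rewrite lee_fin mulr_ge0// normal_pdf_ge0.
apply: eq_measure_integral => A mA _; exact: lebesgue_measureN.
Qed.

(** The sigma-algebra generated by the noise variables other than [E k],
   presented by a family of boxes closed under intersection. *)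
Definition noise_boxes (k : I) : set (set T) :=
  [set S | exists A : I -> set R, [/\ forall i, measurable (A i), A k = setT
    & S = \bigcap_i (E i @^-1` A i)]].

Lemma noise_boxes_measurable k : noise_boxes k `<=` measurable.
Proof.
move=> _ [A [mA _ ->]]; apply: fin_bigcap_measurable => // i _.
exact: measurable_preim.
Qed.

Lemma noise_boxes_noise k j : j != k ->
  measurable_fun [set: g_sigma_algebraType (noise_boxes k)] (E j).
Proof.
move=> jk _ A mA; rewrite setTI; apply: sub_sigma_algebra.
exists (fun i => if i == j then A else setT); split.
- by move=> i; case: ifP.
- by rewrite eq_sym (negPf jk).
apply/seteqP; split => w /=.
  by move=> Aw i _ /=; case: ifP => // /eqP ->.
by move=> /(_ j Logic.I); rewrite eqxx.
Qed.

(** Over a box, the positive and the negative part of [E k] have the same integral,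
   by independence and the symmetry of the normal law; boxes are closed under
   intersection and generate, so the same holds over the whole sigma-algebra. *)
Lemma noise_cond_exp0 k : is_cond_exp P <<s noise_boxes k >> (E k) (cst 0).
Proof.
have mE := measurable_noise noiseE; have [_ _ iE _] := noiseE.
split.
- exact: finite_measure_integrable_cst.
- move=> A mA.
  have := @measurable_cst _ _ (g_sigma_algebraType (noise_boxes k)) R setT 0.
  by move=> /(_ (@measurableT _ _) A mA); rewrite setTI.
have iEk : P.-integrable setT (EFin \o E k).
  apply: (@integrableR_le _ _ _ P _ (fun w => 1 + E k w ^+ 2)) => //.
    move=> w; have := sqr_ge0 (`|E k w| - 1).
    rewrite sqrrB expr1n mulr1 real_normK ?num_real//.
    have := sqr_ge0 (E k w); have := normr_ge0 (E k w); lra.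
  apply: integrableR_D; last exact: (integrable_noise_sqr noiseE).
  exact: finite_measure_integrable_cst.
suff H S0 : <<s noise_boxes k >> S0 -> (\int[P]_(w in S0) (E k w)%:E = 0)%E.
  by move=> A GA; rewrite H//= integral0.
have box S : noise_boxes k S -> (\int[P]_(w in S) (E k w)%:E = 0)%E.
  move=> [A [mA Ak SE]].
  pose f (b : bool) i (x : R) : R :=
    if i == k then Num.max ((-1) ^+ b * x) 0 else \1_(A i) x.
  have mf b i : measurable_fun setT (f b i).
    rewrite /f; case: (i == k); last exact: measurable_indic.
    by apply: measurable_maxr => //; exact: measurable_funM.
  have f0 b i x : 0 <= f b i x.
    by rewrite /f; case: ifP => _ //; rewrite le_max lexx orbT.
  have fE b i : i != k -> f b i = \1_(A i) by rewrite /f => /negPf ->.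
  have ff b i : (\int[P]_w (f b i (E i w))%:E < +oo)%E.
    have [->|ik] := eqVneq i k.
      have : (\int[P]_w (f b k (E k w))%:E <= \int[P]_w `|(E k w)%:E|)%E.
        apply: ge0_le_integral => //.
        - by move=> w _; rewrite lee_fin.
        - by apply/measurable_EFinP; exact: measurableT_comp.
        - by apply: measurableT_comp => //; exact/measurable_EFinP.
        move=> w _; rewrite lee_fin /f eqxx ge_max normr_ge0 andbT.
        by rewrite (le_trans (ler_norm _))// normrMsign.
      by move/le_lt_trans; apply; case/integrableP: iEk.
    rewrite fE//; have := integral_indic P measurableT (measurable_preim i (mA i)).
    rewrite setIT => ->; rewrite (le_lt_trans (probability_le1 _ _)) ?ltry//.
    exact: measurable_preim.
  have prodf b w : \prod_i f b i (E i w) = Num.max ((-1) ^+ b * E k w) 0 * \1_S w.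
    rewrite (bigD1 k)//= {1}/f eqxx; congr (_ * _).
    rewrite (eq_bigr (fun i => \1_(A i) (E i w))); last by move=> i /fE ->.
    rewrite indicE SE; have [wS|wS] := boolP (w \in _).
      by rewrite big1// => i _; rewrite indicE mem_set//; exact: (set_mem wS).
    have [i wi] : exists i, ~ A i (E i w).
      by apply/existsNP => h; move/negP: wS; apply; apply/mem_set => i _; exact: h.
    have ik : i != k by apply/eqP => ik; apply: wi; rewrite ik Ak.
    by rewrite (bigD1 i)//= indicE memNset// mul0r.
  have mS : measurable S by apply: (@noise_boxes_measurable k); exists A.
  have half : (\int[P]_w (Num.max ((-1) ^+ false * E k w) 0 * \1_S w)%:E
     = \int[P]_w (Num.max ((-1) ^+ true * E k w) 0 * \1_S w)%:E)%E.
    transitivity (\int[P]_w (\prod_i f false i (E i w))%:E)%E.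
      by apply: eq_integral => w _; rewrite prodf.
    transitivity (\int[P]_w (\prod_i f true i (E i w))%:E)%E; last first.
      by apply: eq_integral => w _; rewrite prodf.
    rewrite !(@indep_integral_prod _ _ _ _ _ P I E)//.
    apply: eq_bigr => i _; have [->|ik] := eqVneq i k; last by rewrite !fE.
    rewrite !(integral_noise noiseE)// /f eqxx.
    rewrite -[LHS](@normal_prob_sym _ (fun x => Num.max ((-1) ^+ false * x) 0))//.
    + by apply: eq_integral => x _; rewrite expr0 expr1 mul1r mulN1r.
    + by rewrite lt0r_neq0// (noise_gt0 noiseE).
    + by apply: measurable_maxr => //; exact: measurable_funM.
    + by move=> x; rewrite le_max lexx orbT.
  have ip b : P.-integrable setT
      (EFin \o (fun w => Num.max ((-1) ^+ b * E k w) 0 * \1_S w)).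
    apply: (@integrableR_le _ _ _ _ _ (fun w => `|E k w|)).
    - apply: measurable_funM; last exact: measurable_indic.
      by apply: measurable_maxr => //; exact: measurable_funM.
    - move=> w; rewrite normrM -[leRHS]mulr1 ler_pM//.
        rewrite ger0_norm ?le_max ?lexx ?orbT// ge_max normr_ge0 andbT.
        by rewrite (le_trans (ler_norm _))// normrMsign.
      by rewrite indicE; case: (w \in S); rewrite ?normr1 ?normr0 ?ler01.
    - exact: integrable_norm.
  rewrite integral_mkcond (eq_integral (fun w =>
    (Num.max ((-1) ^+ false * E k w) 0 * \1_S w)%:E
    - (Num.max ((-1) ^+ true * E k w) 0 * \1_S w)%:E)%E); last first.
    move=> w _; rewrite patchE indicE expr0 expr1 mul1r mulN1r.
    case: ifP => _; last by rewrite !mulr0 subee.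
    rewrite !mulr1 -EFinB; congr (_%:E); case: (ltrP (E k w) 0) => e0.
      by rewrite (max_l (_ : 0 <= - E k w)) ?oppr_ge0 ?ltW// sub0r opprK.
    by rewrite max_r ?oppr_le0// subr0.
  rewrite (integralB measurableT (ip false) (ip true)).
  by rewrite [X in (X - _)%E]half subee//; exact: (integrable_fin_num measurableT (ip true)).
have gm := @g_sigma_measurable _ T (noise_boxes k) (@noise_boxes_measurable k).
have tot : (\int[P]_w (E k w)%:E = 0)%E.
  apply: box; exists (fun=> setT); split => //.
  by apply/seteqP; split.
apply: (@dynkin_induction _ (g_sigma_algebraType (noise_boxes k))
  (noise_boxes k) (fun S => (\int[P]_(w in S) (E k w)%:E = 0)%E)) => //.
- move=> _ _ [A [mA Ak ->]] [A' [mA' Ak' ->]].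
  exists (fun i => A i `&` A' i); split.
  + by move=> i; exact: measurableI.
  + by rewrite Ak Ak' setIT.
  apply/seteqP; split => w /=; first by move=> [wA wA'] i _; split; [exact: wA|exact: wA'].
  by move=> h; split => i _; have [] := h i Logic.I.
- move=> A mA A0; have mA' : measurable (A : set T) by exact: gm.
  have /measurable_EFinP mEk := mE k.
  have := @integral_setU _ T R P A (~` A) (EFin \o E k) mA' (measurableC mA').
  rewrite setUv disj_set2E setICr eqxx => /(_ mEk isT); rewrite tot A0 add0e.
  by move=> <-.
- move=> F mF tF F0.
  have mF' n : measurable (F n : set T) := gm _ (mF n).
  rewrite integral_bigcup//; first by apply: eseries0 => n _ _; exact: F0.
  apply: (integrableS measurableT) iEk; last exact: subsetT.
  exact: bigcupT_measurable.
Qed.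

End NoiseCondExp.

(** * Linear structural equations *)

Definition qform {R : realType} {d : nat} (S : 'M[R]_d) (u v : 'cV[R]_d) : R :=
  (u^T *m S *m v) 0 0.

Section QForm.
Context {R : realType} {d : nat}.
Implicit Types (S : 'M[R]_d) (u v w : 'cV[R]_d) (a : R).

Lemma qformE S u v : qform S u v = \sum_i \sum_j u i 0 * v j 0 * S i j.
Proof.
rewrite /qform -mulmxA mxE; apply: eq_bigr => i _; rewrite !mxE mulr_sumr.
by apply: eq_bigr => j _; rewrite mulrA mulrAC.
Qed.

Lemma qformDl S u v w : qform S (u + v) w = qform S u w + qform S v w.
Proof. by rewrite /qform linearD/= !mulmxDl mxE. Qed.

Lemma qformDr S u v w : qform S w (u + v) = qform S w u + qform S w v.
Proof. by rewrite /qform mulmxDr mxE. Qed.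

Lemma qformZl S a u v : qform S (a *: u) v = a * qform S u v.
Proof. by rewrite /qform linearZ/= -!scalemxAl mxE. Qed.

Lemma qformZr S a u v : qform S u (a *: v) = a * qform S u v.
Proof. by rewrite /qform -scalemxAr mxE. Qed.

Lemma qformNl S u v : qform S (- u) v = - qform S u v.
Proof. by rewrite -scaleN1r qformZl mulN1r. Qed.

Lemma qformNr S u v : qform S u (- v) = - qform S u v.
Proof. by rewrite -scaleN1r qformZr mulN1r. Qed.

Lemma qformC S u v : S^T = S -> qform S u v = qform S v u.
Proof.
move=> sS; transitivity ((u^T *m S *m v)^T 0 0); first by rewrite mxE.
by rewrite !trmx_mul trmxK sS mulmxA.
Qed.

Lemma qform_sqrD S u v : S^T = S ->
  qform S (u + v) (u + v) = qform S u u + 2 * qform S u v + qform S v v.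
Proof.
by move=> sS; rewrite qformDl !qformDr (qformC v u sS); ring.
Qed.

Lemma qform_sqrB S u v : S^T = S ->
  qform S (u - v) (u - v) = qform S u u - 2 * qform S u v + qform S v v.
Proof. by move=> sS; rewrite qform_sqrD// qformNl !qformNr; ring. Qed.

End QForm.

Section BackSubstitution.
Context {R : realType} {d : nat}.
Variables (B : 'M[R]_d) (tau : {perm 'I_d}).
Hypothesis tauP : topological_sort B tau.

Lemma edge_pos i j : edge B i j -> (tau^-1%g i < tau^-1%g j)%N.
Proof. by move=> eij; apply: tauP; rewrite !permKV. Qed.

Lemma connect_pos i j :
  connect (edge B) i j -> (tau^-1%g i <= tau^-1%g j)%N.
Proof.
move=> /connectP[p]; elim: p i => [|c p IH] i /=; first by move=> _ ->.
by move=> /andP[/edge_pos ic /IH h] /h; exact/leq_trans/ltnW.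
Qed.

(** Solving u = B u + z from the sinks upwards: the equation for a node only
   involves its children. *)
Lemma back_substitution (u z : 'cV[R]_d) (A : pred 'I_d) :
  u = B *m u + z -> (forall l, A l -> z l 0 = 0) ->
  (forall l j, A l -> edge B l j -> A j) -> forall l, A l -> u l 0 = 0.
Proof.
move=> uE zA closedA l.
have [m] := ubnP (d - tau^-1%g l)%N; elim: m l => // m IH l lm Al.
rewrite uE !mxE zA// addr0 big1// => j _.
have [->|Blj] := eqVneq (B l j) 0; first by rewrite mul0r.
have elj : edge B l j by [].
rewrite IH ?mulr0//; last exact: closedA Al elj.
have := edge_pos elj; have := ltn_ord (tau^-1%g l); have := ltn_ord (tau^-1%g j).
by move: lm; lia.
Qed.

Lemma unitmx_one_sub : 1%:M - B \in unitmx.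
Proof.
rewrite -unitmx_tr -row_free_unit -kermx_eq0.
apply/eqP/row_matrixP => i; rewrite row0.
set v := row i _.
have : v *m (1%:M - B)^T = 0 by apply/eqP; rewrite -sub_kermx row_sub.
move/(congr1 trmx); rewrite trmx_mul trmxK trmx0 mulmxBl mul1mx => /eqP.
rewrite subr_eq0 => /eqP vE.
apply/rowP => j; rewrite [RHS]mxE.
have := @back_substitution v^T 0 xpredT; rewrite addr0 => /(_ vE).
by move=> /(_ (fun l _ => mxE _ _ _ _) (fun _ _ _ _ => isT) j isT); rewrite mxE.
Qed.

(** X is the transpose of this matrix applied to the noise, so it maps the
   coefficients of a linear form in X to those of the same form in the noise. *)
Definition total_effect : 'M[R]_d := invmx (1%:M - B).

Lemma total_effectE (u : 'cV[R]_d) :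
  total_effect *m u = B *m (total_effect *m u) + u.
Proof.
apply/eqP; rewrite addrC -subr_eq -{1}(mul1mx (total_effect *m u)) -mulmxBl.
by rewrite mulmxA mulmxV ?unitmx_one_sub// mul1mx.
Qed.

Lemma total_effect_resid k :
  total_effect *m ((delta_mx k 0 : 'cV[R]_d) - col k B) = delta_mx k 0.
Proof.
rewrite colE -{1}(mul1mx (delta_mx k 0)) -mulmxBl mulmxA.
by rewrite mulVmx ?unitmx_one_sub// mul1mx.
Qed.

(** Entry k of total_effect *m z is a combination of the z_l with l reachable from
   k, one term for each directed path. *)
Lemma total_effect_nd k (z : 'cV[R]_d) :
  (forall l, l \notin nd B k -> z l 0 = 0) -> (total_effect *m z) k 0 = 0.
Proof.
move=> zk; apply: (back_substitution (total_effectE z)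
  (A := fun l => connect (edge B) k l)) => //.
- by move=> l kl; apply: zk; rewrite inE negbK.
- by move=> l j kl lj; apply: connect_trans kl (connect1 lj).
Qed.

Lemma col_nd k l : acyclic B -> l \notin nd B k -> col k B l 0 = 0.
Proof.
move=> acB; rewrite inE negbK mxE => kl; apply/eqP/negPn/negP => lk.
by have := acB l k lk; rewrite kl.
Qed.

Lemma acyclic_topological : acyclic B.
Proof.
move=> j k ejk; apply/negP => kj.
by have := leq_ltn_trans (connect_pos kj) (edge_pos ejk); rewrite ltnn.
Qed.

Lemma pred_sub_nd j : predecessors tau j \subset nd B (tau j).
Proof.
apply/fintype.subsetP => l /imsetP[i]; rewrite inE => ij ->; rewrite inE.
by apply/negP => /connect_pos; rewrite !permK leqNgt ij.
Qed.

Lemma pa_sub_pred j : pa B (tau j) \subset predecessors tau j.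
Proof.
apply/fintype.subsetP => l; rewrite inE => /edge_pos; rewrite permK => h.
by apply/imsetP; exists (tau^-1%g l); rewrite ?inE// permKV.
Qed.

End BackSubstitution.

Section SEM.
Context {disp : measure_display} {T : measurableType disp} {R : realType}.
Context {P : probability T R} {d : nat}.
Variables (X eps : {RV P >-> d.-tuple R}) (B : 'M[R]_d) (sigma : 'I_d -> R).
Variable tau : {perm 'I_d}.
Hypothesis tauP : topological_sort B tau.

Let E k w := tnth (eps w) k.

Hypothesis noiseE : gaussian_noise P E sigma.
Hypothesis semE : forall w,
  col_of_tuple (X w) = B^T *m col_of_tuple (X w) + col_of_tuple (eps w).

Definition linform (u : 'cV[R]_d) (x : d.-tuple R) : R :=
  \sum_k u k 0 * tnth x k.

Lemma linformE u x : linform u x = (u^T *m col_of_tuple x) 0 0.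
Proof. by rewrite mxE; apply: eq_bigr => k _; rewrite !mxE. Qed.

Lemma linform_delta k x : linform (delta_mx k 0) x = tnth x k.
Proof.
rewrite /linform (bigD1 k)//= mxE !eqxx mul1r big1 ?addr0// => j /negPf jk.
by rewrite mxE jk mul0r.
Qed.

Lemma measurable_linform u : measurable_fun setT (linform u).
Proof.
apply: measurable_sum => k; apply: measurable_funM => //.
exact: measurable_tnth.
Qed.

Let Te := total_effect B.

Definition total_coef (u : 'cV[R]_d) (l : 'I_d) : R := (Te *m u) l 0.

Lemma linform_noise u w : linform u (X w) = noise_comb E (total_coef u) w.
Proof.
have epsE : col_of_tuple (eps w) = (1%:M - B)^T *m col_of_tuple (X w).
  by rewrite linearB/= trmx1 mulmxBl mul1mx {1}semE addrAC subrr add0r.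
rewrite linformE.
transitivity (((Te *m u)^T *m col_of_tuple (eps w)) 0 0); last first.
  rewrite mxE; apply: eq_bigr => l _.
  by rewrite [X in X * _]mxE [X in _ * X]mxE.
rewrite epsE mulmxA -trmx_mul mulmxA mulmxV ?mul1mx//.
exact: unitmx_one_sub tauP.
Qed.

Lemma covarianceE : covariance_matrix X =
  Te^T *m diag_mx (\row_l sigma l ^+ 2) *m Te.
Proof.
apply/matrixP => i j; rewrite mxE unlock -[fine _]/(\int[P]_w _).
rewrite (eq_Rintegral P (g := fun w => noise_comb E (total_coef (delta_mx i 0)) w *
    noise_comb E (total_coef (delta_mx j 0)) w)); last first.
  by move=> w _; rewrite -!linform_noise !linform_delta.
rewrite (noise_comb_cov noiseE) mxE; apply: eq_bigr => l _.
by rewrite mul_mx_diag !mxE /total_coef -!colE !mxE mulrAC.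
Qed.

Lemma covariance_sym : (covariance_matrix X)^T = covariance_matrix X.
Proof. by rewrite covarianceE !trmx_mul tr_diag_mx trmxK mulmxA. Qed.

Lemma qform_cov u v : qform (covariance_matrix X) u v =
  \sum_l total_coef u l * total_coef v l * sigma l ^+ 2.
Proof.
rewrite /qform covarianceE !mulmxA -trmx_mul -mulmxA mxE.
apply: eq_bigr => l _; rewrite mul_mx_diag [X in X * _]mxE [X in X * _ * _]mxE.
by rewrite [X in _ * X * _]mxE mulrAC.
Qed.

Lemma qform_cov_comb_var u :
  qform (covariance_matrix X) u u = comb_var sigma (total_coef u).
Proof. by rewrite qform_cov; apply: eq_bigr => l _; rewrite -expr2. Qed.

Lemma qform_cov_ge0 u : 0 <= qform (covariance_matrix X) u u.
Proof. by rewrite qform_cov_comb_var comb_var_ge0. Qed.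

Lemma integral_linform_sqr u : (\int[P]_w (linform u (X w) ^+ 2)%:E
  = (qform (covariance_matrix X) u u)%:E)%E.
Proof.
rewrite qform_cov_comb_var -(noise_comb_sqr noiseE) EFin_Rintegral; last first.
  exact: (integrable_noise_comb_sqr noiseE).
by apply: eq_integral => w _; rewrite linform_noise.
Qed.

(** The regression residual of node [k]: its value at X is the noise of [k]. *)
Definition resid_vec (k : 'I_d) : 'cV[R]_d := delta_mx k 0 - col k B.

Lemma total_coef_resid k l : total_coef (resid_vec k) l = (l == k)%:R.
Proof.
by rewrite /total_coef /Te /resid_vec (total_effect_resid tauP) mxE eqxx andbT.
Qed.

Lemma qform_resid k : qform (covariance_matrix X) (resid_vec k) (resid_vec k)
  = sigma k ^+ 2.
Proof.
rewrite qform_cov (bigD1 k)//= !total_coef_resid eqxx !mul1r big1 ?addr0//.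
by move=> l /negPf lk; rewrite !total_coef_resid lk !mul0r.
Qed.

Lemma qform_resid_nd k (z : 'cV[R]_d) :
  (forall l, l \notin nd B k -> z l 0 = 0) ->
  qform (covariance_matrix X) (resid_vec k) z = 0.
Proof.
move=> zk; rewrite qform_cov big1// => l _; rewrite total_coef_resid.
have [->|] := eqVneq l k; last by rewrite !mul0r.
by rewrite /total_coef /Te (total_effect_nd tauP zk) mulr0 mul0r.
Qed.

Lemma resid_noise k w : linform (resid_vec k) (X w) = E k w.
Proof.
rewrite linform_noise -[RHS]noise_comb1; apply: eq_bigr => l _.
by rewrite total_coef_resid.
Qed.

Lemma qform_resid_add k (z : 'cV[R]_d) :
  (forall l, l \notin nd B k -> z l 0 = 0) ->
  qform (covariance_matrix X) (resid_vec k + z) (resid_vec k + z)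
  = sigma k ^+ 2 + qform (covariance_matrix X) z z.
Proof.
move=> zk; rewrite qform_sqrD ?covariance_sym// qform_resid (qform_resid_nd zk).
by rewrite mulr0 addr0.
Qed.

Lemma qform_cov_delta k :
  qform (covariance_matrix X) (delta_mx k 0) (delta_mx k 0)
  = sigma k ^+ 2 + qform (covariance_matrix X) (col k B) (col k B).
Proof.
rewrite -qform_resid_add ?subrK// => l.
exact/col_nd/(acyclic_topological tauP).
Qed.

(** ** The variance gap against linear predictors *)

Let gens (A : {set 'I_d}) : set (set T) :=
  \bigcup_(i in [set` A]) preimage_set_system setT (Defs.coord X i) measurable.

Lemma measurable_coord i : measurable_fun setT (Defs.coord X i).
Proof.
exact: (measurableT_comp (measurable_tnth i) (@measurable_funPT _ _ _ _ X)).
Qed.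

Let gens_measurable A : gens A `<=` measurable.
Proof.
by move=> S [i _ [F mF <-]]; exact: (measurable_coord i).
Qed.

Let coord_gens (A : {set 'I_d}) i : i \in A ->
  measurable_fun [set: g_sigma_algebraType (gens A)] (Defs.coord X i).
Proof.
move=> iA _ F mF; apply: sub_sigma_algebra; exists i => //; exists F => //.
Qed.

Lemma measurable_linform_on {disp' : measure_display} (S : measurableType disp')
    (c : 'I_d -> S -> R) (w : 'cV[R]_d) (A : {set 'I_d}) :
  (forall i, i \notin A -> w i 0 = 0) ->
  (forall i, i \in A -> measurable_fun setT (c i)) ->
  measurable_fun setT (fun s => \sum_i w i 0 * c i s).
Proof.
move=> wA mc; apply: measurable_sum => i.
have [iA|iA] := boolP (i \in A); first by apply: measurable_funM => //; exact: mc.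
rewrite (_ : (fun s => _) = cst 0); first exact: measurable_cst.
by apply/funext => s; rewrite wA// mul0r.
Qed.

Let integrable_coord_sqr i : P.-integrable setT (EFin \o (fun w => Defs.coord X i w ^+ 2)).
Proof.
apply: integrableR_lty.
- by apply: measurable_funX; exact: measurable_coord.
- by move=> w; exact: sqr_ge0.
under eq_integral do rewrite /Defs.coord -linform_delta.
by rewrite integral_linform_sqr ltry.
Qed.

Let integrable_of_sqr (f : T -> R) : measurable_fun setT f ->
  P.-integrable setT (EFin \o (fun w => f w ^+ 2)) -> P.-integrable setT (EFin \o f).
Proof.
move=> mf if2; apply: (@integrableR_le _ _ _ P _ (fun w => 1 + f w ^+ 2)) => //.
  move=> w; have := sqr_ge0 (`|f w| - 1).
  rewrite sqrrB expr1n mulr1 real_normK ?num_real//.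
  have := sqr_ge0 (f w); have := normr_ge0 (f w); lra.
by apply: integrableR_D => //; exact: finite_measure_integrable_cst.
Qed.

(** The linear predictor w . X is a function of the coordinates in [A], hence at
   best as good as the conditional expectation. *)
Lemma expectation_cond_var_le k (A : {set 'I_d}) (w : 'cV[R]_d) :
  (forall i, i \notin A -> w i 0 = 0) ->
  ('E_P[cond_var P (sigma_gen (Defs.coord X) A) (Defs.coord X k)] <=
   (qform (covariance_matrix X) (delta_mx k 0 - w) (delta_mx k 0 - w))%:E)%E.
Proof.
move=> wA; have iX := integrable_of_sqr (measurable_coord k) (integrable_coord_sqr k).
have [Y ceY ->] := expectation_cond_var (@gens_measurable A) iX (integrable_coord_sqr k).
rewrite -integral_linform_sqr.
have := cond_exp_projection (@gens_measurable A) iX ceY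
  (measurable_linform_on wA (@coord_gens A)).
move=> /le_trans; apply; rewrite le_eqVlt; apply/orP; left; apply/eqP.
apply: eq_integral => t _; congr ((_ ^+ 2)%:E).
rewrite {1}/Defs.coord -linform_delta /linform -sumrB; apply: eq_bigr => i _.
by rewrite !mxE mulrBl.
Qed.

(** The noise of [k] has conditional mean zero given all the other noise variables,
   of which the nondescendants of [k] are functions; so no predictor built from
   these improves on the true regression. *)
Lemma expectation_cond_var_ge k (A : {set 'I_d}) : A \subset nd B k ->
  ((sigma k ^+ 2)%:E <=
   'E_P[cond_var P (sigma_gen (Defs.coord X) A) (Defs.coord X k)])%E.
Proof.
move=> And; have iX := integrable_of_sqr (measurable_coord k) (integrable_coord_sqr k).
have [Y ceY ->] := expectation_cond_var (@gens_measurable A) iX (integrable_coord_sqr k).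
pose C := noise_boxes E k.
have mC : C `<=` measurable := noise_boxes_measurable noiseE (k := k).
have mE j : j != k -> measurable_fun [set: g_sigma_algebraType C] (E j).
  exact: noise_boxes_noise.
have mlin (u : 'cV[R]_d) : (forall l, l \notin nd B k -> u l 0 = 0) ->
    measurable_fun [set: g_sigma_algebraType C] (fun w => linform u (X w)).
  move=> uk; rewrite (_ : (fun w => _) =
      (fun w => \sum_l (Te *m u) l 0 * E l w)); last first.
    by apply/funext => w; rewrite linform_noise.
  apply: (measurable_linform_on (A := [set~ k]%SET)) => l.
    by rewrite !inE negbK => /eqP ->; exact: (total_effect_nd tauP uk).
  by rewrite !inE; exact: mE.
have mX i : i \in nd B k -> measurable_fun [set: g_sigma_algebraType C] (Defs.coord X i).
  move=> ik; rewrite (_ : Defs.coord X i = (fun w => linform (delta_mx i 0) (X w))).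
    apply: mlin => l lk; rewrite mxE; have [li|] := eqVneq l i => //.
    by move: lk; rewrite li ik.
  by apply/funext => w; rewrite linform_delta.
have gensC : <<s gens A >> `<=` <<s C >>.
  apply: smallest_sub; first exact: smallest_sigma_algebra.
  move=> S [i iA [F mF <-]].
  by apply: (mX i (fintype.subsetP And _ iA)).
have mY : measurable_fun [set: g_sigma_algebraType C] Y.
  move=> _ F mF; rewrite setTI; apply: gensC; case: ceY => _ + _; exact.
have iE : P.-integrable setT (EFin \o E k).
  apply: integrable_of_sqr; first exact: (measurable_noise noiseE).
  exact: (integrable_noise_sqr noiseE).
have mh : measurable_fun [set: g_sigma_algebraType C]
    (fun w => Y w - linform (col k B) (X w)).
  apply: measurable_funB => //; apply: mlin => l.
  exact/col_nd/(acyclic_topological tauP).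
have := cond_exp_projection mC iE (noise_cond_exp0 noiseE k) mh.
rewrite (eq_integral (fun w => (E k w ^+ 2)%:E)); last by move=> w _; rewrite /= subr0.
rewrite -EFin_Rintegral ?(noise_sqr noiseE); last exact: (integrable_noise_sqr noiseE).
move=> /le_trans; apply; rewrite le_eqVlt; apply/orP; left; apply/eqP.
apply: eq_integral => w _; congr ((_ ^+ 2)%:E).
have -> : E k w = Defs.coord X k w - linform (col k B) (X w).
  rewrite -resid_noise /Defs.coord -linform_delta /linform -sumrB.
  by apply: eq_bigr => i _; rewrite !mxE mulrBl.
by ring.
Qed.

Lemma variance_gap_ge0 : (0 <= variance_gap X B sigma)%E.
Proof.
apply: le_bigmin => [|k _]; first exact: leey.
apply: le_bigmin => [|A /andP[And _]]; first exact: leey.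
by rewrite sube_ge0 ?expectation_cond_var_ge// fin_numE.
Qed.

(** The noise part of the prediction error of w . X cancels against the noise
   variance in the gap, leaving the error on the regression function. *)
Lemma variance_gap_le k (A : {set 'I_d}) (w : 'cV[R]_d) :
  A \subset nd B k -> pa B k :\: A != finset.set0 ->
  (forall i, i \notin A -> w i 0 = 0) ->
  (variance_gap X B sigma <=
   (qform (covariance_matrix X) (col k B - w) (col k B - w))%:E)%E.
Proof.
move=> And paA wA; apply: (le_trans (bigmin_le_cond _ _ (j := k) _)) => //.
apply: (le_trans (bigmin_le_cond _ _ (j := A) _)) => //.
  by rewrite And paA.
rewrite leeBlDr// (le_trans (expectation_cond_var_le k wA))//.
rewrite -EFinD lee_fin [leRHS]addrC.
have -> : delta_mx k 0 - w = resid_vec k + (col k B - w).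
  by rewrite /resid_vec addrA subrK.
rewrite qform_resid_add// => l lk.
rewrite mxE (col_nd (acyclic_topological tauP) lk) mxE wA ?subr0//.
by apply: contra lk => /(fintype.subsetP And).
Qed.

End SEM.

(** * Extreme eigenvalues and Rayleigh quotients *)

Definition nsq {R : realType} {d : nat} (u : 'cV[R]_d) : R :=
  \sum_i u i 0 ^+ 2.

Section Rayleigh.
Context {R : realType} {d : nat}.
Implicit Types (S : 'M[R]_d) (u v z : 'cV[R]_d).

Lemma nsq_ge0 u : 0 <= nsq u.
Proof. by apply: sumr_ge0 => i _; exact: sqr_ge0. Qed.

Lemma nsq_qform u : nsq u = qform 1%:M u u.
Proof. by rewrite /qform mulmx1 mxE; apply: eq_bigr => i _; rewrite mxE expr2. Qed.

Lemma nsq0 : nsq (0 : 'cV[R]_d) = 0.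
Proof. by rewrite /nsq big1// => i _; rewrite mxE expr0n. Qed.

Lemma nsq_eq0 u : (nsq u == 0) = (u == 0).
Proof.
apply/idP/eqP => [|->]; last by rewrite nsq0.
rewrite psumr_eq0 => [/allP u0|i _]; last exact: sqr_ge0.
apply/colP => i; rewrite mxE; apply/eqP.
by rewrite -sqrf_eq0; exact: u0 (mem_index_enum i).
Qed.

Lemma nsq_delta k : nsq (delta_mx k 0 : 'cV[R]_d) = 1.
Proof.
rewrite /nsq (bigD1 k)//= mxE !eqxx expr1n big1 ?addr0// => i /negPf ik.
by rewrite mxE ik expr0n.
Qed.

Lemma nsqZ a u : nsq (a *: u) = a ^+ 2 * nsq u.
Proof. by rewrite !nsq_qform qformZl qformZr mulrA. Qed.

Lemma nsq_coord_le u i : u i 0 ^+ 2 <= nsq u.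
Proof.
by rewrite /nsq (bigD1 i)//= lerDl; apply: sumr_ge0 => j _; exact: sqr_ge0.
Qed.

Lemma qform_bounded S : exists2 K, 0 < K & forall u, `|qform S u u| <= K * nsq u.
Proof.
exists (1 + \sum_i \sum_j `|S i j|) => [|u].
  by rewrite ltr_pwDl// sumr_ge0// => i _; exact: sumr_ge0.
rewrite mulrDl mul1r ler_wpDl ?nsq_ge0// qformE mulr_suml.
apply: (le_trans (ler_norm_sum _ _ _)); apply: ler_sum => i _.
rewrite mulr_suml (le_trans (ler_norm_sum _ _ _))//; apply: ler_sum => j _.
rewrite normrM mulrC ler_wpM2l// ler_norml.
have := nsq_coord_le u i; have := nsq_coord_le u j.
have := sqr_ge0 (u i 0 - u j 0); have := sqr_ge0 (u i 0 + u j 0).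
by move=> *; apply/andP; split; nra.
Qed.

Lemma qform_CauchySchwarz S u v : S^T = S -> (forall z, 0 <= qform S z z) ->
  qform S u v ^+ 2 <= qform S u u * qform S v v.
Proof.
move=> sS S0; set a := qform S u u; set b := qform S u v; set c := qform S v v.
have h t : 0 <= a + 2 * t * b + t ^+ 2 * c.
  have := S0 (u + t *: v); rewrite qform_sqrD// qformZl !qformZr -/a -/b -/c.
  by rewrite (_ : 2 * (t * b) = 2 * t * b) ?mulrA// -expr2.
have := S0 v; rewrite -/c le_eqVlt => /predU1P[c0|c0].
  have [->|b0] := eqVneq b 0; first by rewrite expr0n -c0 mulr0.
  have := h (- (a + 1) / (2 * b)); rewrite -c0 mulr0 addr0.
  rewrite (_ : 2 * (- (a + 1) / (2 * b)) * b = - (a + 1)); last by field.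
  lra.
have := h (- b / c).
rewrite (_ : _ + _ + _ = (a * c - b ^+ 2) / c); last by field; rewrite lt0r_neq0.
by rewrite pmulr_lge0 ?invr_gt0// subr_ge0.
Qed.

(** The infimum of the Rayleigh quotient is an eigenvalue: otherwise S minus it
   would be invertible and nonnegative, hence bounded below by a positive
   multiple of the identity. *)
Lemma rayleigh_min S : (0 < d)%N -> S^T = S ->
  exists2 m, eigenvalue S m & forall u, m * nsq u <= qform S u u.
Proof.
move=> d0 sS; have [K K0 hK] := qform_bounded S.
pose Q := [set x : R | forall u, x * nsq u <= qform S u u].
have QK : Q (- K).
  by move=> u; have := hK u; rewrite mulNr ler_norml => /andP[].
pose e : 'cV[R]_d := delta_mx (Ordinal d0) 0.
have e1 : nsq e = 1 by exact: nsq_delta.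
have ubQ : has_ubound Q by exists (qform S e e) => x /(_ e); rewrite e1 mulr1.
have supQ : has_sup Q by split=> //; exists (- K).
pose m := sup Q.
have Qm : Q m.
  move=> u; have [u0|u0] := eqVneq (nsq u) 0.
    by have := QK u; rewrite u0 !mulr0.
  have u1 : 0 < nsq u by rewrite lt_def u0 nsq_ge0.
  rewrite -ler_pdivlMr//; apply: ge_sup; first by exists (- K).
  by move=> x Qx; rewrite ler_pdivlMr.
exists m => //; pose A := S - m%:M.
have AE u v : qform A u v = qform S u v - m * qform 1%:M u v.
  rewrite /qform /A mulmxBr mulmxBl -[m%:M]scalemx1 -scalemxAr -scalemxAl.
  by rewrite [LHS]mxE [X in _ + X]mxE; congr (_ - _); rewrite mxE.
have sA : A^T = A by rewrite /A linearB/= sS tr_scalar_mx.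
have A0 z : 0 <= qform A z z by rewrite AE -nsq_qform subr_ge0.
rewrite /eigenvalue /eigenspace -/A kermx_eq0 row_free_unit.
apply/negP => uA; have [K' K'0 hK'] := qform_bounded (invmx A).
have lower u : K'^-1 * nsq u <= qform A u u.
  have [u0|u0] := eqVneq (nsq u) 0; first by rewrite u0 mulr0.
  have u1 : 0 < nsq u by rewrite lt_def u0 nsq_ge0.
  have := qform_CauchySchwarz u (invmx A *m u) sA A0.
  have -> : qform A u (invmx A *m u) = nsq u.
    by rewrite /qform -!mulmxA mulKVmx// nsq_qform /qform mulmx1.
  have -> : qform A (invmx A *m u) (invmx A *m u) = qform (invmx A) u u.
    rewrite /qform trmx_mul trmx_inv sA -!mulmxA mulKVmx//.
  have h1 : qform (invmx A) u u <= K' * nsq u := le_trans (ler_norm _) (hK' u).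
  move=> h2; have {h2} := le_trans h2 (ler_wpM2l (A0 u) h1).
  by rewrite mulrA expr2 ler_pM2r// ler_pdivrMl// mulrC.
have Qm' : Q (m + K'^-1).
  by move=> u; have := lower u; rewrite AE -nsq_qform mulrDl; lra.
have := sup_upper_bound supQ Qm'; rewrite -/m gerDl leNgt invr_gt0.
by rewrite K'0.
Qed.

Lemma eigenvalue_qform S a : eigenvalue S a ->
  exists2 u : 'cV[R]_d, 0 < nsq u & S^T *m u = a *: u.
Proof.
move=> /eigenvalueP[v vE v0]; exists v^T.
  rewrite lt_def nsq_ge0 andbT nsq_eq0; apply: contra v0 => /eqP/(congr1 trmx).
  by rewrite trmxK trmx0 => ->.
by rewrite -trmx_mul vE linearZ.
Qed.

Lemma eigenvalueN S a : eigenvalue (- S) a -> eigenvalue S (- a).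
Proof.
move=> /eigenvalueP[v vE v0]; apply/eigenvalueP; exists v => //.
by rewrite scaleNr -vE mulmxN opprK.
Qed.

(** The infimum and the supremum of the set of eigenvalues are taken in the reals,
   hence meaningful only because this set is nonempty and bounded: both follow from
   [rayleigh_min], applied to S and to - S. *)
Lemma lambda_qform S : (0 < d)%N -> S^T = S -> forall u,
  lambda_min S * nsq u <= qform S u u /\ qform S u u <= lambda_max S * nsq u.
Proof.
move=> d0 sS u; have [m em hm] := rayleigh_min d0 sS.
have sNS : (- S)^T = - S by rewrite linearN/= sS.
have [p ep hp] := rayleigh_min d0 sNS.
have hp' v : qform S v v <= - p * nsq v.
  have := hp v; rewrite (_ : qform (- S) v v = - qform S v v) ?mulNr; first lra.
  by rewrite /qform mulmxN mulNmx mxE.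
have eigE a : eigenvalue S a -> exists2 v, 0 < nsq v & qform S v v = a * nsq v.
  move=> /eigenvalue_qform[v v0 vE]; exists v => //.
  by move: vE; rewrite sS => vE; rewrite /qform -mulmxA vE -scalemxAr mxE nsq_qform
     /qform mulmx1.
have lo a : eigenvalue S a -> m <= a.
  by move=> /eigE[v v0 vE]; rewrite -(ler_pM2r v0) -vE.
have hi a : eigenvalue S a -> a <= - p.
  by move=> /eigE[v v0 vE]; rewrite -(ler_pM2r v0) -vE.
split.
- apply: le_trans (hm u); rewrite ler_wpM2r ?nsq_ge0//.
  by apply: ge_inf => //; exists m.
- apply: (le_trans (hp' u)); rewrite ler_wpM2r ?nsq_ge0//.
  by apply: ub_le_sup; [exists (- p)|exact: eigenvalueN].
Qed.

End Rayleigh.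

(** * A lattice net for sparse vectors *)

Section LatticeNet.
Context {R : realType} {d : nat}.
Variable m : nat.
Hypothesis m0 : (0 < m)%N.

(** A coordinate of a lattice point: zero, or a sign and an absolute value j + 1. *)
Definition cell := option (bool * 'I_(5 * m)).

Definition cell_abs (v : cell) : nat := if v is Some bj then bj.2.+1 else 0.

Definition cell_val (v : cell) : R :=
  if v is Some bj then (-1) ^+ bj.1 * bj.2.+1%:R else 0.

Definition lattice_vec (f : {ffun 'I_d -> cell}) : 'cV[R]_d := \col_i cell_val (f i).

(** The radius 5 sqrt m of the ball leaves room for a rounding error of size
   sqrt m, one unit for each of the m coordinates of the support. *)
Definition lattice_net : {set {ffun 'I_d -> cell}} :=
  [set f : {ffun 'I_d -> cell} |
    (#|[set i | f i != None]%SET| <= m)%N && (\sum_i cell_abs (f i) ^ 2 <= 25 * m)%N].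

Lemma cell_val_sqr v : cell_val v ^+ 2 = (cell_abs v ^ 2)%N%:R.
Proof.
case: v => [[b j]|] /=; last by rewrite !expr0n.
by rewrite exprMn -exprM muln2 -signr_odd odd_double mul1r natrX.
Qed.

Lemma nsq_lattice_vec f : nsq (lattice_vec f) = (\sum_i cell_abs (f i) ^ 2)%N%:R.
Proof. by rewrite natr_sum; apply: eq_bigr => i _; rewrite mxE cell_val_sqr. Qed.

(** A generating function bounds the number of sparse lattice points directly,
   with no enumeration of supports: each nonzero coordinate of absolute value k
   gets the weight y 2^-k, so a point of the net weighs at least
   y^m 2^(-25m), while all points together weigh at most (1 + 2y)^d. *)
Lemma card_lattice_net (y : R) : 0 < y <= 1 ->
  #|lattice_net|%:R * (y ^+ m * 2 ^- (25 * m)) <= expR (2 * y * d%:R).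
Proof.
move=> /andP[y0 y1].
pose wt (v : cell) : R := if v is Some bj then y * 2 ^- bj.2.+1 else 1.
have wt0 v : 0 <= wt v by case: v => [[b j]|] //=; rewrite mulr_ge0 ?ltW.
have half n : \sum_(j < n) (2 ^- j.+1 : R) = 1 - 2 ^- n.
  elim: n => [|n IH]; first by rewrite big_ord0 expr0 invr1 subrr.
  by rewrite big_ord_recr/= IH exprS invfM; field; rewrite expf_neq0.
have sum_wt : \sum_v wt v <= 1 + 2 * y.
  rewrite (bigD1 None)//= lerD2l.
  rewrite (eq_bigl (fun v : cell => isSome v)); last by case.
  rewrite (reindex_omap Some id) /=; last by case=> // bj.
  rewrite (eq_bigl xpredT); last by move=> bj; rewrite eqxx.
  rewrite -(pair_bigA _ (fun (b : bool) (j : 'I_(5 * m)) => y * 2 ^- j.+1))/=.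
  rewrite (eq_bigr (fun _ : bool => y * (1 - 2 ^- (5 * m)))); last first.
    by move=> b _; rewrite -mulr_sumr half.
  rewrite sumr_const card_bool mulr2n mulrDl mul1r lerD// ler_piMr ?ltW//;
  by rewrite gtrBl invr_gt0 exprn_gt0.
apply: (@le_trans _ _ (\sum_(f : {ffun 'I_d -> cell}) \prod_i wt (f i))).
  rewrite mulr_natl -sumr_const (big_mkcond (fun f => f \in lattice_net)).
  apply: ler_sum => f _; case: ifPn => [|_]; last exact: prodr_ge0.
  rewrite inE => /andP[sf qf].
  have -> : \prod_i wt (f i) =
      y ^+ #|[set i | f i != None]%SET| * 2 ^- (\sum_i cell_abs (f i)).
    rewrite -exprVn -[X in _ * X]/(_ ^+ _) expr_sum -prodr_const.
    rewrite (big_mkcond (fun i => i \in _)) -big_split/=.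
    apply: eq_bigr => i _; rewrite inE; case: (f i) => [[b j]|] /=.
      by rewrite exprVn.
    by rewrite expr0 mulr1.
  have le2 : (\sum_i cell_abs (f i) <= 25 * m)%N.
    apply: leq_trans qf; apply: leq_sum => i _.
    by case: (cell_abs (f i)) => // n; rewrite expnS expn1 leq_pmulr.
  apply: ler_pM; [by rewrite exprn_ge0// ltW|by rewrite invr_ge0 exprn_ge0| |].
  - exact: (ler_wiXn2l (ltW y0) y1 sf).
  - by rewrite lef_pV2 ?posrE ?exprn_gt0// ler_eXn2l// ltr1n.
rewrite -(bigA_distr_bigA (fun _ => wt))/= prodr_const card_ord.
rewrite mulrC expRM_natl; apply: lerXn2r; rewrite ?nnegrE ?expR_ge0//.
- by apply: sumr_ge0.
- exact: le_trans sum_wt (expR_ge1Dx _).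
Qed.

(** Rounding towards zero keeps a point in the ball and does not enlarge its
   support. *)
Definition cell_trunc (x : R) : cell :=
  if insub (Num.truncn `|x|).-1 is Some j then
    if (Num.truncn `|x| == 0)%N then None else Some (x < 0, j)
  else None.

Lemma cell_truncP (x : R) : x ^+ 2 <= 25 * m%:R ->
  let c := cell_val (cell_trunc x) in
  [/\ c ^+ 2 <= x ^+ 2, (x - c) ^+ 2 <= 1 & (x + c) ^+ 2 <= 4 * x ^+ 2].
Proof.
move=> xm; set k := Num.truncn `|x|.
have /andP[kx xk] : k%:R <= `|x| < k.+1%:R by apply: truncn_itv.
have c_sgn : cell_val (cell_trunc x) = Num.sg x * k%:R.
  have k5 : (k.-1 < 5 * m)%N.
    have [->|k0] := posnP k; first by rewrite muln_gt0.
    rewrite prednK// -(ler_nat R); apply: le_trans kx _.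
    rewrite -(@ler_pXn2r _ 2)// ?nnegrE// real_normK ?num_real//.
    apply: le_trans xm _; rewrite natrM exprMn -natrX ler_wpM2l//.
    by rewrite expr2 ler_peMl// ler1n.
  rewrite /cell_trunc -/k insubT/=; case: eqVneq => [->|k0] /=.
    by rewrite mulr0.
  rewrite prednK ?lt0n//; congr (_ * _).
  have x0 : x != 0.
    by apply: contra k0 => /eqP x0; rewrite /k x0 normr0 truncn0.
  by rewrite sgr_def x0 mulr1n.
move=> c; pose sg := Num.sg x; pose a := `|x|.
have xE : sg * a = x by rewrite /sg /a -numEsg.
have s21 : sg ^+ 2 <= 1 by rewrite sqr_sg lern1; case: (x == 0).
have s20 : 0 <= sg ^+ 2 := sqr_ge0 sg.
have k0 : 0 <= k%:R :> R by [].
have a0 : 0 <= a := normr_ge0 x.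
have ak1 : a - k%:R <= 1 by move: xk; rewrite -natr1 /a; lra.
suff : [/\ (sg * k%:R) ^+ 2 <= (sg * a) ^+ 2, (sg * a - sg * k%:R) ^+ 2 <= 1
    & (sg * a + sg * k%:R) ^+ 2 <= 4 * (sg * a) ^+ 2].
  by rewrite xE /c c_sgn.
split.
- by rewrite !exprMn ler_wpM2l// lerXn2r ?nnegrE.
- rewrite -mulrBr exprMn; apply: mulr_ile1 => //; first exact: sqr_ge0.
  by rewrite expr_le1// subr_ge0.
- rewrite -mulrDr !exprMn [leRHS]mulrCA ler_wpM2l//.
  have -> : 4 * a ^+ 2 = (a + a) ^+ 2 by ring.
  by rewrite lerXn2r ?nnegrE ?addr_ge0// lerD2l.
Qed.

Lemma cell_trunc0 : cell_trunc 0 = None.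
Proof. by rewrite /cell_trunc normr0 truncn0 /=; case: insub. Qed.

Definition supp (z : 'cV[R]_d) : {set 'I_d} := [set i | z i 0 != 0]%SET.

(** Rounding a point of the ball of radius 5 sqrt m to the lattice moves it by
   at most sqrt m, which costs at most half of the supremum of the form. *)
Theorem sparse_net_bound (A : 'M[R]_d) (t : R) (z : 'cV[R]_d) :
  A^T = A -> 0 <= t -> (#|supp z| <= m)%N ->
  (forall f, f \in lattice_net -> supp (lattice_vec f) \subset supp z ->
     `|qform A (lattice_vec f) (lattice_vec f)| <= 25 * m%:R * t) ->
  `|qform A z z| <= 2 * t * nsq z.
Proof.
move=> sA t0 zm hnet.
have mR : 0 < m%:R :> R by rewrite ltr0n.
pose on (u : 'cV[R]_d) := forall i, z i 0 = 0 -> u i 0 = 0.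
pose Q := [set x : R | exists u, [/\ on u, nsq u <= 25 * m%:R & x = `|qform A u u|]].
have [K K0 hK] := qform_bounded A.
have Q0 : Q 0.
  exists 0; split; first by move=> i _; rewrite mxE.
  - by rewrite nsq0 mulr_ge0.
  - by rewrite /qform mulmx0 mxE normr0.
have ubQ : has_ubound Q.
  exists (K * (25 * m%:R)) => _ [u [_ un ->]]; apply: le_trans (hK u) _.
  by rewrite ler_wpM2l// ltW.
have supQ : has_sup Q by split=> //; exists 0.
pose N := sup Q.
have N0 : 0 <= N by exact: (sup_upper_bound supQ).
have homog u : on u -> `|qform A u u| <= N / (25 * m%:R) * nsq u.
  move=> uon; have [/eqP|u0] := eqVneq (nsq u) 0.
    rewrite nsq_eq0 => /eqP ->.
    by rewrite /qform mulmx0 mxE normr0 mulr_ge0 ?nsq_ge0// divr_ge0// mulr_ge0.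
  have u1 : 0 < nsq u by rewrite lt_def u0 nsq_ge0.
  pose a := Num.sqrt (25 * m%:R / nsq u).
  have a2 : a ^+ 2 = 25 * m%:R / nsq u.
    by rewrite sqr_sqrtr// divr_ge0 ?mulr_ge0// ltW.
  have : `|qform A (a *: u) (a *: u)| <= N.
    apply: (sup_upper_bound supQ); exists (a *: u); split => //.
      by move=> i /uon u0'; rewrite mxE u0' mulr0.
    by rewrite nsqZ a2 divfK.
  rewrite qformZl qformZr mulrA -expr2 a2 normrM ger0_norm; last first.
    by rewrite divr_ge0 ?mulr_ge0// ltW.
  rewrite mulrAC ler_pdivrMr// mulrC => h.
  by rewrite mulrAC ler_pdivlMr// mulr_gt0.
have polar x y : on x -> on y ->
    `|qform A x y| <= N / (25 * m%:R) * ((nsq x + nsq y) / 2).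
  move=> xon yon.
  have hp := homog (x + y) _; have hm := homog (x - y) _.
  have {hp} hp : `|qform A (x + y) (x + y)| <= N / (25 * m%:R) * nsq (x + y).
    by apply: hp => i zi; rewrite mxE (xon _ zi) (yon _ zi) addr0.
  have {hm} hm : `|qform A (x - y) (x - y)| <= N / (25 * m%:R) * nsq (x - y).
    by apply: hm => i zi; rewrite !mxE (xon _ zi) (yon _ zi) subr0.
  have nE : nsq (x + y) + nsq (x - y) = 2 * (nsq x + nsq y).
    by rewrite !nsq_qform qform_sqrD ?qform_sqrB ?trmx1//; ring.
  have qE : 4 * qform A x y = qform A (x + y) (x + y) - qform A (x - y) (x - y).
    by rewrite qform_sqrD// qform_sqrB//; ring.
  have : `|4 * qform A x y| <= N / (25 * m%:R) * (2 * (nsq x + nsq y)).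
    by rewrite qE -nE mulrDr (le_trans (ler_normB _ _))// lerD.
  rewrite normrM ger0_norm//; lra.
have step u : on u -> nsq u <= 25 * m%:R ->
    `|qform A u u| <= 25 * m%:R * t + N / 2.
  move=> uon un; pose f := [ffun i => cell_trunc (u i 0)].
  pose g := lattice_vec f.
  have gE i : g i 0 = cell_val (cell_trunc (u i 0)) by rewrite mxE ffunE.
  have ui i : u i 0 ^+ 2 <= 25 * m%:R := le_trans (nsq_coord_le u i) un.
  have gon : on g by move=> i /uon u0; rewrite gE u0 cell_trunc0.
  have gu : nsq g <= nsq u.
    by apply: ler_sum => i _; rewrite gE; case: (cell_truncP (ui i)).
  have gr : nsq (u - g) <= m%:R.
    rewrite (@le_trans _ _ #|supp z|%:R) ?ler_nat// -sumr_const.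
    rewrite (big_mkcond (fun i => i \in supp z)); apply: ler_sum => i _.
    rewrite !mxE -/(g i 0) inE; case: eqVneq => [zi|zi] /=.
      have -> : u i 0 = 0 by exact: uon.
      by rewrite ffunE uon// cell_trunc0 subrr expr0n.
    by rewrite ffunE; case: (cell_truncP (ui i)).
  have gs : nsq (u + g) <= 100 * m%:R.
    apply: (@le_trans _ _ (4 * nsq u)); last by lra.
    rewrite mulr_sumr; apply: ler_sum => i _; rewrite mxE gE.
    by case: (cell_truncP (ui i)).
  have fnet : f \in lattice_net.
    rewrite inE; apply/andP; split.
      apply: leq_trans zm; apply/subset_leq_card/fintype.subsetP => i.
      rewrite !inE ffunE; apply: contra => /eqP zi.
      by rewrite uon// cell_trunc0.
    by rewrite -(ler_nat R) -nsq_lattice_vec natrM (le_trans gu).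
  (* The factor 3 balances the sizes m of u - g and 100 m of u + g in [polar]. *)
  have -> : qform A u u = qform A g g + qform A (3 *: (u - g)) (3^-1 *: (u + g)).
    rewrite qformZl qformZr mulrA divff ?mul1r//.
    by rewrite !(qformDl, qformDr, qformNl) (qformC u g sA); ring.
  have xon : on (3 *: (u - g)).
    by move=> i zi; rewrite !mxE uon// -/(g i 0) ffunE uon// cell_trunc0 subrr mulr0.
  have yon : on (3^-1 *: (u + g)).
    by move=> i zi; rewrite !mxE uon// ffunE uon// cell_trunc0 add0r mulr0.
  apply: (le_trans (ler_normD _ _)); apply: lerD.
    apply: hnet => //; apply/fintype.subsetP => i; rewrite !inE.
    by apply: contra => /eqP zi; apply/eqP; exact: gon.
  apply: (le_trans (polar _ _ xon yon)); rewrite !nsqZ.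
  have -> : N / 2 = N / (25 * m%:R) * (25 * m%:R / 2).
    by field; rewrite lt0r_neq0.
  apply: ler_wpM2l; first by rewrite divr_ge0// mulr_ge0.
  have : 3^-1 ^+ 2 * nsq (u + g) <= 3^-1 ^+ 2 * (100 * m%:R).
    by rewrite ler_wpM2l.
  lra.
have N2 : N <= 25 * m%:R * t + N / 2.
  by apply: ge_sup; [exists 0|move=> _ [u [uon un ->]]; exact: step].
apply: (le_trans (homog z (fun i => id))).
by rewrite ler_wpM2r ?nsq_ge0// ler_pdivrMr ?mulr_gt0//; lra.
Qed.

End LatticeNet.

(** * Residual variances and recovery on a good sample *)

Section ResidVar.
Context {R : realType} {d : nat}.
Variables (S : 'M[R]_d) (C : {set 'I_d}).
Hypothesis sS : S^T = S.

(** Multiplication by this matrix extends a vector indexed by [C] by zero. *)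
Definition incl_mx : 'M[R]_(d, #|C|) := \matrix_(i, j) (i == enum_val j)%:R.

Lemma mul_incl_mx (a : 'cV[R]_#|C|) j : (incl_mx *m a) (enum_val j) 0 = a j 0.
Proof.
rewrite mxE (bigD1 j)//= mxE eqxx mul1r big1 ?addr0// => l lj.
by rewrite mxE (inj_eq enum_val_inj) eq_sym (negPf lj) mul0r.
Qed.

Lemma mul_incl_mx_out (a : 'cV[R]_#|C|) i : i \notin C -> (incl_mx *m a) i 0 = 0.
Proof.
move=> iC; rewrite mxE big1// => l _; rewrite mxE.
by case: eqP iC => [->|_ _]; rewrite ?enum_valP ?mul0r.
Qed.

Lemma incl_mxK (w : 'cV[R]_d) : (forall i, i \notin C -> w i 0 = 0) ->
  exists a, w = incl_mx *m a.
Proof.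
move=> wC; exists (\col_j w (enum_val j) 0); apply/colP => i.
have [iC|iC] := boolP (i \in C); last by rewrite wC// mul_incl_mx_out.
by rewrite -(enum_rankK_in iC iC) mul_incl_mx mxE.
Qed.

Lemma tr_incl_mx_mul {n} (A : 'M[R]_(d, n)) j l :
  (incl_mx^T *m A) j l = A (enum_val j) l.
Proof.
rewrite mxE (bigD1 (enum_val j))//= !mxE eqxx mul1r big1 ?addr0// => i /negPf ij.
by rewrite !mxE ij mul0r.
Qed.

Lemma mul_mx_incl_mx {n} (A : 'M[R]_(n, d)) l j :
  (A *m incl_mx) l j = A l (enum_val j).
Proof.
rewrite mxE (bigD1 (enum_val j))//= !mxE eqxx mulr1 big1 ?addr0// => i /negPf ij.
by rewrite !mxE ij mulr0.
Qed.

Hypothesis S_pos : forall z : 'cV[R]_d, (forall i, i \notin C -> z i 0 = 0) ->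
  z != 0 -> 0 < qform S z z.

Let G := block S C C.

Let G_E : G = incl_mx^T *m S *m incl_mx.
Proof. by apply/matrixP => i j; rewrite mxE mul_mx_incl_mx tr_incl_mx_mul. Qed.

Let G_unit : G \in unitmx.
Proof.
rewrite -unitmx_tr -row_free_unit -kermx_eq0.
apply/eqP/row_matrixP => i; rewrite row0; set v := row i _.
have /(congr1 trmx) : v *m G^T = 0 by apply/eqP; rewrite -sub_kermx row_sub.
rewrite trmx_mul trmxK trmx0 => Gv.
have : incl_mx *m v^T = 0.
  apply: contrapT => /eqP /(S_pos (@mul_incl_mx_out _)).
  rewrite /qform trmx_mul -!mulmxA (mulmxA incl_mx^T) (mulmxA _ incl_mx) -G_E.
  by rewrite Gv mulmx0 mxE ltxx.
move=> /colP h; apply/rowP => j; have := h (enum_val j).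
by rewrite mul_incl_mx !mxE.
Qed.

Let G_sym : G^T = G.
Proof. by rewrite G_E !trmx_mul trmxK sS mulmxA. Qed.

(** Completing the square: the Schur complement is the least value of the form on
   the vectors e_k - w with w supported on [C]. *)
Lemma resid_var_attained k : exists2 w : 'cV[R]_d,
  (forall i, i \notin C -> w i 0 = 0) &
  resid_var S k C = qform S (delta_mx k 0 - w) (delta_mx k 0 - w) /\
  forall u : 'cV[R]_d, (forall i, i \notin C -> u i 0 = 0) ->
    resid_var S k C <= qform S (delta_mx k 0 - u) (delta_mx k 0 - u).
Proof.
pose e : 'cV[R]_d := delta_mx k 0; pose h := incl_mx^T *m S *m e.
have hrow : block_row S k C = h^T.
  apply/rowP => j; rewrite [LHS]mxE [RHS]mxE /h -mulmxA tr_incl_mx_mul.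
  by rewrite /e -colE mxE -[in LHS]sS mxE.
have hcol : block_col S C k = h.
  by apply/colP => j; rewrite [LHS]mxE /h -mulmxA tr_incl_mx_mul /e -colE mxE.
have ee : qform S e e = S k k.
  by rewrite /qform /e trmx_delta -rowE -colE !mxE.
have expand a : qform S (e - incl_mx *m a) (e - incl_mx *m a) =
    S k k - 2 * (h^T *m a) 0 0 + qform G a a.
  rewrite qform_sqrB// ee; congr (_ - 2 * _ + _).
    by rewrite /qform /h !trmx_mul trmxK sS !mulmxA.
  by rewrite /qform G_E trmx_mul !mulmxA.
pose a0 := invmx G *m h.
have vE : resid_var S k C = S k k - (h^T *m a0) 0 0.
  by rewrite /resid_var hrow hcol -/G -mulmxA.
have Ga0 a : qform G a a0 = (h^T *m a) 0 0.
  by rewrite qformC// /qform /a0 trmx_mul trmx_inv G_sym mulmxKV.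
have e0 : resid_var S k C = qform S (e - incl_mx *m a0) (e - incl_mx *m a0).
  by rewrite expand vE Ga0; ring.
exists (incl_mx *m a0); first exact: mul_incl_mx_out.
split=> // u /incl_mxK[a ->]; rewrite expand vE -[a](subrK a0).
set b := a - a0; rewrite mulmxDr qform_sqrD// !Ga0.
rewrite [(h^T *m b + _) 0 0]mxE.
have : 0 <= qform G b b.
  have -> : qform G b b = qform S (incl_mx *m b) (incl_mx *m b).
    by rewrite /qform G_E trmx_mul !mulmxA.
  have [->|b0] := eqVneq (incl_mx *m b) 0; first by rewrite /qform mulmx0 mxE.
  exact/ltW/(S_pos (mul_incl_mx_out b)).
lra.
Qed.

End ResidVar.

(** The empirical residual variance separates the candidate sets: those that
   contain all parents lie within V / 20 of one another, the others at least
   11 V / 20 above them.  So the minimiser contains all parents, and removing one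
   of its elements crosses the threshold V / 2 exactly when it is a parent. *)
Theorem learned_dag_correct {R : realType} {d : nat} (S Sg B : 'M[R]_d)
    (tau : {perm 'I_d}) (q : nat) (V : R) :
  S^T = S -> topological_sort B tau -> (forall k, (#|pa B k| <= q)%N) -> 0 < V ->
  (forall z, 0 <= qform Sg z z) ->
  (forall z, (#|supp z| <= 2 * q)%N -> z != 0 -> 0 < qform S z z) ->
  (forall j (z : 'cV[R]_d), supp z \subset predecessors tau j ->
     (#|supp z| <= 2 * q)%N ->
     6 / 10 * qform Sg z z - V / 20 <=
       qform S z z + 2 * qform S (resid_vec B (tau j)) z) ->
  (forall j (A : {set 'I_d}) (w : 'cV[R]_d), A \subset predecessors tau j ->
     pa B (tau j) :\: A != finset.set0 -> (forall i, i \notin A -> w i 0 = 0) ->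
     V <= qform Sg (col (tau j) B - w) (col (tau j) B - w)) ->
  learned_dag S (V%:E / 2%:E)%E q tau = dag B.
Proof.
move=> sS tauP paq V0 Sg0 S_pos excess gap.
have bE j i : i \notin pa B (tau j) -> col (tau j) B i 0 = 0.
  by rewrite inE /edge negbK mxE => /eqP.
have vP j (C : {set 'I_d}) : C \subset predecessors tau j -> (#|C| <= q)%N ->
    let Q := qform S (resid_vec B (tau j)) (resid_vec B (tau j)) in
    let v := resid_var S (tau j) C in
    (pa B (tau j) \subset C -> Q - V / 20 <= v /\ v <= Q) /\
    (~~ (pa B (tau j) \subset C) -> Q + 11 / 20 * V <= v).
  move=> Cj Cq Q v; set k := tau j.
  have posC (z : 'cV[R]_d) : (forall i, i \notin C -> z i 0 = 0) -> z != 0 -> 0 < qform S z z.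
    move=> zC; apply: S_pos; apply: (@leq_trans q); last by rewrite mul2n -addnn leq_addr.
    apply: leq_trans Cq; apply/subset_leq_card/fintype.subsetP => i; rewrite inE.
    by apply: contraNT => /zC ->.
  have [w wC [vE vmin]] := resid_var_attained sS posC k.
  pose z := col k B - w.
  have rz : delta_mx k 0 - w = resid_vec B k + z by rewrite /z addrA subrK.
  have zU i : i \notin pa B k :|: C -> z i 0 = 0.
    by rewrite inE negb_or => /andP[ip iC]; rewrite !mxE wC// subr0 -(bE j i ip) mxE.
  have zsub : supp z \subset pa B k :|: C.
    by apply/fintype.subsetP => i; rewrite inE; apply: contraNT => /zU ->.
  have zj : supp z \subset predecessors tau j.
    by apply: (fintype.subset_trans zsub); rewrite finset.subUset pa_sub_pred.
  have zq : (#|supp z| <= 2 * q)%N.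
    apply: leq_trans (subset_leq_card zsub) _; rewrite mul2n -addnn.
    by apply: leq_trans (leq_card_setU _ _) _; rewrite leq_add ?paq.
  have vz : v = Q + (qform S z z + 2 * qform S (resid_vec B k) z).
    by rewrite /v vE rz qform_sqrD// -/Q; ring.
  have ex := excess j z zj zq; rewrite -/k in ex.
  split=> [paC|npaC]; last first.
    have : V <= qform Sg z z.
      by apply: (gap j C w) => //; rewrite finset.setD_eq0.
    by rewrite vz; lra.
  split; first by have := Sg0 z; rewrite vz; lra.
  by apply: vmin => i iC; apply: bE; apply: contra iC; exact: (fintype.subsetP paC).
have lpE j : learned_parents S (V%:E / 2%:E)%E q tau j = pa B (tau j).
  rewrite /learned_parents /best_subset; case: arg_minP => /=.
    by rewrite finset.sub0set finset.cards0.
  move=> C /andP[Cj Cq] Cmin; set k := tau j.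
  have [vpa _] := vP j (pa B k) (pa_sub_pred tauP j) (paq k).
  have {vpa} [_ vpa] := vpa (fintype.subxx _).
  have [hin hout] := vP j C Cj Cq.
  have paC : pa B k \subset C.
    apply/negPn/negP => /hout.
    have := Cmin (pa B k); rewrite (pa_sub_pred tauP j) paq => /(_ isT).
    by move: vpa; rewrite -/k; lra.
  have [C1 C2] := hin paC.
  apply/finset.setP => i; rewrite finset.in_setD inE.
  have [iC|iC] := boolP (i \in C); last first.
    by rewrite andbF; apply/esym/negbTE; apply: contra iC; exact: (fintype.subsetP paC).
  rewrite andbT /= inver (_ : (2 == 0 :> R) = false); last by rewrite pnatr_eq0.
  rewrite -EFinM lee_fin.
  have Dj : C :\ i \subset predecessors tau j.
    exact: fintype.subset_trans (finset.subD1set _ _) Cj.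
  have Dq : (#|C :\ i| <= q)%N.
    by apply: leq_trans Cq; exact/subset_leq_card/finset.subD1set.
  have [din dout] := vP j (C :\ i) Dj Dq.
  have [ip|ip] := boolP (i \in pa B k).
    have /dout h : ~~ (pa B k \subset C :\ i).
      by apply/negP => /fintype.subsetP/(_ _ ip); rewrite !inE eqxx.
    by rewrite -ltNge distrC; apply: (lt_le_trans _ (ler_norm _)); lra.
  have /din[D1 D2] : pa B k \subset C :\ i by rewrite finset.subsetD1 paC ip.
  by apply/negbTE; rewrite negbK ler_norml; apply/andP; split; lra.
apply/finset.setP => -[a b]; rewrite /learned_dag finset.in_set lpE permKV.
by rewrite !inE.
Qed.

(** * Measurability of the learned graph *)

Section Measurability.
Context {disp : measure_display} {T : measurableType disp} {R : realType}.

Lemma measurable_invr (f : T -> R) : measurable_fun setT f ->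
  measurable_fun setT (fun w => (f w)^-1).
Proof.
move=> mf.
(* The inverse is x times the real power -1 of x^2, also at x = 0. *)
have -> : (fun w => (f w)^-1) = (fun w => f w * (f w ^+ 2) `^ (-1)).
  apply/funext => w; rewrite powR_inv1 ?sqr_ge0//.
  have [->|f0] := eqVneq (f w) 0; first by rewrite invr0 mul0r.
  by rewrite expr2 invfM mulrA divff// mul1r.
apply: measurable_funM => //; apply: (measurableT_comp (measurable_powR (-1))).
exact: measurable_funX.
Qed.

Lemma measurable_det n (A : T -> 'M[R]_n) :
  (forall i j, measurable_fun setT (fun w => A w i j)) ->
  measurable_fun setT (fun w => \det (A w)).
Proof.
move=> mA; rewrite /determinant; apply: measurable_sum => s.
apply: measurable_funM => //.
by apply: measurable_prod => i _; exact: mA.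
Qed.

Lemma measurable_invmx n (A : T -> 'M[R]_n) :
  (forall i j, measurable_fun setT (fun w => A w i j)) ->
  forall i j, measurable_fun setT (fun w => invmx (A w) i j).
Proof.
move=> mA i j.
have -> : (fun w => invmx (A w) i j) = (fun w =>
    if \det (A w) == 0 then A w i j else (\det (A w))^-1 * cofactor (A w) j i).
  apply/funext => w; rewrite /invmx unitmxE unitfE.
  by case: eqVneq => // _; rewrite !mxE.
apply: measurable_fun_ifT => //.
- by apply: measurable_fun_eqr => //; exact: measurable_det.
apply: measurable_funM; first by apply: measurable_invr; exact: measurable_det.
apply: measurable_funM => //; apply: measurable_det => k l.
by under eq_fun do rewrite !mxE; exact: mA.
Qed.

Lemma measurable_resid_var d (S : T -> 'M[R]_d) k (C : {set 'I_d}) :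
  (forall i j, measurable_fun setT (fun w => S w i j)) ->
  measurable_fun setT (fun w => resid_var (S w) k C).
Proof.
move=> mS; apply: measurable_funB => //.
under eq_fun do rewrite mxE; apply: measurable_sum => j.
under eq_fun do rewrite mxE; apply: measurable_funM; last first.
  by under eq_fun do rewrite mxE; exact: mS.
apply: measurable_sum => i; apply: measurable_funM.
  by under eq_fun do rewrite mxE; exact: mS.
by apply: measurable_invmx => a b; under eq_fun do rewrite mxE; exact: mS.
Qed.

(** A set that depends on finitely many measurable boolean tests is a finite union
   of cells, whatever the way in which it depends on them. *)
Lemma measurable_finite_tests {K : finType} (b : K -> T -> bool) (A : set T) :
  (forall k, measurable_fun setT (b k)) ->
  (forall w w', (forall k, b k w = b k w') -> A w -> A w') -> measurable A.
Proof.
move=> mb hA.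
have -> : A = \bigcup_(t in [set t : {ffun K -> bool} |
      exists2 w, A w & forall k, b k w = t k])
    \bigcap_(k in setT) [set w | b k w = t k].
  apply/seteqP; split => [w Aw|w [t [w' Aw' hw'] hw]].
    exists [ffun k => b k w]; first by exists w => // k; rewrite ffunE.
    by move=> k _ /=; rewrite ffunE.
  by apply: (hA w') => // k; rewrite hw' hw.
apply: fin_bigcup_measurable => // t _; apply: fin_bigcap_measurable => // k _.
by have := mb k measurableT [set t k] Logic.I; rewrite setTI.
Qed.

Lemma eq_arg_min {I : finType} (i0 : I) (p : pred I) (F F' : I -> R) :
  (forall i j, (F i <= F j) = (F' i <= F' j)) ->
  [arg min_(i < i0 | p i) F i]%O = [arg min_(i < i0 | p i) F' i]%O.
Proof.
move=> h; rewrite /Order.arg_min /extremum; congr odflt; apply: eq_pick => i /=.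
by congr andb; apply: eq_forallb => j; rewrite h.
Qed.

(** The graph is a function of the comparisons between residual variances, with
   one another and, for the differences, with the threshold. *)
Lemma measurable_learned_dag d (S : T -> 'M[R]_d) (gamma : \bar R) q
    (tau : {perm 'I_d}) (G : {set 'I_d * 'I_d}) :
  (forall i j, measurable_fun setT (fun w => S w i j)) ->
  measurable [set w | learned_dag (S w) gamma q tau = G].
Proof.
move=> mS.
pose K := ('I_d * {set 'I_d} * {set 'I_d} + 'I_d * {set 'I_d} * 'I_d)%type.
pose v w j C := resid_var (S w) (tau j) C.
pose b (k : K) w := match k with
  | inl (j, C, C') => v w j C <= v w j C'
  | inr (j, C, i) => (`|v w j C - v w j (C :\ i)|%:E <= gamma)%E
  end.
have mv j C : measurable_fun setT (fun w => v w j C).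
  exact: measurable_resid_var.
apply: (measurable_finite_tests (b := b)) => [[[[j C] C']|[[j C] i]]|w w' h /= <-].
- exact: measurable_fun_ler.
- apply: measurable_fun_lee => //; apply/measurable_EFinP.
  by apply: measurableT_comp => //; exact: measurable_funB.
have bestE j : best_subset (S w) q tau j = best_subset (S w') q tau j.
  by apply: eq_arg_min => C C'; exact: (h (inl (j, C, C'))).
apply/finset.setP => -[a c]; rewrite /learned_dag !finset.in_set /=.
rewrite /learned_parents bestE /=; set C := best_subset _ _ _ _.
by have := h (inr (tau^-1%g c, C, a)); rewrite /b /v => ->.
Qed.

End Measurability.

(** * Union bounds, counting and sample covariances *)

Lemma union_bound {disp : measure_display} {T : measurableType disp}
    {R : realType} (P : probability T R) {K : choiceType} (s : seq K)
    (A : K -> set T) (G : set T) (p : R) :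
  measurable G -> 0 <= p -> (forall k, measurable (A k)) ->
  (forall k, (P (A k) <= p%:E)%E) ->
  (forall w, G w -> exists2 k, k \in s & A k w) ->
  (P G <= ((size s)%:R * p)%:E)%E.
Proof.
move=> mG p0 mA pA GA.
have [mU PU] : measurable (\big[setU/set0]_(k <- s) A k) /\
    (P (\big[setU/set0]_(k <- s) A k) <= ((size s)%:R * p)%:E)%E.
  elim: (s) => [|k r [mr Pr]]; first by rewrite big_nil measure0 mul0r.
  rewrite big_cons; split; first exact: measurableU.
  rewrite (le_trans (measureU2 _ (mA k) mr))//= -natr1 mulrDl mul1r addrC EFinD.
  exact: leeD.
apply: le_trans PU; rewrite le_measure ?inE// => w /GA[k ks Akw].
by rewrite -bigcup_seq; exists k.
Qed.

(** [card_lattice_net] at y = q / d: the total weight is exp(2q), and y^(2q) costs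
   exp(2q log (d / q)), which is where the rate q log (d / q) comes from. *)
Lemma card_net_le {R : realType} (d q : nat) : (1 <= q <= d)%N ->
  (#|@lattice_net d (2 * q)|%:R <= expR (54 * (q%:R * log_ratio d q)) :> R).
Proof.
move=> /andP[q1 qd]; pose L : R := log_ratio d q.
have L1 : 1 <= L by rewrite /L /log_ratio le_max lexx.
have q0 : 0 < q%:R :> R by rewrite ltr0n.
have d0 : 0 < d%:R :> R by rewrite ltr0n; exact: leq_trans qd.
have y01 : 0 < (q%:R / d%:R : R) <= 1.
  by rewrite divr_gt0//= ler_pdivrMr// mul1r ler_nat.
have := @card_lattice_net R d (2 * q) (q%:R / d%:R) y01.
rewrite -mulrA divfK ?lt0r_neq0// => h.
have : expR (- (2 * (q%:R * L))) * expR (- (50 * q%:R)) <=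
    (q%:R / d%:R) ^+ (2 * q) * 2 ^- (25 * (2 * q)) :> R.
  apply: ler_pM; rewrite ?expR_ge0//.
    have -> : (q%:R / d%:R : R) = expR (- ln (d%:R / q%:R)).
      by rewrite expRN lnK ?posrE ?divr_gt0// invf_div.
    rewrite -expRM_natl ler_expR natrM mulrN lerN2 -mulrA ler_wpM2l//.
    by rewrite ler_wpM2l ?ler0n// /L /log_ratio le_max lexx orbT.
  rewrite expRN lef_pV2 ?posrE ?expR_gt0 ?exprn_gt0//.
  have -> : 50 * q%:R = (25 * (2 * q))%N%:R * 1 :> R by rewrite !natrM; ring.
  rewrite expRM_natl lerXn2r ?nnegrE ?expR_ge0//.
  by have := expR_ge1Dx (1 : R).
rewrite -expRD => h2.
have {h h2} h := le_trans (ler_wpM2l (ler0n _ _) h2) h.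
rewrite -(ler_pM2r (expR_gt0 (- (2 * (q%:R * L)) - 50 * q%:R))).
apply: (le_trans h); rewrite -expRD ler_expR -/L.
have : 1 * q%:R <= L * q%:R by rewrite ler_wpM2r// ltW.
lra.
Qed.

Lemma card_nodes_le {R : realType} (d q : nat) : (1 <= q <= d)%N ->
  d%:R <= expR (2 * (q%:R * log_ratio d q)) :> R.
Proof.
move=> /andP[q1 qd]; pose L : R := log_ratio d q.
have L1 : 1 <= L by rewrite /L /log_ratio le_max lexx.
have q0 : 0 < q%:R :> R by rewrite ltr0n.
have q1' : 1 <= q%:R :> R by rewrite ler1n.
have d0 : 0 < d%:R :> R by rewrite ltr0n; exact: leq_trans qd.
have -> : d%:R = (d%:R / q%:R) * q%:R :> R by rewrite divfK ?lt0r_neq0.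
apply: (@le_trans _ _ (expR L * expR q%:R)); last first.
  rewrite -expRD ler_expR -/L.
  have : 1 * L <= q%:R * L by rewrite ler_wpM2r// (le_trans _ L1).
  have : 1 * q%:R <= L * q%:R by rewrite ler_wpM2r// ltW.
  lra.
apply: ler_pM => //.
  rewrite -{1}[d%:R / q%:R]lnK ?posrE ?divr_gt0//.
  by rewrite ler_expR /L /log_ratio le_max lexx orbT.
by apply: le_trans (expR_ge1Dx _); rewrite lerDr.
Qed.

Section SampleCovariance.
Context {R : realType} {d n : nat}.
Variable x : 'I_n -> d.-tuple R.

Lemma sample_covariance_sym : (sample_covariance x)^T = sample_covariance x.
Proof.
rewrite /sample_covariance linearZ/= linear_sum; congr (_ *: _).
by apply: eq_bigr => i _; rewrite /= trmx_mul trmxK.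
Qed.

Lemma qform_sample_covariance u : qform (sample_covariance x) u u =
  n%:R^-1 * \sum_i linform u (x i) ^+ 2.
Proof.
rewrite /qform /sample_covariance -scalemxAr -scalemxAl mxE; congr (_ * _).
rewrite mulmx_sumr mulmx_suml summxE; apply: eq_bigr => i _.
rewrite -!mulmxA mulmxA mxE big_ord1 expr2 !linformE; congr (_ * _).
transitivity (((u^T *m col_of_tuple (x i))^T) 0 0); last by rewrite mxE.
by rewrite trmx_mul trmxK.
Qed.

End SampleCovariance.

Lemma measurable_sample_covariance {disp : measure_display}
    {T : measurableType disp} {R : realType} {d n : nat} (P : probability T R)
    (Xs : 'I_n -> {RV P >-> d.-tuple R}) a b :
  measurable_fun setT (fun w => sample_covariance (fun i => Xs i w) a b).
Proof.
have mX i j : measurable_fun setT (fun w => tnth (Xs i w) j).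
  exact: (measurableT_comp (measurable_tnth j) (@measurable_funPT _ _ _ _ (Xs i))).
under eq_fun do rewrite mxE summxE.
apply: measurable_funM => //; apply: measurable_sum => i.
under eq_fun do rewrite mxE big_ord1 !mxE.
exact: measurable_funM.
Qed.

Lemma measurable_qform {disp : measure_display} {T : measurableType disp}
    {R : realType} {d : nat} (S : T -> 'M[R]_d) (u v : 'cV[R]_d) :
  (forall i j, measurable_fun setT (fun w => S w i j)) ->
  measurable_fun setT (fun w => qform (S w) u v).
Proof.
move=> mS; under eq_fun do rewrite qformE.
by apply: measurable_sum => i; apply: measurable_sum => j; exact: measurable_funM.
Qed.

(** * From the net to all sparse vectors *)

Lemma qform_rank1 {R : realType} {d : nat} (l u : 'cV[R]_d) :
  qform (l *m l^T) u u = (l^T *m u) 0 0 ^+ 2.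
Proof.
rewrite /qform -!mulmxA mulmxA mxE big_ord1 expr2; congr (_ * _).
by transitivity (((l^T *m u)^T) 0 0); [rewrite trmx_mul trmxK|rewrite mxE].
Qed.

Section SparseExcess.
Context {R : realType} {d m : nat}.
Variables (S Sg : 'M[R]_d) (M V : R).
Hypotheses (m0 : (0 < m)%N) (M1 : 1 < M) (V0 : 0 < V).
Hypotheses (sS : S^T = S) (sSg : Sg^T = Sg).
Hypothesis Sg_lb : forall u, nsq u <= M * qform Sg u u.
Hypothesis Sg_ub : forall u, qform Sg u u <= M * nsq u.

Let M0 : 0 < M. Proof. exact: lt_trans M1. Qed.

Let mR : 0 < m%:R :> R. Proof. by rewrite ltr0n. Qed.

Let Sg0 u : 0 <= qform Sg u u.
Proof. by have := le_trans (nsq_ge0 u) (Sg_lb u); rewrite pmulr_rge0. Qed.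

Let net_ub f : f \in @lattice_net d m ->
  qform Sg (lattice_vec f) (lattice_vec f) <= 25 * m%:R * M.
Proof.
rewrite inE => /andP[_ fm]; apply: le_trans (Sg_ub _) _.
by rewrite mulrC ler_wpM2r ?(ltW M0)// nsq_lattice_vec -natrM ler_nat.
Qed.

(** The relative precision 1 / (10 M^2) on the net is absolute precision 1 / (10 M)
   per unit of squared length, and on vectors of unit length Sg is at least 1 / M. *)
Lemma sparse_lower (z : 'cV[R]_d) : (#|supp z| <= m)%N ->
  (forall f, f \in @lattice_net d m ->
    let g := lattice_vec f in
    `|qform S g g - qform Sg g g| <= (10 * M ^+ 2)^-1 * qform Sg g g) ->
  8 / 10 * qform Sg z z <= qform S z z.
Proof.
move=> zm h.
have qB u : qform (S - Sg) u u = qform S u u - qform Sg u u.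
  by rewrite /qform mulmxBr mulmxBl mxE [X in _ + X]mxE.
have t0 : 0 <= (10 * M)^-1 by rewrite invr_ge0 mulr_ge0// ltW.
have sA : (S - Sg)^T = S - Sg by rewrite linearB/= sS sSg.
have := sparse_net_bound m0 sA t0 zm.
have hnet f : f \in @lattice_net d m -> supp (lattice_vec f : 'cV[R]_d) \subset supp z ->
    `|qform (S - Sg) (lattice_vec f) (lattice_vec f)| <= 25 * m%:R * (10 * M)^-1.
  move=> fn _; rewrite qB (le_trans (h f fn))//.
  apply: (@le_trans _ _ ((10 * M ^+ 2)^-1 * (25 * m%:R * M))).
    by rewrite ler_wpM2l ?net_ub// invr_ge0 mulr_ge0// sqr_ge0.
  by rewrite le_eqVlt; apply/orP; left; apply/eqP; field; rewrite lt0r_neq0.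
move=> /(_ hnet); rewrite qB ler_norml => /andP[+ _].
have : 2 * (10 * M)^-1 * nsq z <= 2 * (10 * M)^-1 * (M * qform Sg z z).
  by rewrite ler_wpM2l// mulr_ge0.
have -> : 2 * (10 * M)^-1 * (M * qform Sg z z) = qform Sg z z / 5.
  by field; rewrite lt0r_neq0.
lra.
Qed.

(** The scale [alpha] gives the residual part the same population size as the
   largest lattice vectors, and the difference of the two quadratic forms is a
   multiple of the cross term. *)
Lemma sparse_excess (z r : 'cV[R]_d) (s t alpha : R) : (#|supp z| <= m)%N ->
  0 < s -> qform Sg r r = s ^+ 2 -> s ^+ 2 <= M ->
  alpha ^+ 2 * s ^+ 2 = 25 * m%:R * M -> 0 <= t -> t ^+ 2 = V / (200 * M ^+ 3) ->
  (forall g : 'cV[R]_d, supp g \subset supp z -> qform Sg r g = 0) ->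
  (forall f, f \in @lattice_net d m ->
    let g := lattice_vec f in
    `|qform S g g - qform Sg g g| <= (10 * M ^+ 2)^-1 * qform Sg g g) ->
  (forall f (b : bool), f \in @lattice_net d m ->
    let u := alpha *: r + (-1) ^+ b *: lattice_vec f in
    `|qform S u u - qform Sg u u| <= t * qform Sg u u) ->
  6 / 10 * qform Sg z z - V / 20 <= qform S z z + 2 * qform S r z.
Proof.
move=> zm s0 rs sM al t0 t2 orth h1 h2.
have lower := sparse_lower zm h1.
have a2 : 0 < alpha ^+ 2.
  have : 0 < alpha ^+ 2 * s ^+ 2 by rewrite al !mulr_gt0.
  by rewrite pmulr_lgt0// exprn_gt0.
pose l := S *m r; pose A := l *m l^T.
have sA : A^T = A by rewrite trmx_mul trmxK.
have AE u : qform A u u = qform S r u ^+ 2.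
  by rewrite /A qform_rank1 /l trmx_mul sS.
have T0 : 0 <= M ^+ 2 * t ^+ 2 by rewrite mulr_ge0 ?sqr_ge0.
have hnet f : f \in @lattice_net d m -> supp (lattice_vec f : 'cV[R]_d) \subset supp z ->
    `|qform A (lattice_vec f) (lattice_vec f)| <= 25 * m%:R * (M ^+ 2 * t ^+ 2).
  move=> fn fz; set g := lattice_vec f.
  have gub := net_ub fn; rewrite -/g in gub.
  have rg : qform Sg r g = 0 by exact: orth.
  have hS b : let e : R := (-1) ^+ b in
      qform S (alpha *: r + e *: g) (alpha *: r + e *: g) =
      alpha ^+ 2 * qform S r r + 2 * alpha * e * qform S r g + qform S g g.
    move=> e; rewrite qform_sqrD// !(qformZl, qformZr).
    have e2 : e * e = 1 by rewrite -expr2 sqrr_sign.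
    by rewrite [e * (e * _)]mulrA e2; ring.
  have hSg b : let e : R := (-1) ^+ b in
      qform Sg (alpha *: r + e *: g) (alpha *: r + e *: g) =
      25 * m%:R * M + qform Sg g g.
    move=> e; rewrite qform_sqrD// !(qformZl, qformZr) rg rs -al.
    have e2 : e * e = 1 by rewrite -expr2 sqrr_sign.
    by rewrite [e * (e * _)]mulrA e2; ring.
  have := h2 f false fn; have := h2 f true fn; rewrite /= -/g.
  rewrite hS (hS false) hSg (hSg false) expr0 expr1 => hm hp.
  have cr : `|4 * (alpha * qform S r g)| <= 4 * (25 * m%:R * M * t).
    set P1 := qform S g g in hm hp; set P2 := qform S r r in hm hp.
    set P3 := qform Sg g g in hm hp gub.
    have gt : t * (25 * m%:R * M + P3) <= t * (2 * (25 * m%:R * M)).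
      by rewrite ler_wpM2l//; lra.
    move: hm hp; rewrite !ler_norml => /andP[m1 m2] /andP[p1 p2].
    by apply/andP; split; lra.
  have {cr} : `|alpha * qform S r g| <= 25 * m%:R * M * t.
    by move: cr; rewrite normrM ger0_norm// ler_pM2l.
  rewrite -(@ler_pXn2r _ 2)// ?nnegrE//; last by rewrite !mulr_ge0// ltW.
  rewrite real_normK ?num_real// exprMn => cr.
  rewrite AE ger0_norm ?sqr_ge0// -(ler_pM2l a2) (le_trans cr)//.
  rewrite -subr_ge0.
  have -> : alpha ^+ 2 * (25 * m%:R * (M ^+ 2 * t ^+ 2)) - (25 * m%:R * M * t) ^+ 2
     = 25 * m%:R * M * t ^+ 2 * (alpha ^+ 2 * M - 25 * m%:R * M) by ring.
  apply: mulr_ge0; first by rewrite !mulr_ge0 ?sqr_ge0 ?(ltW M0).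
  by rewrite subr_ge0 -al ler_wpM2l// ltW.
have := sparse_net_bound m0 sA T0 zm hnet; rewrite AE ger0_norm ?sqr_ge0// => bnd.
have {bnd} : qform S r z ^+ 2 <= V * qform Sg z z / 100.
  apply: (le_trans bnd).
  apply: (@le_trans _ _ (2 * (M ^+ 2 * t ^+ 2) * (M * qform Sg z z))).
    by rewrite ler_wpM2l// mulr_ge0.
  by rewrite t2 le_eqVlt; apply/orP; left; apply/eqP; field; rewrite lt0r_neq0.
have Q0 := Sg0 z; set Q := qform Sg z z in lower Q0 *; set l0 := qform S r z.
move=> bnd.
have : `|2 * l0| <= Q / 5 + V / 20.
  have p0 : 0 <= Q / 5 + V / 20.
    by rewrite addr_ge0 ?divr_ge0 ?(ltW V0).
  rewrite -(@ler_pXn2r _ 2)// ?nnegrE//.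
  rewrite real_normK ?num_real//.
  have := sqr_ge0 (Q / 5 - V / 20); nra.
by rewrite ler_norml => /andP[+ _]; lra.
Qed.

End SparseExcess.

(** * Recovery with probability one half *)

Lemma measurable_gt_set {disp : measure_display} {T : measurableType disp}
    {R : realType} (f : T -> R) (a : R) :
  measurable_fun setT f -> measurable [set w | a < f w].
Proof.
move=> mf; rewrite (_ : [set w | _] = ~` (setT `&` [set w | f w <= a])).
  by apply: measurableC; exact: measurable_fun_le.
apply/seteqP; split => w /=; rewrite ltNge; first by move=> /negP h [_ /h].
by move=> /not_andP[//|/negP].
Qed.

(** Relative to its mean, the form at [u] is an average of n centred squares of
   standard Gaussian variables, to which the Chernoff bound applies. *)
Lemma qform_concentration {disp0 disp : measure_display}
    {T0 : measurableType disp0} {T : measurableType disp} {R : realType}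
    (P0 : probability T0 R) (P : probability T R) {d n : nat}
    (X eps : {RV P0 >-> d.-tuple R}) (B : 'M[R]_d) (sigma : 'I_d -> R)
    (tau : {perm 'I_d}) (Xs : 'I_n -> {RV P >-> d.-tuple R})
    (u : 'cV[R]_d) (t : R) :
  topological_sort B tau ->
  gaussian_noise P0 (fun k w => tnth (eps w) k) sigma ->
  (forall w, col_of_tuple (X w) =
     B^T *m col_of_tuple (X w) + col_of_tuple (eps w)) ->
  iid_samples X Xs -> (0 < n)%N -> 0 <= t <= 1 ->
  let v := qform (covariance_matrix X) u u in 0 < v ->
  (P [set w | t * v <
        `|qform (sample_covariance (fun i => Xs i w)) u u - v|]%R
   <= (2 * expR (- (n%:R * t ^+ 2 / 512)))%:E)%E.
Proof.
move=> tauP noiseE semE [iXs lXs] n0 t01 v v0.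
have nR : 0 < n%:R :> R by rewrite ltr0n.
pose g (x : d.-tuple R) := linform u x ^+ 2 / v - 1.
have mg : measurable_fun setT g.
  apply: measurable_funB => //; apply: measurable_funM => //.
  by apply: measurable_funX; exact: measurable_linform.
have hg a : `|a| <= 8^-1 ->
    (\int[P0]_w (expR (a * g (X w)))%:E <= (expR (128 * a ^+ 2))%:E)%E.
  move=> a8; have vE := qform_cov_comb_var tauP noiseE semE u.
  have := noise_comb_chi_mgf noiseE (c := total_coef B u) (a := a).
  rewrite -vE -/v => /(_ v0 a8); apply: le_trans.
  rewrite le_eqVlt; apply/orP; left; apply/eqP; apply: eq_integral => w _.
  by rewrite /g (linform_noise tauP semE).
have := @iid_sum_concentration _ _ _ _ _ _ _ P0 P n X Xs g t iXs lXs mg hg t01.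
apply: le_trans; apply: le_measure.
- rewrite inE; apply: measurable_gt_set.
  apply: measurableT_comp => //; apply: measurable_funB => //.
  by apply: measurable_qform => i j; exact: measurable_sample_covariance.
- rewrite inE -[X in measurable X]setTI; apply: measurable_fun_le => //.
  apply: measurableT_comp => //; apply: measurable_sum => i.
  exact: (measurableT_comp mg).
move=> w /= /ltW; rewrite qform_sample_covariance => h.
have -> : \sum_i g (Xs i w) =
    n%:R / v * (n%:R^-1 * \sum_i linform u (Xs i w) ^+ 2 - v).
  rewrite /g big_split/= -mulr_suml sumr_const card_ord.
  by rewrite -mulr_natl; field; rewrite !lt0r_neq0.
rewrite normrM ger0_norm; last by rewrite divr_ge0// ltW.
by rewrite -mulrA ler_wpM2l// ler_pdivlMl// mulrC.
Qed.

Lemma gaussian_sem_noise {disp : measure_display} {T : measurableType disp}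
    {R : realType} {P : probability T R} {d : nat} (X : {RV P >-> d.-tuple R})
    (B : 'M[R]_d) (sigma : 'I_d -> R) : gaussian_sem X B sigma ->
  exists eps : {RV P >-> d.-tuple R},
    gaussian_noise P (fun k w => tnth (eps w) k) sigma /\
    forall w, col_of_tuple (X w) =
      B^T *m col_of_tuple (X w) + col_of_tuple (eps w).
Proof.
move=> [_ s0 [eps [ie le se]]]; exists eps; split => //; split => // i.
exact: (measurableT_comp (measurable_tnth i) (@measurable_funPT _ _ _ _ eps)).
Qed.

Lemma rate_constant_gt0 {R : realType} : 0 < 60 * 320 ^+ 2 :> R.
Proof. exact: mulr_gt0 (ltr0Sn _ _) (exprn_gt0 2 (ltr0Sn _ _)). Qed.

Section Recovery.
Context {disp0 disp : measure_display} {T0 : measurableType disp0}.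
Context {T : measurableType disp} {R : realType}.
Variables (P0 : probability T0 R) (P : probability T R) (d q n : nat).
Variables (X eps : {RV P0 >-> d.-tuple R}) (B : 'M[R]_d) (sigma : 'I_d -> R).
Variables (tau : {perm 'I_d}) (Xs : 'I_n -> {RV P >-> d.-tuple R}) (M V : R).
Hypotheses (tauP : topological_sort B tau)
  (noiseE : gaussian_noise P0 (fun k w => tnth (eps w) k) sigma)
  (semE : forall w, col_of_tuple (X w) =
     B^T *m col_of_tuple (X w) + col_of_tuple (eps w))
  (iidXs : iid_samples X Xs) (q1d : (1 <= q <= d)%N)
  (paq : forall k, (#|pa B k| <= q)%N) (M1 : 1 < M) (V0 : 0 < V) (VM : V <= M)
  (gapV : variance_gap X B sigma = V%:E).

Let Sg := covariance_matrix X.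

Hypotheses (Sg_lb : forall u, nsq u <= M * qform Sg u u)
  (Sg_ub : forall u, qform Sg u u <= M * nsq u).
Hypothesis n_large :
  60 * 320 ^+ 2 * (M ^+ 5 / V) * (q%:R * log_ratio d q) <= n%:R.

Let S w := sample_covariance (fun i => Xs i w).
Let Net := @lattice_net d (2 * q).
Let t1 : R := (10 * M ^+ 2)^-1.
Let t2 : R := Num.sqrt (V / (200 * M ^+ 3)).
Let alpha k : R := Num.sqrt (25 * (2 * q)%N%:R * M) / sigma k.

(** The forms at the lattice points control S(z); by polarisation, those at their
   sums and differences with the scaled residual vectors control the cross terms. *)
Let test_vec (k : option ('I_d * bool) * {ffun 'I_d -> cell (2 * q)}) : 'cV[R]_d :=
  if k.1 is Some (j, b) then
    alpha (tau j) *: resid_vec B (tau j) + (-1) ^+ b *: lattice_vec k.2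
  else lattice_vec k.2.

Let test_tol (k : option ('I_d * bool) * {ffun 'I_d -> cell (2 * q)}) : R :=
  if k.1 is Some _ then t2 else t1.

Let failure k : set T := [set w |
  test_tol k * qform Sg (test_vec k) (test_vec k) <
  `|qform (S w) (test_vec k) (test_vec k) - qform Sg (test_vec k) (test_vec k)|].

Let M0 : 0 < M. Proof. exact: lt_trans M1. Qed.

Let qL1 : 1 <= q%:R * log_ratio d q :> R.
Proof.
have /andP[q1 _] := q1d; rewrite mulr_ege1 ?ler1n//.
by rewrite /log_ratio le_max lexx.
Qed.

Let n0 : (0 < n)%N.
Proof.
rewrite -(ltr_nat R); apply: lt_le_trans n_large.
apply: mulr_gt0; last by rewrite (lt_le_trans _ qL1).
exact: mulr_gt0 rate_constant_gt0 (divr_gt0 (exprn_gt0 5 M0) V0).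
Qed.

Let t1_01 : 0 <= t1 <= 1.
Proof.
rewrite invr_ge0 mulr_ge0 ?sqr_ge0//= invf_le1 ?mulr_gt0 ?exprn_gt0//.
by rewrite mulr_ege1 ?ler1n// exprn_ege1// ltW.
Qed.

Let t2_sqr : t2 ^+ 2 = V / (200 * M ^+ 3).
Proof.
apply: sqr_sqrtr; apply: divr_ge0 (ltW V0) _.
exact: mulr_ge0 (ler0n _ _) (exprn_ge0 _ (ltW M0)).
Qed.

Let t2_01 : 0 <= t2 <= 1.
Proof.
rewrite sqrtr_ge0 -sqrtr1 ler_sqrt// ler_pdivrMr ?mulr_gt0 ?exprn_gt0// mul1r.
apply: (le_trans VM); rewrite exprS mulrCA ler_peMr ?(ltW M0)//.
by rewrite mulr_ege1 ?ler1n// exprn_ege1// ltW.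
Qed.

Let measurable_failure k : measurable (failure k).
Proof.
apply: measurable_gt_set; apply: measurableT_comp => //; apply: measurable_funB => //.
by apply: measurable_qform => i j; exact: measurable_sample_covariance.
Qed.

(* With C = 60 * 320^2, n t2^2 / 512 is at least 60 q log (d / q), as
   320^2 = 200 * 512; n t1^2 / 512 is larger, as Delta <= M. *)
Let p : R := 2 * expR (- (60 * (q%:R * log_ratio d q))).

Let failure_le k : (P (failure k) <= p%:E)%E.
Proof.
pose u := test_vec k; pose v := qform Sg u u.
have v0 : 0 <= v by exact: (qform_cov_ge0 tauP noiseE semE).
have [u0|u0] := eqVneq (nsq u) 0.
  rewrite (_ : failure k = set0) ?measure0 ?lee_fin ?mulr_ge0 ?expR_ge0//.
  apply/seteqP; split => // w; move/eqP: u0; rewrite nsq_eq0 => /eqP u0.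
  by rewrite /failure /= -/u u0 /qform !mulmx0 !mxE mulr0 subrr normr0 ltxx.
have {v0} v0 : 0 < v.
  rewrite lt_def v0 andbT; apply: contra u0 => /eqP v00.
  by have := Sg_lb u; rewrite -/v v00 mulr0 eq_le nsq_ge0 andbT.
have tol01 : 0 <= test_tol k <= 1 by rewrite /test_tol; case: k.1.
have := qform_concentration tauP noiseE semE iidXs n0 tol01 v0.
move=> /le_trans; apply; rewrite lee_fin ler_wpM2l// ler_expR lerN2.
have scale (c : R) : 0 <= c -> 60 * 320 ^+ 2 * (M ^+ 5 / V) * c >= 60 ->
    60 * (q%:R * log_ratio d q) <= n%:R * c.
  move=> c0 hc; apply: (@le_trans _ _ (60 * 320 ^+ 2 * (M ^+ 5 / V) *
      (q%:R * log_ratio d q) * c)); last by rewrite ler_wpM2r.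
  by rewrite mulrAC ler_wpM2r// (le_trans _ qL1).
rewrite -mulrA; apply: scale.
  exact: divr_ge0 (sqr_ge0 _) (ler0n _ _).
have M2 : 1 <= M ^+ 2 by rewrite exprn_ege1// ltW.
rewrite /test_tol; case: k.1 => [_|].
  rewrite t2_sqr [leRHS](_ : _ = 60 * M ^+ 2); last first.
    by field; rewrite !lt0r_neq0.
  by rewrite ler_peMr.
rewrite /t1 [leRHS](_ : _ = 60 * (2 * (M / V))); last first.
  by field; rewrite !lt0r_neq0.
have MV : 1 <= M / V by rewrite ler_pdivlMr ?mul1r.
lra.
Qed.

(** There are (1 + 2d) |Net| test vectors, at most 3 exp(56 q log (d / q)), and each
   fails with probability at most 2 exp(- 60 q log (d / q)). *)
Lemma recovery_probability :
  ((1 / 2)%:E <= P [set w | (learned_dag (S w) (V%:E / 2%:E)%E q tau = dag B)%type])%E.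
Proof.
pose G := [set w | learned_dag (S w) (V%:E / 2%:E)%E q tau = dag B].
have mG : measurable G.
  by apply: measurable_learned_dag => i j; exact: measurable_sample_covariance.
have [q1 qd] := andP q1d.
have [sS sSg] : (forall w, (S w)^T = S w) /\ Sg^T = Sg.
  by split=> [w|]; [exact: sample_covariance_sym|exact: covariance_sym tauP noiseE semE].
have m0 : (0 < 2 * q)%N by rewrite muln_gt0.
have good w : (forall k, k.2 \in Net -> ~ failure k w) -> G w.
  move=> ok; have h1 f : f \in Net -> let g := lattice_vec f in
      `|qform (S w) g g - qform Sg g g| <= t1 * qform Sg g g.
    by move=> fN; have /negP := ok (None, f) fN; rewrite -leNgt.
  apply: (@learned_dag_correct _ _ (S w) Sg) => //.
  - exact: (qform_cov_ge0 tauP noiseE semE).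
  - move=> z zq z0; apply: lt_le_trans (sparse_lower m0 M1 (sS w) sSg Sg_lb Sg_ub zq h1).
    rewrite mulr_gt0// lt_def (qform_cov_ge0 tauP noiseE semE) andbT.
    apply: contra z0 => /eqP z0; rewrite -nsq_eq0 eq_le nsq_ge0 andbT.
    by have := Sg_lb z; rewrite /Sg z0 mulr0.
  - move=> j z zj zq.
    have s0 : 0 < sigma (tau j) := noise_gt0 noiseE (tau j).
    have sE := qform_resid tauP noiseE semE (tau j).
    apply: (@sparse_excess _ _ _ (S w) Sg M V m0 M1 V0 (sS w) sSg Sg_lb Sg_ub z
      (resid_vec B (tau j)) (sigma (tau j)) t2 (alpha (tau j))) => //.
    + have := Sg_ub (delta_mx (tau j) 0 : 'cV[R]_d).
      rewrite nsq_delta mulr1 (qform_cov_delta tauP noiseE semE).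
      by apply: le_trans; rewrite lerDl (qform_cov_ge0 tauP noiseE semE).
    + rewrite /alpha expr_div_n divfK ?sqr_sqrtr//; last by rewrite lt0r_neq0// exprn_gt0.
      by rewrite mulr_ge0 ?(ltW M0)// mulr_ge0.
    + by case/andP: t2_01.
    + move=> g gz; apply: (qform_resid_nd tauP noiseE semE) => l lnd.
      apply/eqP; apply: contraNT lnd => gl.
      apply: (fintype.subsetP (pred_sub_nd tauP j)).
      by apply: (fintype.subsetP zj); apply: (fintype.subsetP gz); rewrite inE.
    + move=> f b fN; have /negP := ok (Some (j, b), f) fN.
      by rewrite -leNgt.
  - move=> j A u Aj paA uA; rewrite -lee_fin -gapV.
    apply: (variance_gap_le tauP noiseE semE _ paA uA).
    exact: fintype.subset_trans Aj (pred_sub_nd tauP j).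
pose keys := [seq (k, f) | k <- enum {: option ('I_d * bool)}, f <- enum Net].
have p0 : 0 <= p by rewrite mulr_ge0// expR_ge0.
have PGc : (P (~` G) <= ((size keys)%:R * p)%:E)%E.
  apply: (union_bound (A := failure) (measurableC mG) p0 measurable_failure failure_le).
  move=> w nGw; apply: contrapT => none; apply: nGw; apply: good => -[k f] fN fk.
  apply: none; exists (k, f) => //; apply/allpairsP; exists (k, f).
  by rewrite !mem_enum.
have sizeE : (size keys)%:R = (1 + 2 * d%:R) * #|Net|%:R :> R.
  rewrite size_allpairs -!cardE card_option card_prod card_ord card_bool.
  by rewrite natrM -natr1 natrM; ring.
have half : (size keys)%:R * p <= 1 / 2.
  pose Q : R := q%:R * log_ratio d q.
  have dE : d%:R <= expR (2 * Q) by exact: card_nodes_le.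
  have NE : #|Net|%:R <= expR (54 * Q) by exact: card_net_le.
  have e1 : 1 <= expR (2 * Q).
    by rewrite -expR0 ler_expR mulr_ge0// (le_trans _ qL1).
  have e3 : (8 : R) <= expR 3.
    have -> : (8 : R) = 2 ^+ 3 by rewrite -natrX.
    rewrite -[X in expR X]mulr1 expRM_natl lerXn2r ?nnegrE ?expR_ge0//.
    by have := expR_ge1Dx (1 : R).
  rewrite sizeE /p -/Q.
  apply: (@le_trans _ _ (expR 3 * expR (2 * Q) * expR (54 * Q) * expR (- (60 * Q)))).
    have -> : (1 + 2 * d%:R) * #|Net|%:R * (2 * expR (- (60 * Q))) =
      (1 + 2 * d%:R) * 2 * #|Net|%:R * expR (- (60 * Q)) by ring.
    rewrite ler_wpM2r ?expR_ge0//; apply: ler_pM => //.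
    have : 8 * expR (2 * Q) <= expR 3 * expR (2 * Q) by rewrite ler_wpM2r ?expR_ge0.
    lra.
  rewrite -!expRD; apply: (@le_trans _ _ (expR (- 1))).
    by rewrite ler_expR; have := qL1; rewrite -/Q; lra.
  rewrite expRN div1r lef_pV2 ?posrE ?expR_gt0//.
  by have := expR_ge1Dx (1 : R).
have := probability_setC P mG; rewrite -/G => PE.
have {PGc} : (P (~` G) <= (1 / 2)%:E)%E by apply: (le_trans PGc); rewrite lee_fin.
have fG : P G \is a fin_num by exact: fin_num_measure.
rewrite PE -(fineK fG) -EFinB !lee_fin; lra.
Qed.

End Recovery.

Lemma variance_gap_no_edge {disp : measure_display} {T : measurableType disp}
    {R : realType} {P : probability T R} {d : nat} (X : {RV P >-> d.-tuple R})
    (B : 'M[R]_d) (sigma : 'I_d -> R) :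
  dag B = finset.set0 -> variance_gap X B sigma = +oo%E.
Proof.
move=> B0; apply/eqP; rewrite -leye_eq.
apply: le_bigmin => // k _; apply: le_bigmin => // A /andP[_ /finset.set0Pn[j]].
rewrite !inE => /andP[_ ejk].
have : (j, k) \in dag B by rewrite inE.
by rewrite B0 inE.
Qed.

Lemma learned_dag_infinite_threshold {R : realType} {d : nat} (S : 'M[R]_d) q
    (tau : {perm 'I_d}) : learned_dag S +oo%E q tau = finset.set0.
Proof.
apply/finset.setP => -[a b]; rewrite /learned_dag finset.in_set finset.in_set0.
rewrite /learned_parents finset.in_setD finset.in_set leey andbT.
by case: (a \in _).
Qed.

Theorem proposition4p1 (R : realType) :
  exists C c : R, [/\ 0 < C, 0 < c &
  forall (d q n : nat) (beta_min sigma2_max M delta : R)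
    (disp0 : measure_display) (T0 : measurableType disp0)
    (P0 : probability T0 R) (X : {RV P0 >-> d.-tuple R})
    (B : 'M[R]_d) (sigma : 'I_d -> R) (tau : {perm 'I_d})
    (disp : measure_display) (T : measurableType disp)
    (P : probability T R) (Xs : 'I_n -> {RV P >-> d.-tuple R}),
  0 < beta_min -> 0 < sigma2_max -> 1 < M -> (1 <= q <= d)%N ->
  0 < delta < 1 ->
  model_class X B sigma q beta_min sigma2_max M ->
  topological_sort B tau ->
  iid_samples X Xs ->
  let Delta := variance_gap X B sigma in
  (C%:E * ((M ^+ 5)%:E / Delta) *
     (q%:R * log_ratio d q + ln (1 / delta))%:E
     <= n%:R%:E)%E ->
  ((c * (1 - delta))%:E <=
   P [set w | learned_dag (sample_covariance (fun i => Xs i w))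
                (Delta / 2%:E) q tau = dag B])%E ].
Proof.
have [C C0 CE] : exists2 C : R, 0 < C & C = 60 * 320 ^+ 2.
  by exists (60 * 320 ^+ 2); first exact: rate_constant_gt0.
exists C, (1 / 2); split => //.
move=> d q n beta_min s2max M delta disp0 T0 P0 X B sigma tau disp T P Xs.
move=> _ _ M1 q1d /andP[delta0 delta1] [sem [paq _ [lmin _ lmax] _]] tauP iidXs.
move=> Delta; have M0 : 0 < M by exact: lt_trans M1.
have [eps [noiseE semE]] := gaussian_sem_noise sem.
have half : ((1 / 2 * (1 - delta))%:E <= (1 / 2)%:E)%E by rewrite lee_fin; lra.
(* Without edges, the gap and the threshold are infinite. *)
have [B0|/finset.set0Pn[[j k] jk]] := eqVneq (dag B) finset.set0.
  rewrite /Delta (variance_gap_no_edge X sigma B0) gt0_mulye; last first.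
    by rewrite inver pnatr_eq0 /= lte_fin invr_gt0.
  move=> _; rewrite (_ : [set w | _] = setT).
    by rewrite probability_setT (le_trans half)// lee_fin; lra.
  by apply/seteqP; split => // w _ /=; rewrite learned_dag_infinite_threshold.
have {}jk : edge B j k by move: jk; rewrite inE.
pose Q u := qform (covariance_matrix X) u u.
have Q0 u : 0 <= Q u := qform_cov_ge0 tauP noiseE semE u.
have d0 : (0 < d)%N by exact: leq_ltn_trans (ltn_ord j).
have sSg := covariance_sym tauP noiseE semE.
have lam u := lambda_qform d0 sSg u.
have Sg_lb u : nsq u <= M * Q u.
  rewrite -ler_pdivrMl//; apply: le_trans (lam u).1.
  by rewrite ler_wpM2r ?nsq_ge0.
have Sg_ub u : Q u <= M * nsq u.
  by apply: (le_trans (lam u).2); rewrite ler_wpM2r ?nsq_ge0.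
have gap_le : (Delta <= (Q (col k B))%:E)%E.
  rewrite -[col k B]subr0; apply: (variance_gap_le tauP noiseE semE
    (A := finset.set0)).
  - exact: finset.sub0set.
  - by rewrite finset.setD0; apply/finset.set0Pn; exists j; rewrite inE.
  - by move=> i _; rewrite mxE.
have gap_ge : (0 <= Delta)%E by exact: variance_gap_ge0 tauP noiseE semE.
have gap_fin : Delta \is a fin_num.
  by rewrite ge0_fin_numE// (le_lt_trans gap_le) ?ltry.
pose V := fine Delta; have gapV : Delta = V%:E by rewrite fineK.
have VM : V <= M.
  rewrite -lee_fin -gapV (le_trans gap_le)// lee_fin.
  have := Sg_ub (delta_mx k 0).
  rewrite nsq_delta mulr1 /Q (qform_cov_delta tauP noiseE semE).
  by apply: le_trans; rewrite lerDr sqr_ge0.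
have [q1 qd] := andP q1d.
have rate_gt0 : 0 < q%:R * log_ratio d q + ln (1 / delta) :> R.
  rewrite ltr_pwDl//; last by rewrite ln_ge0// ler_pdivlMr// mul1r ltW.
  by rewrite mulr_gt0 ?ltr0n// /log_ratio lt_max ltr01.
(* At gap zero the rate is infinite, so the sample size hypothesis fails. *)
rewrite gapV; have [V0|] := ltP 0 V; last first.
  move=> V0; have {V0} -> : V = 0.
    by apply/eqP; rewrite eq_le V0 -lee_fin -gapV.
  rewrite inver eqxx gt0_muley ?lte_fin ?exprn_gt0//.
  rewrite gt0_muley ?lte_fin ?mulr_gt0 ?exprn_gt0//.
  by rewrite gt0_mulye ?lte_fin// leye_eq.
rewrite inver (gt_eqF V0) -!EFinM lee_fin => n_large.
apply: (le_trans half).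
apply: (recovery_probability tauP noiseE semE iidXs q1d paq M1 V0 VM gapV Sg_lb Sg_ub).
apply: le_trans n_large; rewrite -CE ler_wpM2l//.
  exact: mulr_ge0 (ltW C0) (divr_ge0 (exprn_ge0 5 (ltW M0)) (ltW V0)).
by rewrite lerDl ln_ge0// ler_pdivlMr// mul1r ltW.
Qed.
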